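(* Let $\gamma:S^1\to P^2$ be a simple closed regular $C^\infty$ curve in the real projective plane that is null-homotopic. Then the total number of sextactic and inflection points on $\gamma$ is at least four.
   Context: $P^2$ is the real projective plane. Curves are $C^\infty$-parameterized and regular (nowhere vanishing tangent vector); simple means free of self-intersections. A conic is a nonsingular quadric in $P^2$. Multiplicity of intersection: if two simple regular curves $\gamma,\sigma$ meet at $p$ transversally, the multiplicity at $p$ is $1$; otherwise choose coordinates about $p$ (corresponding to $(0,0)$) in which the common tangent is the $x$-axis, write both curves locally as graphs over the $x$-axis; the multiplicity is $k+1$ if the first $k$ derivatives of the two functions agree at $0$ but not the $(k+1)$-st, and $\infty$ if all derivatives agree. A point $p$ of $\gamma$ is an inflection point if $\gamma$ and its tangent line at $p$ meet with multiplicity at least three in $p$. If $p$ is not an inflection point, there is a unique conic meeting $\gamma$ with multiplicity at least five in $p$, called the osculating conic of $\gamma$ at $p$. A point $p$ of $\gamma$ that is not an inflection point is sextactic if the osculating conic at $p$ meets $\gamma$ with multiplicity at least six in $p$. *)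

(* Defs.v *)
From HB Require Import structures.
From mathcomp Require Import all_boot all_order all_algebra generic_quotient.
From mathcomp Require Import all_classical all_reals all_analysis.

Set Implicit Arguments.
Unset Strict Implicit.
Unset Printing Implicit Defensive.

Import Order.TTheory GRing.Theory Num.Theory.
Import numFieldTopology.Exports numFieldNormedType.Exports.

Local Open Scope ring_scope.
Local Open Scope classical_set_scope.
Local Open Scope quotient_scope.

(* As a type, [circle R] carries the subspace topology of R^2. *)
Definition circle (R : realType) : set (R * R) :=
  [set z | z.1 ^+ 2 + z.2 ^+ 2 = 1].
Arguments circle : clear implicits.

Lemma cos_sin_circle (R : realType) (t : R) : (cos t, sin t) \in circle R.
Proof. by rewrite inE /circle /= cos2Dsin2. Qed.

Definition angle (R : realType) (t : R) : circle R :=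
  exist _ (cos t, sin t) (cos_sin_circle t).

Definition null_homotopic (R : realType) (X Y : topologicalType) (f : X -> Y) :=
  exists (H : X * R -> Y) (y : Y),
    [/\ {within [set: X] `*` `[0, 1], continuous H},
        forall x, H (x, 0) = f x
      & forall x, H (x, 1) = y].

Section ProjectivePlane.
Variable R : realType.

Definition nonzero_vec : set 'rV[R]_3 := [set v | v != 0].

Definition proportional (v w : nonzero_vec) : bool :=
  `[< exists k : R, set_val w = k *: set_val v >].

Lemma proportional_refl : reflexive proportional.
Proof. by move=> v; apply/asboolP; exists 1; rewrite scale1r. Qed.

Lemma proportional_sym : symmetric proportional.
Proof.
suff H v w : proportional v w -> proportional w v.
  by move=> v w; apply/idP/idP; exact: H.
move=> /asboolP[k e]; apply/asboolP; exists k^-1.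
have k0 : k != 0.
  apply: contraPneq (set_mem (valP w)) => k0; rewrite /nonzero_vec /=.
  by have -> : val w = 0 :> 'rV_3; rewrite ?eqxx// [LHS]e k0 scale0r.
by rewrite e scalerA mulVf// scale1r.
Qed.

Lemma proportional_trans : transitive proportional.
Proof.
move=> v u w /asboolP[k e] /asboolP[l f]; apply/asboolP.
by exists (l * k); rewrite f e scalerA.
Qed.

Canonical proportional_equiv :=
  EquivRel proportional proportional_refl proportional_sym proportional_trans.

Definition P2 := quotient_topology {eq_quot proportional_equiv}.

(* Homogeneous coordinates of [p], taken for a chosen representative and then
   changed by the linear map [A]; only properties that are invariant under
   rescaling are used below. *)
Definition hcoord (A : 'M[R]_3) (p : P2) : 'rV[R]_3 := set_val (repr p) *m A.

(* The affine chart [z0 : z1 : z2] |-> (z1 / z0, z2 / z0), where z = v A; it is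
   meaningful only on the affine plane z0 != 0.  The charts with [A] invertible
   form a smooth atlas of P^2. *)
Definition in_chart (A : 'M[R]_3) (p : P2) : bool := hcoord A p 0 0 != 0.
Definition chart_x (A : 'M[R]_3) (p : P2) : R := hcoord A p 0 1 / hcoord A p 0 0.
Definition chart_y (A : 'M[R]_3) (p : P2) : R :=
  hcoord A p 0 2%:R / hcoord A p 0 0.

Definition smooth_near (f : R -> R) (t : R) : Prop :=
  \forall s \near t, forall n : nat, derivable f^`(n) s 1.

Definition smooth_curve (c : R -> P2) : Prop :=
  continuous c /\
  forall (A : 'M[R]_3) (t : R), A \in unitmx -> in_chart A (c t) ->
    smooth_near (chart_x A \o c) t /\ smooth_near (chart_y A \o c) t.

Definition regular_curve (c : R -> P2) : Prop :=
  forall (A : 'M[R]_3) (t : R), A \in unitmx -> in_chart A (c t) ->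
    ~ ((chart_x A \o c)^`() t = 0 /\ (chart_y A \o c)^`() t = 0).

(* [A] gives coordinates in which p is (0,0), the tangent line of C at p is the
   x-axis and C is near p the graph y = f(x).  A simple regular curve is
   identified with its image. *)
Definition graph_at (C : set P2) (p : P2) (A : 'M[R]_3) (f : R -> R) : Prop :=
  [/\ A \in unitmx,
      [/\ in_chart A p, chart_x A p = 0 & chart_y A p = 0],
      smooth_near f 0,
      f 0 = 0 /\ f^`() 0 = 0
    & \forall q \near p, C q <-> chart_y A q = f (chart_x A q)].

(* The projective line with affine part y = 0. *)
Definition x_axis (A : 'M[R]_3) : set P2 := [set q | hcoord A q 0 2%:R = 0].

Definition tangent_line (C : set P2) (p : P2) (L : set P2) : Prop :=
  exists A f, graph_at C p A f /\ L = x_axis A.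

(* [None] stands for infinite multiplicity. *)
Definition multiplicity (C D : set P2) (p : P2) (m : option nat) : Prop :=
  (exists L M, [/\ tangent_line C p L, tangent_line D p M, L <> M
                 & m = Some 1%N])
  \/
  (exists A f g, [/\ graph_at C p A f, graph_at D p A g &
     match m with
     | Some k.+1 => (forall j, (j <= k)%N -> f^`(j) 0 = g^`(j) 0) /\
                    f^`(k.+1) 0 <> g^`(k.+1) 0
     | Some 0 => False
     | None => forall j, f^`(j) 0 = g^`(j) 0
     end]).

Definition multiplicity_ge (C D : set P2) (p : P2) (n : nat) : Prop :=
  exists m, multiplicity C D p m /\
    match m with Some k => (n <= k)%N | None => True end.

Definition inflection_point (C : set P2) (p : P2) : Prop :=
  exists L, tangent_line C p L /\ multiplicity_ge C L p 3.

(* The symmetric matrix [B] is invertible exactly when the quadric is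
   nonsingular. *)
Definition conic (Q : set P2) : Prop :=
  exists B : 'M[R]_3, [/\ B^T = B, B \in unitmx &
    Q = [set q | set_val (repr q) *m B *m (set_val (repr q))^T = 0]].

Definition osculating_conic (C : set P2) (p : P2) (Q : set P2) : Prop :=
  conic Q /\ multiplicity_ge C Q p 5.

Definition sextactic_point (C : set P2) (p : P2) : Prop :=
  ~ inflection_point C p /\
  exists Q, osculating_conic C p Q /\ multiplicity_ge C Q p 6.

End ProjectivePlane.

(* Main.v *)
(** The curve lifts to a smooth curve G in R^3 \ {0} with G(t + 2 pi) = G(t): a
    null-homotopy makes the sign monodromy trivial.  The inflection points are
    the zeros of D = det(G, G', G'').  Where D > 0, the lift y = D^(-1/3) G
    satisfies y''' = al y + be y'.  The quadratic form of the osculating conic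
    at t, evaluated along y, vanishes to order five, and its fifth derivative is
    12 q(t) with q = al - be'/2; so the zeros of q are sextactic points.

    For two coordinates w, n of y let x = n/w, m = n' w - n w' and g = (m/w)^2.
    Then d^2 g/dx^2 = -4 P, where P = w w'' - w'^2/2 - be w^2/2 has P' = q w^2.
    - Between consecutive inflection points g blows up at both ends, and a
      constant sign of q would bound g at one of them; so q vanishes.
    - If ]p, p + 2 pi[ contains no inflection point, q has three zeros in it.
      Send the tangent line at p to infinity.  The curve being simple, its polar
      angle can neither turn back nor make more than one turn, so that the curve
      becomes the graph of a convex function F on the whole line, with equal
      quadratic growth at both ends.  There g = (F'')^(-2/3), and with at most
      two zeros of q its second derivative is monotone on ]-oo, a], [a, b] and
      [b, +oo[, which is incompatible with the growth of F.

    Two or more inflection points leave two complementary arcs, each with a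
    further point; a single one leaves an arc with three sextactic points; if
    there is none, there is a sextactic point z, and three more in
    ]z, z + 2 pi[. *)
Require Import Defs.
From mathcomp Require Import all_boot all_order all_algebra generic_quotient.
From mathcomp Require Import all_classical all_reals all_analysis.
From mathcomp Require Import ring lra.

Import Order.TTheory GRing.Theory Num.Theory.
Import numFieldTopology.Exports numFieldNormedType.Exports.

Set Implicit Arguments.
Unset Strict Implicit.
Unset Printing Implicit Defensive.

Local Open Scope ring_scope.
Local Open Scope classical_set_scope.

(** * Real derivatives *)

(** The expression $g = (F'')^{-2/3}$ is the one that Halphen used for the differential equation of
    conics: a graph lies on a conic along an interval exactly when $g''' = 0$ there. The identities
    above give $d^3g/dx^3 = -4 q w^4/m$ with $m > 0$, so the sign of $q$ can be read in any chart.
    The chart is therefore chosen to suit the purpose: adapted to an inflection point for the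
    blow-up, with a tangent line at infinity for the global count. The main obstacle is to pass from
    simplicity to convexity. The condition $D > 0$ only says that the curve is locally convex, and
    such a curve may still spiral. Spirals are excluded on a cylinder around the base point, with
    the angle of $(B, C)$ and the height $A/|(B, C)|$ as coordinates. The base point then lies at
    height $+\infty$ at both ends of the arc, and turning back, or more than one turn, forces two
    branches to cross. For a lift with $G(t + 2\pi) = -G(t)$ the two ends would run to opposite
    heights and this argument would fail. *)

Definition der (R : realType) (f : R -> R) (t d : R) : Prop := is_derive t 1 f d.

Section Derivation.
Variable R : realType.
Implicit Types (f g : R -> R) (a b c t x y d e : R).

Lemma der_eq f t d e : der f t d -> d = e -> der f t e.
Proof. by move=> ? <-. Qed.

Lemma der_cst (c t : R) : der (fun=> c) t 0.
Proof. exact: is_derive_cst. Qed.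

Lemma der_id t : der (fun x : R => x) t 1.
Proof. exact: is_derive_id. Qed.

Lemma derD f g t d e : der f t d -> der g t e -> der (fun x => f x + g x) t (d + e).
Proof. by move=> ? ?; exact: is_deriveD. Qed.

Lemma derN f t d : der f t d -> der (fun x => - f x) t (- d).
Proof. by move=> ?; exact: is_deriveN. Qed.

Lemma derB f g t d e : der f t d -> der g t e -> der (fun x => f x - g x) t (d - e).
Proof. by move=> ? ?; exact: is_deriveB. Qed.

Lemma derM f g t d e : der f t d -> der g t e ->
  der (fun x => f x * g x) t (d * g t + f t * e).
Proof.
move=> df dg; have h := is_deriveM df dg; apply: (der_eq h).
by rewrite /GRing.scale /= addrC mulrC.
Qed.

Lemma derX f n t d : der f t d -> der (fun x => f x ^+ n) t (n%:R * f t ^+ n.-1 * d).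
Proof. by move=> df; have := is_deriveX n df; rewrite exprfctE => h; exact: (der_eq h). Qed.

Lemma derV f t d : f t != 0 -> der f t d -> der (fun x => (f x)^-1) t (- d * (f t)^-1 ^+ 2).
Proof.
move=> f0 df; have h := is_deriveV f0 df; apply: (der_eq h).
by rewrite /GRing.scale /= mulNr -exprVn mulrC mulNr.
Qed.

Lemma der_comp f g t d e : der f (g t) d -> der g t e -> der (fun x => f (g x)) t (d * e).
Proof.
move=> df dg; have h := is_derive1_comp df dg; exact: (der_eq h).
Qed.

Lemma der_val f t d : der f t d -> f^`() t = d.
Proof. by rewrite /der => df; rewrite derive1E derive_val. Qed.

Lemma derivable_der f t : derivable f t 1 -> der f t (derive1 f t).
Proof. by move=> df; rewrite /der derive1E; exact: derivableP. Qed.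

Lemma der_unique f t d e : der f t d -> der f t e -> d = e.
Proof. by move=> /der_val <- /der_val <-. Qed.

Lemma der_continuous f t d : der f t d -> {for t, continuous f}.
Proof. by case=> df _; apply: differentiable_continuous; apply/derivable1_diffP. Qed.

Lemma der_near f g t d : (\near t, f t = g t) -> der f t d -> der g t d.
Proof. by move=> fg df; apply: near_eq_is_derive fg df; rewrite oner_eq0. Qed.

Lemma ball_itv (t e : R) s : 0 < e -> ball t e s = (t - e < s < t + e) :> Prop.
Proof. by move=> e0; rewrite ball_itv /= in_itv. Qed.

Lemma near_itv t a b : a < t -> t < b -> \forall s \near t, a < s < b.
Proof.
by move=> at_ tb; near=> s; apply/andP; split; near: s; [exact: lt_nbhsr|exact: lt_nbhsl].
Unshelve. all: by end_near. Qed.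

Lemma near_gap (P : R -> Prop) t : (\forall s \near t, P s) ->
  exists2 e, 0 < e & forall s, t - e < s -> s < t + e -> P s.
Proof.
move=> /nbhs_ballP[e /= e0 h]; exists e => // s h1 h2; apply: h.
by rewrite ball_itv // h1 h2.
Qed.

End Derivation.

(** [der_auto] differentiates by structure towards an unknown value and leaves the comparison with
    the announced value as an equation, which [der_ring] closes. *)
Ltac der_step :=
  first [ match goal with H : forall x, der ?f x _ |- der ?f ?t _ => apply: (H t) end
        | apply: der_id | apply: der_cst | apply: derD | apply: derB | apply: derN
        | apply: derM | apply: derX | apply: derV | eassumption ].
Ltac der_auto := apply: der_eq; [repeat der_step| ..].
Ltac der_ring := der_auto; rewrite /=; ring.

(** * Monotonicity and intermediate values *)

Section MeanValue.
Variable R : realType.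
Implicit Types (f g : R -> R) (a b c t x y d e : R).

Lemma der_mvt f f1 a b : a < b -> (forall t, a <= t -> t <= b -> der f t (f1 t)) ->
  exists2 c, a < c /\ c < b & f b - f a = f1 c * (b - a).
Proof.
move=> ab df; have [t||c] := @MVT R f f1 a b ab.
- by rewrite in_itv /= => /andP[h1 h2]; apply: df; rewrite ltW.
- apply: continuous_in_subspaceT => t; rewrite inE /= in_itv /= => /andP[h1 h2].
  exact: der_continuous (df _ h1 h2).
- by rewrite in_itv /= => /andP[? ?] ?; exists c.
Qed.

Lemma der_gt0_lt f f1 a b : a < b -> (forall t, a <= t -> t <= b -> der f t (f1 t)) ->
  (forall t, a < t -> t < b -> 0 < f1 t) -> f a < f b.
Proof.
move=> ab df f0; have [c [ac cb] e] := der_mvt ab df.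
by rewrite -subr_gt0 e mulr_gt0 ?subr_gt0 // f0.
Qed.

Lemma der_lt0_gt f f1 a b : a < b -> (forall t, a <= t -> t <= b -> der f t (f1 t)) ->
  (forall t, a < t -> t < b -> f1 t < 0) -> f b < f a.
Proof.
move=> ab df f0; rewrite -ltrN2.
apply: (der_gt0_lt (f := fun t => - f t) (f1 := fun t => - f1 t)) => // t h1 h2.
  by apply: derN; apply: df.
by rewrite oppr_gt0 f0.
Qed.

Lemma der_ge0_le f f1 a b : a <= b -> (forall t, a <= t -> t <= b -> der f t (f1 t)) ->
  (forall t, a < t -> t < b -> 0 <= f1 t) -> f a <= f b.
Proof.
rewrite le_eqVlt => /predU1P[-> //|ab] df f0; have [c [ac cb] e] := der_mvt ab df.
by rewrite -subr_ge0 e mulr_ge0 ?f0 // subr_ge0 ltW.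
Qed.

Lemma der_le0_ge f f1 a b : a <= b -> (forall t, a <= t -> t <= b -> der f t (f1 t)) ->
  (forall t, a < t -> t < b -> f1 t <= 0) -> f b <= f a.
Proof.
move=> ab df f0; rewrite -lerN2.
apply: (der_ge0_le (f := fun t => - f t) (f1 := fun t => - f1 t)) => // t h1 h2.
  by apply: derN; apply: df.
by rewrite oppr_ge0 f0.
Qed.

Lemma der_eq0_cst f a b : a <= b -> (forall t, a <= t -> t <= b -> der f t 0) -> f a = f b.
Proof.
move=> ab df; apply/eqP; rewrite eq_le; apply/andP; split.
  by apply: (der_ge0_le (f1 := fun=> 0)).
by apply: (der_le0_ge (f1 := fun=> 0)).
Qed.

Lemma der_pos_incr f t d : der f t d -> 0 < d ->
  exists2 e, 0 < e & (forall s, t < s -> s < t + e -> f t < f s) /\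
                     (forall s, t - e < s -> s < t -> f s < f t).
Proof.
move=> [df dfE] d0.
have : (fun h => h^-1 *: (f (h *: (1 : R) + t) - f t)) @ 0^' --> d.
  by rewrite -dfE; exact: df.
move=> /cvgr_gt /(_ _ d0); rewrite near_withinE => h.
have [e e0 he] := near_gap h; exists e => //; split => s h1 h2.
- have := he (s - t); rewrite !add0r /GRing.scale /= mulr1 subrK.
  have st : 0 < s - t by lra.
  rewrite pmulr_rgt0 ?invr_gt0 // subr_gt0; apply; [lra|lra|].
  by rewrite gt_eqF.
- have := he (s - t); rewrite !add0r /GRing.scale /= mulr1 subrK.
  have st : s - t < 0 by lra.
  rewrite nmulr_rgt0 ?invr_lt0 // subr_lt0; apply; [lra|lra|].
  by rewrite lt_eqF.
Qed.

(** The product form of the hypothesis covers both orders of the end values, so callers need not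
    know whether [f] rises or falls. *)
Lemma ivt f a b y : a <= b -> (forall t, a <= t -> t <= b -> {for t, continuous f}) ->
  (f a - y) * (f b - y) <= 0 -> exists2 c, a <= c /\ c <= b & f c = y.
Proof.
move=> ab cf fy.
have [||c] := @IVT R f a b y ab.
- by apply: continuous_in_subspaceT => t; rewrite inE /= in_itv /= => /andP[]; exact: cf.
- have [le|/ltW le] := leP (f a) (f b).
    by rewrite ?(min_idPl le) ?(max_idPr le); apply/andP; split; nra.
  by rewrite ?(min_idPr le) ?(max_idPl le); apply/andP; split; nra.
- by rewrite in_itv /= => /andP[? ?] ?; exists c.
Qed.

Lemma nonzero_sign f a b : (forall t, a < t -> t < b -> {for t, continuous f}) ->
  (forall t, a < t -> t < b -> f t != 0) ->
  forall s t, a < s -> s < b -> a < t -> t < b -> 0 < f s * f t.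
Proof.
move=> cf f0 s t; wlog st : s t / s <= t.
  have [st|/ltW ts] := leP s t; first exact.
  by move=> /(_ t s ts) h *; rewrite mulrC; exact: h.
move=> as_ sb at_ tb; rewrite ltNge; apply/negP => le0.
have [|||c [sc ct] fc] := @ivt f s t 0 => //.
- by move=> u us ut; apply: cf; lra.
- by rewrite !subr0.
- by have := f0 c; rewrite fc eqxx => h; have : false by apply: h; lra.
Qed.

End MeanValue.

(** * Smooth functions *)

Section Smooth.
Variable R : realType.
Implicit Types (f g : R -> R) (U V : set R) (n : nat).

(** The recursion peels off one derivative at a time, so each closure property is an induction on
    [n] that applies a single differentiation rule. *)
Fixpoint Cn U n f : Prop :=
  if n is m.+1 then (forall s, U s -> derivable f s 1) /\ Cn U m (derive1 f) else True.

Definition smooth_on U f := forall n, Cn U n f.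

Lemma open_near U s : open U -> U s -> \forall r \near s, U r.
Proof. by move=> oU Us; apply: open_nbhs_nbhs. Qed.

Lemma Cn_eq U n f g : open U -> (forall s, U s -> f s = g s) -> Cn U n f -> Cn U n g.
Proof.
move=> oU; elim: n f g => //= n IH f g fg [df cf].
have dg s : U s -> der g s ((derive1 f) s).
  move=> Us; apply: der_near (derivable_der (df s Us)).
  by near=> r; apply: fg; near: r; exact: open_near.
split=> [s /dg[]//|]; apply: IH cf => s Us; by rewrite (der_val (dg s Us)).
Unshelve. all: by end_near. Qed.

(** [derive1 f] may be replaced by any formula that is right on [U] alone: as [U] is open, both
    agree near each of its points and hence in all further derivatives. *)
Lemma CnS U n f f1 : open U -> (forall s, U s -> der f s (f1 s)) -> Cn U n f1 -> Cn U n.+1 f.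
Proof.
move=> oU df cf; split=> [s /df[]//|].
by apply: Cn_eq cf => // s /df /der_val ->.
Qed.

Lemma Cn_le U n f : Cn U n.+1 f -> Cn U n f.
Proof. by elim: n f => //= n IH f [df /IH]. Qed.

Lemma CnSd U n f s : Cn U n.+1 f -> U s -> der f s ((derive1 f) s).
Proof. by move=> [df _] Us; apply: derivable_der; exact: df. Qed.

Lemma Cn_cst U n (c : R) : open U -> Cn U n (fun=> c).
Proof.
move=> oU; elim: n c => // n IH c. by apply: (CnS (f1 := fun=> 0) oU) => [s _|]; [exact: der_cst|exact: IH].
Qed.

Lemma Cn_id U n : open U -> Cn U n (fun x => x).
Proof.
move=> oU; case: n => // n.
by apply: (CnS (f1 := fun=> 1) oU) => [s _|]; [exact: der_id|exact: Cn_cst].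
Qed.

Lemma CnD U n f g : open U -> Cn U n f -> Cn U n g -> Cn U n (fun x => f x + g x).
Proof.
move=> oU; elim: n f g => // n IH f g cf cg.
apply: (CnS (f1 := (fun x => (derive1 f) x + (derive1 g) x)) oU) => [s Us|].
  by apply: derD; [exact: CnSd cf Us|exact: CnSd cg Us].
by apply: IH; [case: cf|case: cg].
Qed.

Lemma CnN U n f : open U -> Cn U n f -> Cn U n (fun x => - f x).
Proof.
move=> oU; elim: n f => // n IH f cf.
apply: (CnS (f1 := (fun x => - (derive1 f) x)) oU) => [s Us|].
  by apply: derN; exact: CnSd cf Us.
by apply: IH; case: cf.
Qed.

Lemma CnB U n f g : open U -> Cn U n f -> Cn U n g -> Cn U n (fun x => f x - g x).
Proof. by move=> oU cf cg; apply: CnD => //; exact: CnN. Qed.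

Lemma CnM U n f g : open U -> Cn U n f -> Cn U n g -> Cn U n (fun x => f x * g x).
Proof.
move=> oU; elim: n f g => // n IH f g cf cg.
apply: (CnS (f1 := (fun x => (derive1 f) x * g x + f x * (derive1 g) x)) oU) => [s Us|].
  by apply: derM; [exact: CnSd cf Us|exact: CnSd cg Us].
have [cf' cg'] := (Cn_le cf, Cn_le cg).
by apply: CnD => //; apply: IH => //; [case: cf|case: cg].
Qed.

Lemma CnX U n k f : open U -> Cn U n f -> Cn U n (fun x => f x ^+ k).
Proof.
move=> oU cf; elim: k => [|k IH]; first by apply: Cn_eq (Cn_cst n 1 oU).
by apply: Cn_eq (CnM oU cf IH) => // s _; rewrite exprS.
Qed.

Lemma CnV U n f : open U -> (forall s, U s -> f s != 0) -> Cn U n f ->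
  Cn U n (fun x => (f x)^-1).
Proof.
move=> oU f0; elim: n => // n IH cf.
apply: (CnS (f1 := (fun x => - (derive1 f) x * (f x)^-1 ^+ 2)) oU) => [s Us|].
  by apply: derV; [exact: f0|exact: CnSd cf Us].
apply: CnM => //; first by apply: CnN => //; case: cf.
by apply: CnX => //; apply: IH; exact: Cn_le.
Qed.

Lemma Cn_comp U V n f g : open U -> open V -> (forall s, U s -> V (g s)) ->
  Cn V n f -> Cn U n g -> Cn U n (fun x => f (g x)).
Proof.
move=> oU oV gUV; elim: n f => // n IH f cf cg.
apply: (CnS (f1 := (fun x => (derive1 f) (g x) * (derive1 g) x)) oU) => [s Us|].
  by apply: der_comp; [apply: CnSd cf _; exact: gUV|exact: CnSd cg Us].
apply: CnM => //; last by case: cg.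
by apply: IH; [case: cf|exact: Cn_le].
Qed.

Lemma Cn_exp U n f : open U -> Cn U n f -> Cn U n (fun x => expR (f x)).
Proof.
move=> oU; elim: n => // n IH cf.
apply: (CnS (f1 := (fun x => expR (f x) * (derive1 f) x)) oU) => [s Us|].
  by apply: der_comp; [exact: is_derive_expR|exact: CnSd cf Us].
by apply: CnM => //; [apply: IH; exact: Cn_le|case: cf].
Qed.

Lemma Cn_ln U n f : open U -> (forall s, U s -> 0 < f s) -> Cn U n f ->
  Cn U n (fun x => ln (f x)).
Proof.
move=> oU f0; case: n => // n cf.
apply: (CnS (f1 := (fun x => (f x)^-1 * (derive1 f) x)) oU) => [s Us|].
  by apply: der_comp; [apply: is_derive1_ln; exact: f0|exact: CnSd cf Us].
apply: CnM => //; last by case: cf.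
apply: CnV => //; [by move=> s /f0; exact: lt0r_neq0|exact: Cn_le].
Qed.

(* The derivative of an inverse function [g] of [x] is [1 / (x' o g)], so
   regularity is gained one order at a time. *)
Lemma Cn_inverse U V n (g x1 : R -> R) : open U -> open V ->
  (forall s, V s -> U (g s)) -> (forall s, U s -> x1 s != 0) ->
  (forall s, V s -> der g s (x1 (g s))^-1) -> Cn U n x1 -> Cn V n g.
Proof.
move=> oU oV gVU x10 dg; elim: n => // n IH cx.
apply: (CnS (f1 := fun s => (x1 (g s))^-1) oV dg).
apply: CnV => //; first by move=> s /gVU /x10.
by apply: (Cn_comp (V := U)) => //; [exact: Cn_le|apply: IH; exact: Cn_le].
Qed.

Lemma Cn_sub U V n f : V `<=` U -> Cn U n f -> Cn V n f.
Proof. by move=> VU; elim: n f => //= n IH f [df /IH]; split=> // s /VU /df. Qed.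

Lemma smooth_der U f s : smooth_on U f -> U s -> der f s ((derive1 f) s).
Proof. by move=> sf; exact: CnSd (sf 1%N). Qed.

Lemma smooth_d U f : smooth_on U f -> smooth_on U (derive1 f).
Proof. by move=> sf n; case: (sf n.+1). Qed.

Lemma smooth_onP U f :
  smooth_on U f <-> (forall n s, U s -> derivable (derive1n n f) s 1).
Proof.
split=> [sf n s Us|df].
  by elim: n f sf => [|n IH] f sf; [case: (sf 1%N) => + _; exact|
    rewrite derive1Sn; apply: IH; exact: smooth_d].
move=> n; elim: n f df => //= n IH f df; split=> [s Us|]; first exact: (df 0%N).
by apply: IH => k s Us; rewrite -derive1Sn; exact: df.
Qed.

Lemma smooth_nearP f t :
  smooth_near f t <-> exists2 e, 0 < e & smooth_on (ball t e) f.
Proof.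
split=> [/nbhs_ballP[e /= e0 h]|[e e0 /smooth_onP h]].
  by exists e => //; apply/smooth_onP => n s /h.
by apply/nbhs_ballP; exists e => // s se n; exact: h.
Qed.

Lemma smooth_continuous U f s : smooth_on U f -> U s -> {for s, continuous f}.
Proof. by move=> sf Us; apply: der_continuous (smooth_der sf Us). Qed.

Lemma smooth_sub U V f : V `<=` U -> smooth_on U f -> smooth_on V f.
Proof. by move=> VU sf n; exact: Cn_sub (sf n). Qed.

Lemma smooth_eq U f g : open U -> (forall s, U s -> f s = g s) -> smooth_on U f -> smooth_on U g.
Proof. by move=> oU fg sf n; exact: Cn_eq (sf n). Qed.

(** Vanishing to order [n] at [t]. It survives products and changes of parameter ([flatM],
    [flat_comp]), which lets orders of contact pass from the lift of the curve to its local graph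
    without Taylor expansions. *)
Fixpoint flat n f t : Prop := if n is m.+1 then f t = 0 /\ flat m (derive1 f) t else True.

Lemma flat_near n f g t : (\forall s \near t, f s = g s) -> flat n f t -> flat n g t.
Proof.
elim: n f g => //= n IH f g fg [f0 ff]; split.
  by rewrite -f0; symmetry; exact: nbhs_singleton fg.
apply: IH ff; have := near_join fg.
by apply: filterS => s fs; rewrite !derive1E; apply: near_eq_derive => //; rewrite oner_eq0.
Qed.

Lemma flatS n f f1 t : f t = 0 -> (\forall s \near t, der f s (f1 s)) ->
  flat n f1 t -> flat n.+1 f t.
Proof.
move=> f0 df ff; split=> //; apply: flat_near ff.
by apply: filterS df => s /der_val.
Qed.

Lemma flat_le n f t : flat n.+1 f t -> flat n f t.
Proof. by elim: n f => //= n IH f [f0 /IH]. Qed.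

Lemma flatD n U f g t : open U -> U t -> smooth_on U f -> smooth_on U g ->
  flat n f t -> flat n g t -> flat n (fun x => f x + g x) t.
Proof.
move=> oU Ut; elim: n f g => // n IH f g sf sg [f0 ff] [g0 fg].
apply: (@flatS _ _ (fun x => (derive1 f) x + (derive1 g) x)); first by rewrite f0 g0 addr0.
  by apply: filterS (open_near oU Ut) => s Us; apply: derD; exact: smooth_der Us.
by apply: IH => //; exact: smooth_d.
Qed.

Lemma flatM n U f g t : open U -> U t -> smooth_on U f -> smooth_on U g ->
  flat n f t -> flat n (fun x => f x * g x) t.
Proof.
move=> oU Ut; elim: n f g => // n IH f g sf sg ff.
have ff' := flat_le ff; case: ff => f0 ff.
apply: (@flatS _ _ (fun x => (derive1 f) x * g x + f x * (derive1 g) x)); first by rewrite f0 mul0r.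
  by apply: filterS (open_near oU Ut) => s Us; apply: derM; exact: smooth_der Us.
have [sf' sg'] := (smooth_d sf, smooth_d sg).
by apply: (flatD (U := U)) => //; try (by move=> k; apply: CnM); apply: IH.
Qed.

Lemma flat_comp n U V f g t : open U -> U t -> open V -> (forall s, U s -> V (g s)) ->
  smooth_on V f -> smooth_on U g -> flat n f (g t) -> flat n (fun x => f (g x)) t.
Proof.
move=> oU Ut oV gUV; elim: n f => // n IH f sf sg [f0 ff].
apply: (@flatS _ _ (fun x => (derive1 f) (g x) * (derive1 g) x)) => //.
  apply: filterS (open_near oU Ut) => s Us; apply: der_comp; last exact: smooth_der Us.
  by apply: smooth_der sf _; exact: gUV.
have [sf' sg'] := (smooth_d sf, smooth_d sg).
apply: (flatM (U := U)) => //; last exact: IH.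
by move=> k; apply: (Cn_comp (V := V)).
Qed.

Lemma flat_derive1n n f t : flat n f t -> forall j, (j < n)%N -> (derive1n j f) t = 0.
Proof.
elim: n f => // n IH f [f0 ff] [|j] jn; first exact: f0.
by rewrite derive1Sn; exact: IH.
Qed.

Lemma derive1n_near n f g t : (\forall s \near t, f s = g s) ->
  derive1n n f t = derive1n n g t.
Proof.
elim: n f g => [|n IH] f g fg; first exact: (nbhs_singleton fg).
rewrite !derive1Sn; apply: IH; apply: filterS (near_join fg) => s fs.
by rewrite !derive1E; apply: near_eq_derive => //; rewrite oner_eq0.
Qed.

Lemma derive1nB U f g t n : open U -> U t -> smooth_on U f -> smooth_on U g ->
  derive1n n (fun x => f x - g x) t = derive1n n f t - derive1n n g t.
Proof.
move=> oU Ut; elim: n f g => [|n IH] f g sf sg; first by [].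
have [sf' sg'] := (smooth_d sf, smooth_d sg).
rewrite !derive1Sn -IH //; apply: derive1n_near.
apply: filterS (open_near oU Ut) => s Us.
by apply: der_val; apply: derB; exact: smooth_der Us.
Qed.

End Smooth.

(** * Convex graphs with few sextactic points *)

Section Profile.
Variable R : realType.
Implicit Types (F Phi h : R -> R) (a b c x y : R).

(* In an affine chart sending a tangent line to infinity the curve is the graph
   of [F], and [h = F''^(-1/3)]; zeros of [(h^2)'''] are the sextactic points. *)
Record profile F Phi h h1 g2 : Prop := Profile {
  profF : forall x, der F x (Phi x);
  profPhi : forall x, der Phi x (h x ^- 3);
  prof_gt0 : forall x, 0 < h x;
  profh : forall x, der h x (h1 x);
  profg : forall x, der (fun x => 2 * (h x * h1 x)) x (g2 x);
  prof_superlinear : forall K, exists X, forall x, X <= x -> K * x <= F x /\ K * x <= F (- x) }.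

Lemma profile_opp F Phi h h1 g2 : profile F Phi h h1 g2 ->
  profile (fun x => F (- x)) (fun x => - Phi (- x)) (fun x => h (- x))
          (fun x => - h1 (- x)) (fun x => g2 (- x)).
Proof.
have dN x : der (fun y : R => - y) x (-1) by apply: derN; exact: der_id.
move=> [dF dPhi h0 dh dg big]; split=> [x|x|x|x|x|K].
- by apply: der_eq; [exact: der_comp (dF _) (dN x)|ring].
- by apply: der_eq; [apply: derN; exact: der_comp (dPhi _) (dN x)|ring].
- exact: h0.
- by apply: der_eq; [exact: der_comp (dh _) (dN x)|ring].
- have -> : (fun x => 2 * (h (- x) * - h1 (- x))) = (fun x => - (2 * (h (- x) * h1 (- x)))).
    by apply/funext => y; ring.
  apply: der_eq; last exact: opprK.
  apply: derN; apply: der_eq; first exact: (der_comp (dg _) (dN x)).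
  by rewrite mulrN1.
- have [X hX] := big K; exists X => x /hX[]; by rewrite opprK.
Qed.

(** Here [2 * (h x * h1 x)] is $g'$ for $g = h^2$. From $2 h h' \ge e$ follows $F'' = h^{-3} \le
    (2/e) h'/h^2$, and the right side is the derivative of $-(2/e)/h$. So the slope [Phi] stays
    bounded above and [F] grows at most linearly. *)
Lemma profile_no_linear_growth F Phi h h1 g2 x0 e : profile F Phi h h1 g2 ->
  0 < e -> (forall x, x0 <= x -> e <= 2 * (h x * h1 x)) -> False.
Proof.
move=> [dF dPhi h0 dh _ big] e0 he.
pose Psi x := Phi x + 2 / e * (h x)^-1.
pose dPsi x := h x ^- 3 - 2 / e * (h1 x * (h x)^-1 ^+ 2).
have dP x : der Psi x (dPsi x).
  apply: der_eq; first apply: derD (dPhi x) (derM (der_cst _ _) (derV _ (dh x))).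
    by rewrite gt_eqF.
  by rewrite /dPsi; ring.
have Phi_le x : x0 <= x -> Phi x <= Psi x0.
  move=> xx; apply: le_trans (_ : Psi x <= _).
    by rewrite /Psi lerDl mulr_ge0 ?divr_ge0 ?invr_ge0 ?ltW.
  apply: der_le0_ge xx (fun t _ _ => dP t) _ => t /ltW /he het _.
  have hp := h0 t; rewrite /dPsi.
  have -> : h t ^- 3 - 2 / e * (h1 t * (h t)^-1 ^+ 2) =
            (e - 2 * (h t * h1 t)) / (e * h t ^+ 3).
    by field; rewrite !gt_eqF.
  by rewrite pmulr_lle0 ?subr_le0 // invr_gt0 mulr_gt0 // exprn_gt0.
have [X hX] := big (Psi x0 + 1).
pose K := Psi x0.
have F_le x : x0 <= x -> F x <= F x0 + K * (x - x0).
  move=> xx; rewrite -lerBlDr.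
  suff : F x - K * x <= F x0 - K * x0 by lra.
  apply: (der_le0_ge (f := fun x => F x - K * x) (f1 := fun x => Phi x - K) xx) => t h1' h2'.
    by der_ring.
  by rewrite subr_le0; apply: Phi_le; rewrite ltW.
(* Beyond this point growth faster than slope [Psi x0 + 1] contradicts the linear bound of slope
   [Psi x0]. *)
pose x := Num.max (Num.max x0 X) (F x0 - K * x0 + 1).
have xx0 : x0 <= x by rewrite /x !le_max lexx.
have xX : X <= x by rewrite /x !le_max lexx orbT.
have xF : F x0 - K * x0 + 1 <= x by rewrite /x !le_max lexx orbT.
have [hx _] := hX x xX; have := F_le x xx0; move: hx xF; rewrite /K; lra.
Qed.

(** The positive function $g = h^2$ cannot decrease at a definite rate for ever: at
    [x0 + h x0 ^+ 2 / e] its linear upper bound reaches zero. *)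
Lemma profile_no_decay F Phi h h1 g2 x0 e : profile F Phi h h1 g2 ->
  0 < e -> (forall x, x0 <= x -> 2 * (h x * h1 x) <= - e) -> False.
Proof.
move=> [_ _ h0 dh _ _] e0 he.
have dg x : der (fun x => h x ^+ 2 + e * x) x (2 * (h x * h1 x) + e).
  by der_ring.
pose x := x0 + h x0 ^+ 2 / e.
have xx : x0 <= x by rewrite lerDl divr_ge0 ?ltW // exprn_gt0.
have := der_le0_ge xx (fun t _ _ => dg t); rewrite /= => le.
have {}le : h x ^+ 2 + e * x <= h x0 ^+ 2 + e * x0.
  by apply: le => t /ltW /he ht _; lra.
have : 0 < h x ^+ 2 by rewrite exprn_gt0.
have : e * x = e * x0 + h x0 ^+ 2 by rewrite /x; field; rewrite gt_eqF.
lra.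
Qed.

(** If the decreasing $g''$ were negative somewhere, $g'$ would tend to $-\infty$, against
    [profile_no_decay]. So $g'' > 0$ and $g'$ increases; were it nonnegative somewhere, it would
    later stay above a positive constant, against [profile_no_linear_growth]. *)
Lemma profile_right_dec F Phi h h1 g2 b : profile F Phi h h1 g2 ->
  (forall x y, b <= x -> x < y -> g2 y < g2 x) ->
  forall x, b <= x -> 0 < g2 x /\ 2 * (h x * h1 x) < 0.
Proof.
move=> P dec; have [_ _ _ _ dg _] := P.
set g1 := (fun x => 2 * (h x * h1 x)) in dg.
have g2_ge0 x : b <= x -> 0 <= g2 x.
  move=> bx; rewrite leNgt; apply/negP => gx.
  have gle y : x <= y -> g1 y - g2 x * y <= g1 x - g2 x * x.
    move=> xy; apply: (der_le0_ge (f := fun y => g1 y - g2 x * y)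
      (f1 := fun y => g2 y - g2 x) xy) => t xt _.
      by der_ring.
    by rewrite subr_le0 ltW // dec.
  apply: (profile_no_decay (x0 := Num.max x (x + (1 + g1 x) / - g2 x)) P ltr01) => y.
  rewrite ge_max => /andP[xy yy]; have := gle y xy; rewrite /g1.
  have : (1 + g1 x) <= (- g2 x) * (y - x).
    by rewrite mulrC -ler_pdivrMr ?oppr_gt0 // lerBrDl.
  rewrite /g1; lra.
have g2_gt0 x : b <= x -> 0 < g2 x.
  move=> bx; apply: (@le_lt_trans _ _ (g2 (x + 1))); first by apply: g2_ge0; lra.
  by apply: dec => //; lra.
move=> x bx; split; first exact: g2_gt0.
rewrite ltNge; apply/negP => gx.
have g1lt y z : b <= y -> y < z -> g1 y < g1 z.
  move=> by_ yz; apply: der_gt0_lt yz (fun t _ _ => dg t) _ => t yt _.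
  by apply: g2_gt0; lra.
apply: (@profile_no_linear_growth _ _ _ _ _ (x + 1) (g1 (x + 1)) P).
  by apply: le_lt_trans gx _; apply: g1lt => //; lra.
move=> y; rewrite le_eqVlt => /predU1P[<- //|xy].
by apply: ltW; apply: g1lt => //; lra.
Qed.

(** The argument of [profile_right_dec] with the two growth lemmas exchanged. *)
Lemma profile_right_inc F Phi h h1 g2 b : profile F Phi h h1 g2 ->
  (forall x y, b <= x -> x < y -> g2 x < g2 y) ->
  forall x, b <= x -> g2 x < 0 /\ 0 < 2 * (h x * h1 x).
Proof.
move=> P inc; have [_ _ _ _ dg _] := P.
set g1 := (fun x => 2 * (h x * h1 x)) in dg.
have g2_le0 x : b <= x -> g2 x <= 0.
  move=> bx; rewrite leNgt; apply/negP => gx.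
  have gle y : x <= y -> g1 x - g2 x * x <= g1 y - g2 x * y.
    move=> xy; apply: (der_ge0_le (f := fun y => g1 y - g2 x * y)
      (f1 := fun y => g2 y - g2 x) xy) => t xt _.
      by der_ring.
    by rewrite subr_ge0 ltW // inc.
  apply: (profile_no_linear_growth (x0 := Num.max x (x + (1 - g1 x) / g2 x)) P ltr01) => y.
  rewrite ge_max => /andP[xy yy]; have := gle y xy; rewrite /g1.
  have : (1 - g1 x) <= g2 x * (y - x).
    by rewrite mulrC -ler_pdivrMr // lerBrDl.
  rewrite /g1; lra.
have g2_lt0 x : b <= x -> g2 x < 0.
  move=> bx; apply: (@lt_le_trans _ _ (g2 (x + 1))); last by apply: g2_le0; lra.
  by apply: inc => //; lra.
move=> x bx; split; first exact: g2_lt0.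
rewrite ltNge; apply/negP => gx.
have g1lt y z : b <= y -> y < z -> g1 z < g1 y.
  move=> by_ yz; apply: der_lt0_gt yz (fun t _ _ => dg t) _ => t yt _.
  by apply: g2_lt0; lra.
have gx1 : g1 (x + 1) < 0 by apply: lt_le_trans gx; apply: g1lt => //; lra.
apply: (@profile_no_decay _ _ _ _ _ (x + 1) (- g1 (x + 1)) P); first by rewrite oppr_gt0.
move=> y; rewrite opprK le_eqVlt => /predU1P[<- //|xy].
by apply: ltW; apply: g1lt => //; lra.
Qed.

(* [s] is the sign of the monotonicity of [g2]. *)
Definition mono_on (s : R) (g : R -> R) (P : R -> Prop) :=
  forall x y, P x -> P y -> x < y -> 0 < s * (g y - g x).

Lemma profile_right F Phi h h1 g2 b s : profile F Phi h h1 g2 -> s = 1 \/ s = -1 ->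
  mono_on s g2 (fun x => b <= x) ->
  forall x, b <= x -> s * g2 x < 0 /\ 0 < s * (2 * (h x * h1 x)).
Proof.
move=> P [] -> mono x bx.
  rewrite !mul1r; apply: (profile_right_inc P) bx => y z by_ yz.
  by have := mono y z by_ (le_trans by_ (ltW yz)) yz; lra.
have [y z by_ yz||A B] := @profile_right_dec _ _ _ _ _ b P _ x; rewrite ?bx //; last lra.
by have := mono y z by_ (le_trans by_ (ltW yz)) yz; lra.
Qed.

Lemma profile_left F Phi h h1 g2 a s : profile F Phi h h1 g2 -> s = 1 \/ s = -1 ->
  mono_on s g2 (fun x => x <= a) ->
  forall x, x <= a -> 0 < s * g2 x /\ 0 < s * (2 * (h x * h1 x)).
Proof.
move=> P s1 mono x xa.
have s1' : - s = 1 \/ - s = -1 by case: s1 => ->; [right|left; rewrite opprK].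
have mono' : mono_on (- s) (fun x => g2 (- x)) (fun x => - a <= x).
  move=> y z y1 z1 yz; have := mono (- z) (- y); rewrite !(lerNl _ a) ltrN2.
  by move=> /(_ z1 y1 yz); lra.
have := @profile_right _ _ _ _ _ (- a) (- s) (profile_opp P) s1' mono' (- x).
by rewrite lerN2 !opprK => /(_ xa) [A B]; split; lra.
Qed.

(** If $g' > 0$, then [h] increases and $F'' = h^{-3}$ decreases. So $F''$ is at least [k2] left of
    0 and at most [k1 < k2] right of 1, and [F] cannot have the same quadratic growth rate [c] at
    both ends. *)
Lemma profile_inc F Phi h h1 g2 c : profile F Phi h h1 g2 ->
  (forall e, 0 < e -> exists X, forall x, X <= x ->
     `|F x - c * x ^+ 2| <= e * x ^+ 2 /\ `|F (- x) - c * x ^+ 2| <= e * x ^+ 2) ->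
  (forall x, 0 < 2 * (h x * h1 x)) -> False.
Proof.
move=> [dF dPhi h0 dh _ _] asym g10.
have h10 x : 0 < h1 x by have := g10 x; rewrite pmulr_rgt0 // pmulr_rgt0.
have hlt x y : x < y -> h x < h y.
  by move=> xy; apply: der_gt0_lt xy (fun t _ _ => dh t) _ => t _ _; exact: h10.
have hle x y : x <= y -> h y ^- 3 <= h x ^- 3.
  rewrite le_eqVlt => /predU1P[-> //|/hlt xy].
  by rewrite lef_pV2 ?posrE ?exprn_gt0 // lerXn2r ?nnegrE ?ltW.
pose k2 := h 0 ^- 3; pose k1 := h 1 ^- 3.
have k12 : k1 < k2.
  by rewrite /k1 /k2 ltf_pV2 ?posrE ?exprn_gt0 // ltrXn2r // ?nnegrE ?ltW ?hlt.
have Fl x : x <= 0 -> F 0 + Phi 0 * x + k2 / 2 * x ^+ 2 <= F x.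
  move=> x0.
  have Ple t : t <= 0 -> Phi t <= Phi 0 + k2 * t.
    move=> t0; rewrite -lerBlDr.
    have := @der_ge0_le _ (fun t => Phi t - k2 * t) (fun t => h t ^- 3 - k2) t 0 t0.
    rewrite mulr0 subr0; apply=> [u _ _|u _ /ltW u0].
      by der_ring.
    by rewrite subr_ge0 hle.
  have := @der_le0_ge _ (fun t => F t - Phi 0 * t - k2 / 2 * t ^+ 2)
    (fun t => Phi t - Phi 0 - k2 * t) x 0 x0.
  rewrite expr0n /= !mulr0 !subr0 => X; suff : F 0 <= F x - Phi 0 * x - k2 / 2 * x ^+ 2 by lra.
  apply: X => [u _ _|u _ /ltW /Ple]; last by lra.
  by der_auto; rewrite /=; field.
have Fr x : 1 <= x -> F x <= F 1 + Phi 1 * (x - 1) + k1 / 2 * (x - 1) ^+ 2.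
  move=> x1.
  have Ple t : 1 <= t -> Phi t <= Phi 1 + k1 * (t - 1).
    move=> t1.
    have := @der_le0_ge _ (fun t => Phi t - k1 * (t - 1)) (fun t => h t ^- 3 - k1) 1 t t1.
    rewrite subrr mulr0 subr0 => X; suff : Phi t - k1 * (t - 1) <= Phi 1 by lra.
    apply: X => [u _ _|u /ltW u0 _]; first by der_ring.
    by rewrite subr_le0 hle.
  have := @der_le0_ge _ (fun t => F t - Phi 1 * (t - 1) - k1 / 2 * (t - 1) ^+ 2)
    (fun t => Phi t - Phi 1 - k1 * (t - 1)) 1 x x1.
  rewrite subrr expr0n /= !mulr0 !subr0 => X.
  suff : F x - Phi 1 * (x - 1) - k1 / 2 * (x - 1) ^+ 2 <= F 1 by lra.
  apply: X => [u _ _|u /ltW /Ple ? _]; last by lra.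
  by der_auto; rewrite /=; field.
(* The growth rates [k2 / 2] and [k1 / 2] differ by [8 * e]. The asymptotic hypothesis accounts for
   [2 * e] and the lower order terms, bounded by [M * x], for one more [e]. *)
pose e := (k2 - k1) / 16.
have e0 : 0 < e by rewrite /e; lra.
have [X hX] := asym e e0.
pose M := `|F 0| + `|Phi 0| + `|F 1| + `|Phi 1| + 1 + k1.
have k10 : 0 < k1 by rewrite /k1 invr_gt0 exprn_gt0.
have M0 : 0 < M by rewrite /M; have := (normr_ge0 (F 0), normr_ge0 (Phi 0), normr_ge0 (F 1), normr_ge0 (Phi 1)) => -[[[]]]; lra.
pose x := Num.max (Num.max 1 X) (M / e).
have x1 : 1 <= x by rewrite /x !le_max lexx.
have xX : X <= x by rewrite /x !le_max lexx orbT.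
have xM : M <= e * x.
  by rewrite mulrC -ler_pdivrMr // /x !le_max lexx orbT.
have [] := hX x xX; rewrite !ler_norml => /andP[A _] /andP[_ B].
have := Fl (- x); have := Fr x x1.
move=> C /(_ _); rewrite sqrrN => /(_ _); move=> D0.
have {D0}D : F 0 + Phi 0 * - x + k2 / 2 * x ^+ 2 <= F (- x) by apply: D0; lra.
have xx : M * x <= e * x ^+ 2 by rewrite expr2 mulrA ler_pM2r //; lra.
have b1 : - F 0 <= `|F 0| * x.
  by rewrite (le_trans (ler_norm _)) // normrN ler_peMr.
have b2 : Phi 0 * x <= `|Phi 0| * x by rewrite ler_wpM2r ?ler_norm //; lra.
have b3 : F 1 <= `|F 1| * x by rewrite (le_trans (ler_norm _)) // ler_peMr.
have b4 : Phi 1 * (x - 1) <= `|Phi 1| * x.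
  by apply: le_trans (_ : `|Phi 1| * (x - 1) <= _); [rewrite ler_wpM2r ?ler_norm //; lra|rewrite ler_wpM2l // ?normr_ge0 //; lra].
have b5 : k1 / 2 * (x - 1) ^+ 2 <= k1 / 2 * x ^+ 2.
  by rewrite ler_pM2l; [rewrite lerXn2r ?nnegrE //; lra|lra].
have x0 : 0 < x ^+ 2 by rewrite exprn_gt0 //; lra.
have xe : 16 * (e * x ^+ 2) = k2 * x ^+ 2 - k1 * x ^+ 2 by rewrite /e; field.
have Mx : M * x = `|F 0| * x + `|Phi 0| * x + `|F 1| * x + `|Phi 1| * x + x + k1 * x.
  by rewrite /M; ring.
have kx : 0 < k1 * x by rewrite mulr_gt0 //; lra.
have ex : 0 < e * x ^+ 2 by rewrite mulr_gt0.
lra.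
Qed.

(* If [g2] is monotone at both ends in the same direction, [g'] has a constant
   sign and the two quadratic growth rates of [F] differ; if in opposite
   directions, the signs of [g'] at [a] and [b] contradict those of [g2]. *)
Lemma profile_False F Phi h h1 g2 c a b s1 s2 s3 : profile F Phi h h1 g2 ->
  (forall e, 0 < e -> exists X, forall x, X <= x ->
     `|F x - c * x ^+ 2| <= e * x ^+ 2 /\ `|F (- x) - c * x ^+ 2| <= e * x ^+ 2) ->
  a <= b -> s1 = 1 \/ s1 = -1 -> s2 = 1 \/ s2 = -1 -> s3 = 1 \/ s3 = -1 ->
  mono_on s1 g2 (fun x => x <= a) -> mono_on s2 g2 (fun x => a <= x <= b) ->
  mono_on s3 g2 (fun x => b <= x) -> False.
Proof.
move=> P asym ab s1E s2E s3E m1 m2 m3; have [_ _ h0 dh dg _] := P.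
set g1 := (fun x => 2 * (h x * h1 x)) in dg.
have L := profile_left P s1E m1; have Rt := profile_right P s3E m3.
have [ga1 ga2] := L a (lexx a); have [gb1 gb2] := Rt b (lexx b).
have mid x : a <= x -> x <= b -> s2 * (g2 x - g2 a) >= 0 /\ s2 * (g2 b - g2 x) >= 0.
  move=> ax xb; split.
    move: ax; rewrite le_eqVlt => /predU1P[->|ax]; first by rewrite subrr mulr0.
    by apply/ltW/m2 => //; rewrite ?lexx ?ab ?(ltW ax).
  move: xb; rewrite le_eqVlt => /predU1P[->|xb]; first by rewrite subrr mulr0.
  by apply/ltW/m2 => //; rewrite ?lexx ?ab ?(ltW xb) ?ax.
have [s13|s13] : s1 = s3 \/ s1 = - s3.
- by case: s1E => ->; case: s3E => ->; rewrite ?opprK; [left|right|right|left].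
- subst s1.
  (* With [s1 = s3] the end lemmas give $g''$ opposite signs at [a] and [b], which fixes the
     direction of its monotonicity in between. *)
  have s2s3 : s2 = - s3.
    have [] := mid b ab (lexx b); rewrite subrr mulr0 => mb _.
    by case: s2E mb ga1 gb1 => ->; case: s3E => ->; rewrite ?opprK => *; try lra.
  have s30 : s3 * s3 = 1 by case: s3E => ->; lra.
  (* Inside [[a, b]] a nonpositive value of [s3 * g1] between two positive ones would make [s3 * g2]
     first negative and then positive, although it decreases there. *)
  have g1s x : 0 < s3 * g1 x.
    have [xa|ax] := leP x a; first by have [] := L x xa.
    have [xb|bx] := leP b x; first by have [] := Rt x xb.
    rewrite ltNge; apply/negP => gx.
    have dsg t : der (fun t => s3 * g1 t) t (s3 * g2 t) by der_ring.
    have [u [au ux] eu] := der_mvt ax (fun t _ _ => dsg t).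
    have [v [xv vb] ev] := der_mvt bx (fun t _ _ => dsg t).
    have sc : s3 * g2 u < 0.
      rewrite -(pmulr_llt0 (x := x - a)) ?subr_gt0 // -eu subr_lt0.
      exact: le_lt_trans gx ga2.
    have sd : 0 < s3 * g2 v.
      rewrite -(pmulr_lgt0 (x := b - x)) ?subr_gt0 // -ev subr_gt0.
      exact: le_lt_trans gx gb2.
    have cd : u < v by lra.
    have := m2 u v _ _ cd; rewrite s2s3 => m; have : 0 < - s3 * (g2 v - g2 u).
      by apply: m; rewrite !ltW //; lra.
    lra.
  case: s3E g1s => -> g1s.
    by apply: (profile_inc P asym) => x; have := g1s x; rewrite /g1; lra.
  have asym' e : 0 < e -> exists X, forall x, X <= x ->
     `|F (- x) - c * x ^+ 2| <= e * x ^+ 2 /\ `|F (- - x) - c * x ^+ 2| <= e * x ^+ 2.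
    by move=> /asym[X hX]; exists X => x /hX[]; rewrite opprK.
  by apply: (profile_inc (profile_opp P) asym') => x; have := g1s (- x); rewrite /g1; lra.
- subst s1.
  have pos x : a <= x -> x <= b -> 0 <= - s3 * g2 x.
    move=> /mid m /m [m1' m2'].
    by case: s2E m1' m2' ga1 gb1 => ->; case: s3E => -> *; lra.
  have : - s3 * g1 a <= - s3 * g1 b.
    apply: (der_ge0_le (f := fun t => - s3 * g1 t) (f1 := fun t => - s3 * g2 t) ab).
      by move=> t _ _; der_ring.
    by move=> t at_ tb; apply: pos; exact: ltW.
  by move: ga2 gb2; rewrite /g1; lra.
Qed.

End Profile.

(** * Turning pieces of a simple curve *)

Section Inverse.
Variable R : realType.
Implicit Types (phi v f : R -> R) (a b p q r s t u w x y z e : R).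

Lemma mono_surj_continuous phi psi : (forall t u, t < u -> phi t < phi u) ->
  (forall y, phi (psi y) = y) -> forall y, {for y, continuous psi}.
Proof.
move=> inc can y; apply/cvgrPdist_lt => e e0; near=> z.
have psi_lt t x : phi t < x -> t < psi x.
  by move=> tx; rewrite ltNge; apply/negP; rewrite le_eqVlt => /predU1P[E|/inc];
    [move: tx; rewrite -E can ltxx|rewrite can => ?; lra].
have psi_gt t x : x < phi t -> psi x < t.
  by move=> tx; rewrite ltNge; apply/negP; rewrite le_eqVlt => /predU1P[E|/inc];
    [move: tx; rewrite E can ltxx|rewrite can => ?; lra].
have h1 : phi (psi y - e) < z.
  by near: z; apply: lt_nbhsr; rewrite -{2}(can y); apply: inc; lra.
have h2 : z < phi (psi y + e).
  by near: z; apply: lt_nbhsl; rewrite -{1}(can y); apply: inc; lra.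
by rewrite ltr_norml; have := psi_lt _ _ h1; have := psi_gt _ _ h2; lra.
Unshelve. all: by end_near. Qed.

Definition smono s phi p q := forall t u, p <= t -> t < u -> u <= q -> 0 < s * (phi u - phi t).

(** The inverse is total and continuous everywhere, so that later compositions carry no domain
    conditions. *)
Lemma inc_inverse phi p q : p <= q -> (forall t, p <= t -> t <= q -> {for t, continuous phi}) ->
  (forall t u, p <= t -> t < u -> u <= q -> phi t < phi u) ->
  exists psi, [/\ forall y, {for y, continuous psi},
    forall t, p <= t -> t <= q -> psi (phi t) = t &
    forall y, phi p <= y -> y <= phi q -> [/\ p <= psi y, psi y <= q & phi (psi y) = y]].
Proof.
move=> pq cphi inc.
(* [phi] is continued with slope [1] outside of [[p, q]]. *)
pose ext t := if t < p then phi p + (t - p) else if q < t then phi q + (t - q) else phi t.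
have ext_in t : p <= t -> t <= q -> ext t = phi t by move=> pt tq; rewrite /ext ltNge pt /= ltNge tq.
have inc' t u : p <= t -> t <= u -> u <= q -> phi t <= phi u.
  by move=> pt; rewrite le_eqVlt => /predU1P[-> //|tu] uq; apply/ltW/inc.
have ext_inc t u : t < u -> ext t < ext u.
  move=> tu; rewrite /ext; have [tp|pt] := ltP t p; have [up|pu] := ltP u p; try lra.
  - have [qu|uq] := ltP q u; first by have := inc' p q; lra.
    by have := inc' p u (lexx p) pu uq; lra.
  - have [qt|tq] := ltP q t; have [qu|uq] := ltP q u; try lra.
      by have := inc' t q pt tq (lexx q); lra.
    exact: inc.
have ext_surj y : exists t, ext t = y.
  have [yp|py] := ltP y (phi p).
    by exists (p + (y - phi p)); rewrite /ext ifT; [lra|lra].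
  have [qy|yq] := ltP (phi q) y.
    by exists (q + (y - phi q)); rewrite /ext ifF ?ifT; [lra|lra|apply/negbTE; rewrite -leNgt; lra].
  have [|t [pt tq] <-] := ivt (y := y) pq cphi; last by exists t; rewrite ext_in.
  by rewrite mulr_le0_ge0 ?subr_le0 ?subr_ge0.
have [psi psiK] := choice ext_surj.
have ext_inj t u : ext t = ext u -> t = u.
  by move=> E; have [/ext_inc|/ext_inc|//] := ltgtP t u; rewrite E ltxx.
exists psi; split.
- exact: mono_surj_continuous ext_inc psiK.
- by move=> t pt tq; apply: ext_inj; rewrite psiK ext_in.
- move=> y py yq.
  have h1 : p <= psi y.
    rewrite leNgt; apply/negP => /ext_inc; rewrite psiK ext_in //; lra.
  have h2 : psi y <= q.
    rewrite leNgt; apply/negP => /ext_inc; rewrite psiK ext_in //; lra.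
  by split=> //; rewrite -ext_in.
Qed.

Lemma smono_inverse s phi p q : s = 1 \/ s = -1 -> p <= q ->
  (forall t, p <= t -> t <= q -> {for t, continuous phi}) -> smono s phi p q ->
  exists psi, [/\ forall y, {for y, continuous psi},
    forall t, p <= t -> t <= q -> psi (phi t) = t &
    forall y, (phi p - y) * (phi q - y) <= 0 -> [/\ p <= psi y, psi y <= q & phi (psi y) = y]].
Proof.
move=> s1 pq cphi mono.
have [|t u pt tu uq|psi [c1 c2 c3]] := @inc_inverse (fun t => s * phi t) p q pq.
- move=> t pt tq; apply: continuousM; [exact: cst_continuous|exact: cphi].
- by have := mono t u pt tu uq; lra.
have ss : s * s = 1 by case: s1 => ->; lra.
have mpq : s * phi p <= s * phi q.
  by move: pq; rewrite le_eqVlt => /predU1P[-> //|pq]; have := mono p q (lexx p) pq (lexx q); lra.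
exists (fun y => psi (s * y)); split.
- move=> y; apply: (@continuous_comp _ _ _ (fun y => s * y) psi); last exact: c1.
  by apply: continuousM; [exact: cst_continuous|move=> ?].
- exact: c2.
- move=> y y1.
  have [||h1 h2 h3] := c3 (s * y).
  + by case: s1 mpq => -> *; nra.
  + by case: s1 mpq => -> *; nra.
  + by split=> //; have := congr1 ( *%R s) h3; rewrite !mulrA ss !mul1r.
Qed.

End Inverse.

Section Turning.
Variable R : realType.
Implicit Types (phi v f : R -> R) (a b p q r s t u w x y z e : R).

Definition cont_on f p q := forall t, p <= t -> t <= q -> {for t, continuous f}.

Lemma smono_ge s phi p q t u : smono s phi p q -> p <= t -> t <= u -> u <= q ->
  0 <= s * (phi u - phi t).
Proof.
move=> mono pt; rewrite le_eqVlt => /predU1P[->|tu uq]; first by rewrite subrr mulr0.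
by apply/ltW/mono.
Qed.

(** Both arcs are graphs over the [phi] axis, and the second one covers the range of the first.
    Along the first arc the difference of height to the second changes sign. *)
Lemma crossing phi1 v1 phi2 v2 i0 i1 j0 j1 b0 b1 s1 s2 :
  s1 = 1 \/ s1 = -1 -> s2 = 1 \/ s2 = -1 -> i0 <= i1 -> j0 <= j1 ->
  cont_on phi1 i0 i1 -> cont_on v1 i0 i1 -> cont_on phi2 j0 j1 -> cont_on v2 j0 j1 ->
  smono s1 phi1 i0 i1 -> smono s2 phi2 j0 j1 ->
  j0 <= b0 -> b0 <= j1 -> j0 <= b1 -> b1 <= j1 ->
  phi1 i0 = phi2 b0 -> phi1 i1 = phi2 b1 ->
  (v1 i0 - v2 b0) * (v1 i1 - v2 b1) <= 0 ->
  exists x y, [/\ i0 <= x, x <= i1, j0 <= y, y <= j1 & phi1 x = phi2 y /\ v1 x = v2 y].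
Proof.
move=> s11 s21 i01 j01 cp1 cv1 cp2 cv2 m1 m2 h1 h2 h3 h4 e0 e1 prod.
have [psi [cpsi psiK1 psiK2]] := smono_inverse s21 j01 cp2 m2.
have rng t : i0 <= t -> t <= i1 -> (phi2 j0 - phi1 t) * (phi2 j1 - phi1 t) <= 0.
  move=> it ti; have := smono_ge m1 (lexx i0) it ti; have := smono_ge m1 it ti (lexx i1).
  rewrite e0 e1.
  have := smono_ge m2 (lexx j0) h1 h2; have := smono_ge m2 h1 h2 (lexx j1).
  have := smono_ge m2 (lexx j0) h3 h4; have := smono_ge m2 h3 h4 (lexx j1).
  by case: s11 => ->; case: s21 => -> *; nra.
have [||t [it ti] ft] := @ivt _ (fun t => v1 t - v2 (psi (phi1 t))) i0 i1 0 i01.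
- move=> t it ti; have [a1 a2 _] := psiK2 _ (rng t it ti).
  apply: continuousB; first exact: cv1.
  apply: (@continuous_comp _ _ _ (fun t => psi (phi1 t)) v2); last exact: cv2.
  by apply: (@continuous_comp _ _ _ phi1 psi); [exact: cp1|exact: cpsi].
- by rewrite !subr0 e0 e1 !psiK1.
have [a1 a2 a3] := psiK2 _ (rng t it ti).
by exists t, (psi (phi1 t)); split=> //; split; [rewrite a3|lra].
Qed.

Definition incr_at s v q := exists2 e, 0 < e &
  (forall t, q < t -> t < q + e -> 0 < s * (v t - v q)) /\
  (forall t, q - e < t -> t < q -> 0 < s * (v q - v t)).

(** Angles are compared on the line; coincidences modulo a full turn are left to [full_turn]. *)
Definition simple_on phi v p r := forall t u, p <= t -> t < u -> u <= r ->
  phi t = phi u -> v t <> v u.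

Lemma cont_sub f p q t u : p <= t -> u <= q -> cont_on f p q -> cont_on f t u.
Proof. by move=> pt uq cf x tx xu; apply: cf; lra. Qed.

Lemma smono_sub s f p q t u : p <= t -> u <= q -> smono s f p q -> smono s f t u.
Proof. by move=> pt uq mf x y tx xy yu; apply: mf; lra. Qed.

(* Next to the turning point [q] the branch on the [k] side is higher; the two
   branches cannot change order without crossing. *)
Lemma fold_side phi v p q r s k : s = 1 \/ s = -1 -> k = 1 \/ k = -1 -> p < q -> q < r ->
  cont_on phi p r -> cont_on v p r -> smono s phi p q -> smono (- s) phi q r ->
  incr_at k v q -> simple_on phi v p r ->
  forall u w, p <= u -> u < q -> q < w -> w <= r -> phi u = phi w -> 0 < k * (v w - v u).
Proof.
move=> s1 k1 pq qr cp cv m1 m2 [e e0 [er el]] sim u w pu uq qw wr uw.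
rewrite ltNge; apply/negP => neg.
have s1' : - s = 1 \/ - s = -1 by case: s1 => ->; [right|left; rewrite opprK].
(* Take one parameter on each side of [q], within reach of [incr_at]. The one with the lower value
   of [s * phi] is moved towards [q] until both are level. *)
have [u' [w' [uu' u'q qw' w'w [uw' lt]]]] : exists u' w',
  [/\ u <= u', u' < q, q < w', w' <= w & phi u' = phi w' /\ 0 < k * (v w' - v u')].
  pose u1 := Num.max u (q - e / 2); pose w1 := Num.min w (q + e / 2).
  have u1P : [/\ u <= u1, u1 < q & q - e < u1].
    by rewrite /u1; split; [rewrite le_max lexx|rewrite gt_max; lra|rewrite lt_max; lra].
  have w1P : [/\ w1 <= w, q < w1 & w1 < q + e].
    by rewrite /w1; split; [rewrite ge_min lexx|rewrite lt_min; lra|rewrite gt_min; lra].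
  case: u1P => u11 u12 u13; case: w1P => w11 w12 w13.
  have A := m1 u1 q (le_trans pu u11) u12 (lexx q).
  have B := m2 q w1 (lexx q) w12 (le_trans w11 wr).
  have [le|le] := leP (s * phi w1) (s * phi u1).
    have [|||w' [qw' w'w1] E] := @ivt _ phi q w1 (phi u1).
    + exact: ltW.
    + by apply: cont_sub cp; lra.
    + by case: (s1) le A B => -> *; nra.
    have qw'' : q < w'.
      rewrite lt_neqAle qw' andbT; apply/negP => /eqP F; move: A; rewrite -E -F subrr mulr0; lra.
    exists u1, w'; split => //; first lra.
    split=> //; have := el _ u13 u12; have := er w' qw'' (le_lt_trans w'w1 w13); lra.
  have [|||u' [u1u' u'q] E] := @ivt _ phi u1 q (phi w1).
  + exact: ltW.
  + by apply: cont_sub cp; lra.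
  + by case: (s1) le A B => -> *; nra.
  have u'q' : u' < q.
    rewrite lt_neqAle u'q andbT; apply/negP => /eqP F; move: B; rewrite -E -F subrr mulr0; lra.
  exists u', w1; split => //; first lra.
  split=> //; have := el _ (lt_le_trans u13 u1u') u'q'; have := er _ w12 w13; lra.
have := @crossing phi v phi v u u' w' w w w' s (- s) s1 s1' uu' w'w.
case.
- by apply: cont_sub cp; lra.
- by apply: cont_sub cv; lra.
- by apply: cont_sub cp; lra.
- by apply: cont_sub cv; lra.
- by apply: smono_sub m1; lra.
- by apply: smono_sub m2; lra.
- by [].
- by [].
- by [].
- by [].
- by [].
- by [].
- by case: k1 neg lt => -> *; nra.
move=> x [y [h1 h2 h3 h4 [h5 h6]]].
by apply: (sim x y _ _ _ h5 h6); lra.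
Qed.

(* By [fold_side] at [q] and at [r] the outer branches are in opposite order at
   the two ends of the middle piece, hence cross. *)
Lemma no_short_piece phi v p q r z s : s = 1 \/ s = -1 -> p < q -> q < r -> r < z ->
  cont_on phi p z -> cont_on v p z ->
  smono s phi p q -> smono (- s) phi q r -> smono s phi r z ->
  incr_at s v q -> incr_at (- s) v r -> simple_on phi v p z ->
  `|phi r - phi q| <= `|phi q - phi p| -> `|phi r - phi q| <= `|phi z - phi r| -> False.
Proof.
move=> s1 pq qr rz cp cv m1 m2 m3 iq ir sim l1 l2.
have s1' : - s = 1 \/ - s = -1 by case: s1 => ->; [right|left; rewrite opprK].
have norm1 t : t = 1 \/ t = -1 -> forall x, 0 < t * x -> `|x| = t * x.
  by move=> [] -> x; rewrite ?mul1r ?mulN1r => x0; [rewrite gtr0_norm|rewrite ltr0_norm //; lra].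
have A := m1 p q (lexx p) pq (lexx q); have B := m2 q r (lexx q) qr (lexx r).
have C := m3 r z (lexx r) rz (lexx z).
move: l1 l2; rewrite (norm1 _ s1 _ A) (norm1 _ s1' _ B) (norm1 _ s1 _ C) => l1 l2.
(* The outer pieces are at least as long as the middle one, so they reach the levels of its ends:
   [u] is level with [r], and below [w] is level with [q]. *)
have [|||u [pu uq] E] := @ivt _ phi p q (phi r).
- exact: ltW.
- by apply: cont_sub cp; lra.
- by case: (s1) A B l1 => -> *; nra.
have uq' : u < q.
  rewrite lt_neqAle uq andbT; apply/negP => /eqP F; move: B; rewrite -E F subrr mulr0; lra.
have [|||w [rw wz] F] := @ivt _ phi r z (phi q).
- exact: ltW.
- by apply: cont_sub cp; lra.
- by case: (s1) B C l2 => -> *; nra.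
have rw' : r < w.
  rewrite lt_neqAle rw andbT; apply/negP => /eqP G; move: B; rewrite -F -G subrr mulr0; lra.
have sub1 : simple_on phi v p r by move=> ? ? ? ? ?; apply: sim => //; lra.
have sub2 : simple_on phi v q z by move=> ? ? ? ? ?; apply: sim => //; lra.
have cps x y : p <= x -> y <= z -> cont_on phi x y by move=> ? ?; apply: cont_sub cp.
have cvs x y : p <= x -> y <= z -> cont_on v x y by move=> ? ?; apply: cont_sub cv.
have f1 : 0 < s * (v r - v u).
  apply: (@fold_side phi v p q r s s s1 s1 pq qr _ _ m1 m2 iq sub1 u r pu uq' qr (lexx r) E).
    by apply: cps; lra.
  by apply: cvs; lra.
have m3' : smono (- - s) phi r z by rewrite opprK.
have f2 : 0 < - s * (v w - v q).
  apply: (@fold_side phi v q r z (- s) (- s) s1' s1' qr rz _ _ m2 m3' ir sub2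
    q w (lexx q) qr rw' wz (esym F)).
    by apply: cps; lra.
  by apply: cvs; lra.
have := @crossing phi v phi v u q r w r w s s s1 s1 (ltW uq') (ltW rw').
case.
- by apply: cont_sub cp; lra.
- by apply: cont_sub cv; lra.
- by apply: cont_sub cp; lra.
- by apply: cont_sub cv; lra.
- by apply: smono_sub m1; lra.
- by apply: smono_sub m3; lra.
- by [].
- exact: ltW.
- exact: ltW.
- by [].
- by [].
- by [].
- by case: s1 f1 f2 => -> *; nra.
move=> x [y [h1 h2 h3 h4 [h5 h6]]].
by apply: (sim x y _ _ _ h5 h6); lra.
Qed.

(** Otherwise the piece after [q] comes back to the level of [p]. By [fold_side] it is then higher
    than [v p], against the bound on [v]. *)
Lemma first_piece phi v p q r : p < q -> q < r -> cont_on phi p r -> cont_on v p r ->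
  smono 1 phi p q -> smono (-1) phi q r -> incr_at 1 v q -> simple_on phi v p r ->
  (forall t, q <= t -> t <= r -> v t < v p) -> phi p < phi r.
Proof.
move=> pq qr cp cv m1 m2 iq sim vp; rewrite ltNge; apply/negP => rp.
have A := m1 p q (lexx p) pq (lexx q); have B := m2 q r (lexx q) qr (lexx r).
have [|||w [qw wr] E] := @ivt _ phi q r (phi p).
- exact: ltW.
- by apply: cont_sub cp; lra.
- by nra.
have qw' : q < w.
  rewrite lt_neqAle qw andbT; apply/negP => /eqP G; move: A; rewrite -E -G subrr mulr0; lra.
have := @fold_side phi v p q r 1 1 (or_introl erefl) (or_introl erefl) pq qr cp cv m1 m2 iq sim
  p w (lexx p) pq qw' wr (esym E).
have := vp w qw wr; lra.
Qed.

(** The counterpart of [first_piece] at the other end: a return to the level of [z] before [r] would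
    lie above [v z]. *)
Lemma last_piece phi v q r z : q < r -> r < z -> cont_on phi q z -> cont_on v q z ->
  smono (-1) phi q r -> smono 1 phi r z -> incr_at (-1) v r -> simple_on phi v q z ->
  (forall t, q <= t -> t <= r -> v t < v z) -> phi q < phi z.
Proof.
move=> qr rz cp cv m1 m2 iq sim vp; rewrite ltNge; apply/negP => rp.
have A := m1 q r (lexx q) qr (lexx r); have B := m2 r z (lexx r) rz (lexx z).
have [|||u [qu ur] E] := @ivt _ phi q r (phi z).
- exact: ltW.
- by apply: cont_sub cp; lra.
- by nra.
have ur' : u < r.
  rewrite lt_neqAle ur andbT; apply/negP => /eqP G; move: B; rewrite -E G subrr mulr0; lra.
have := @fold_side phi v q r z (-1) (-1) (or_intror erefl) (or_intror erefl) qr rz cp cv m1.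
rewrite opprK => /(_ m2 iq sim u z qu ur' rz (lexx z) E).
have := vp u qu ur; lra.
Qed.

End Turning.

(** * Zeros of the angular velocity *)

Section Zeros.
Variable R : realType.
Implicit Types (phi v f m : R -> R) (a b p q r s t u w x y z e : R).

Lemma continuous_gt0_near f t : {for t, continuous f} -> 0 < f t ->
  exists2 e, 0 < e & forall s, t - e < s -> s < t + e -> 0 < f s.
Proof.
move=> cf ft; apply: near_gap.
by have /cvgr_gt := cf; apply.
Qed.

Lemma isolated_zero m d t : der m t d -> (m t = 0 -> d <> 0) ->
  exists2 e, 0 < e & forall s, t - e < s -> s < t + e -> m s = 0 -> s = t.
Proof.
move=> dm d0; have cm := der_continuous dm.
have [mt|mt|mt] := ltgtP (m t) 0.
- have [||e e0 he] := @continuous_gt0_near (fun t => - m t) t.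
  + exact: der_continuous (derN dm).
  + by rewrite oppr_gt0.
  + by exists e => // s h1 h2 ms; have := he s h1 h2; rewrite ms; lra.
- have [e e0 he] := continuous_gt0_near cm mt.
  by exists e => // s h1 h2 ms; have := he s h1 h2; rewrite ms; lra.
- have [dpos|dneg|/(d0 mt)//] := ltgtP d 0.
  + have [|e e0 [h1 h2]] := der_pos_incr (derN dm); first by rewrite oppr_gt0.
    exists e => // s a1 a2 ms; have [st|ts|//] := ltgtP s t.
      by have := h2 s a1 st; rewrite ms mt; lra.
    by have := h1 s ts a2; rewrite ms mt; lra.
  + have [e e0 [h1 h2]] := der_pos_incr dm dneg.
    exists e => // s a1 a2 ms; have [st|ts|//] := ltgtP s t.
      by have := h2 s a1 st; rewrite ms mt; lra.
    by have := h1 s ts a2; rewrite ms mt; lra.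
Qed.

(** Every point has a ball in which at most its centre is a zero; by compactness all zeros are among
    the centres of a finite subcover. *)
Lemma finite_zeros m (m1 : R -> R) a b : (forall t, a <= t -> t <= b -> der m t (m1 t)) ->
  (forall t, a <= t -> t <= b -> m t = 0 -> m1 t <> 0) ->
  exists zs : seq R, sorted <%O zs /\ forall t, (t \in zs) = [&& a <= t, t <= b & m t == 0].
Proof.
move=> dm m10.
have iso t : exists e, 0 < e /\ (a <= t -> t <= b ->
    forall s, t - e < s -> s < t + e -> m s = 0 -> s = t).
  have [/andP[at_ tb]|H] := boolP ((a <= t) && (t <= b)).
    by have [e e0 he] := isolated_zero (dm t at_ tb) (m10 t at_ tb); exists e.
  by exists 1; split=> // at_ tb; rewrite at_ tb in H.
have [e he] := choice iso.
have := @segment_compact R a b; rewrite compact_cover.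
move=> /(_ R `[a, b] (fun t => ball t (e t))) [||D DS cov].
- by move=> t _; exact: ball_open.
- move=> t tab; exists t => //; apply: ballxx; exact: (he t).1.
pose zs := sort <=%O [seq t <- finmap.enum_fset D | [&& a <= t, t <= b & m t == 0]].
exists zs; split.
  by rewrite lt_sorted_uniq_le sort_uniq filter_uniq ?sort_sorted ?finmap.fset_uniq //; exact: le_total.
move=> t; rewrite mem_sort mem_filter andbC; apply/andP/idP => [[]//|tP]; split=> //.
have /and3P[at_ tb /eqP mt] := tP.
have [|u /= uD ut] := cov t; first by rewrite /= in_itv /= at_ tb.
have := DS u uD.
rewrite inE /= in_itv /= => /andP[au ub].
have [e0 hu] := he u; move: ut; rewrite ball_itv // => /andP[h1 h2].
by rewrite (hu au ub t h1 h2 mt).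
Qed.

Lemma der_incr_at v t d s : der v t d -> 0 < s * d -> incr_at s v t.
Proof.
move=> dv sd; have dsv : der (fun x => s * v x) t (s * d) by der_ring.
have [e e0 [h1 h2]] := der_pos_incr dsv sd.
exists e => //; split=> u u1 u2; first by have := h1 u u1 u2; lra.
by have := h2 u u1 u2; lra.
Qed.

(* The zeros of [m] cut the curve into pieces.  The end pieces are the longer
   ones of their pairs, so that among the pieces there is one that is not longer
   than both neighbours, which [no_short_piece] forbids. *)
Lemma no_turning phi v m (k m1 v1 : R -> R) a b a' b' : a < b ->
  (forall t, a <= t -> t <= b -> der phi t (m t * k t)) ->
  (forall t, a <= t -> t <= b -> 0 < k t) ->
  (forall t, a <= t -> t <= b -> der m t (m1 t)) ->
  (forall t, a <= t -> t <= b -> der v t (v1 t)) ->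
  (forall t, a <= t -> t <= b -> m t = 0 -> m1 t * v1 t < 0) ->
  0 < m a -> 0 < m b -> simple_on phi v a b ->
  (forall t, a <= t -> t <= b -> m t = 0 -> a' <= t /\ t <= b') ->
  (forall t, a' <= t -> t <= b' -> v t < v a /\ v t < v b) ->
  forall t, a <= t -> t <= b -> 0 < m t.
Proof.
move=> ab dphi k0 dm dv turn ma mb sim inner vmax.
have cm t : a <= t -> t <= b -> {for t, continuous m}.
  by move=> h1 h2; exact: der_continuous (dm t h1 h2).
have [|zs [zs_sorted zsP]] := @finite_zeros m m1 a b dm.
  by move=> t h1 h2 mt E; have := turn t h1 h2 mt; rewrite E mul0r ltxx.
pose n := size zs; pose ns := a :: rcons zs b; pose node j := nth b ns j.
have ns_sorted : sorted <%O ns.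
  rewrite /ns /= -cats1 cat_path /= andbT; apply/andP; split.
    rewrite (path_sortedE lt_trans) zs_sorted andbT; apply/allP => t; rewrite zsP.
    case/and3P=> h1 h2 /eqP h3; rewrite lt_neqAle h1 andbT; apply/negP => /eqP E.
    by move: ma; rewrite E h3 ltxx.
  have := mem_last a zs; rewrite inE => /predU1P[->//|]; rewrite zsP.
  case/and3P=> h1 h2 /eqP h3; rewrite lt_neqAle h2 andbT; apply/negP => /eqP E.
  by move: mb; rewrite -E h3 ltxx.
have ns_size : size ns = n.+2 by rewrite /ns /= size_rcons.
have node_lt i j : (i < n.+2)%N -> (j < n.+2)%N -> (node i < node j) = (i < j)%N.
  by move=> h1 h2; apply: lt_sorted_ltn_nth => //; rewrite inE ns_size.
have node_le i j : (i < n.+2)%N -> (j < n.+2)%N -> (i <= j)%N -> node i <= node j.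
  by move=> h1 h2 h3; rewrite leNgt node_lt // -leqNgt.
have node0 : node 0%N = a by [].
have nodeb : node n.+1 = b by rewrite /node /ns /= nth_rcons ltnn eqxx.
have node_in j : (j < n.+2)%N -> a <= node j /\ node j <= b.
  move=> jn; have A := node_le 0%N j isT jn (leq0n j).
  by have B := node_le j n.+1 jn (leqnn _) jn; rewrite node0 in A; rewrite nodeb in B.
have node_zero j : (j < n)%N -> m (node j.+1) = 0.
  move=> jn; rewrite /node /ns /= nth_rcons jn.
  by have := mem_nth b jn; rewrite zsP => /and3P[_ _ /eqP].
have node_gap j t : (j <= n)%N -> node j < t -> t < node j.+1 -> m t != 0.
  move=> jn h1 h2; apply/negP => /eqP mt.
  have [[aj _] [_ jb]] := (node_in j (leqW jn), node_in j.+1 jn).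
  have : t \in zs by rewrite zsP mt eqxx !andbT; apply/andP; split; lra.
  move=> /[dup] tz; rewrite -index_mem => ti.
  have E : t = node (index t zs).+1 by rewrite /node /ns /= nth_rcons ti nth_index.
  have i2 : ((index t zs).+1 < n.+2)%N by exact: leqW.
  have j2 : (j < n.+2)%N by exact: leqW.
  move: h1 h2; rewrite E node_lt // node_lt // !ltnS => h1 h2.
  by have := leq_trans h2 h1; rewrite ltnn.
(* The zeros of [m] are simple, because [turn] excludes [m1 t = 0] there. So [m] alternates in sign
   from piece to piece, starting positive after [a]. *)
pose sg j : R := (-1) ^+ j.
have sg1 j : sg j = 1 \/ sg j = -1.
  by elim: j => [|j [E|E]]; rewrite /sg; [left|right|left]; rewrite ?expr0 // exprS -/(sg j) E; lra.
have sgS j : sg j.+1 = - sg j by rewrite /sg exprS mulN1r.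
have same_sign j t u : (j <= n)%N -> node j < t -> t < node j.+1 -> node j < u ->
    u < node j.+1 -> 0 < m t * m u.
  move=> jn t1 t2 u1 u2.
  have [[aj _] [_ jb]] := (node_in j (leqW jn), node_in j.+1 jn).
  apply: (@nonzero_sign _ m (node j) (node j.+1)) => //.
    by move=> w w1 w2; apply: cm; lra.
  by move=> w w1 w2; exact: node_gap w2.
have node_S j : (j <= n)%N -> node j < node j.+1 by move=> jn; rewrite node_lt // leqW.
have signE j t u : (j <= n)%N -> node j < t -> t < node j.+1 -> 0 < sg j * m t ->
    node j < u -> u < node j.+1 -> 0 < sg j * m u.
  move=> jn t1 t2 st u1 u2; have := same_sign j t u jn t1 t2 u1 u2.
  by case: (sg1 j) st => -> *; nra.
have sgn_piece j : (j <= n)%N -> forall t, node j < t -> t < node j.+1 -> 0 < sg j * m t.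
  elim: j => [|j IH] jn t t1 t2.
    have [e e0 he] := continuous_gt0_near (cm a (lexx a) (ltW ab)) ma.
    have S0 := node_S 0%N jn.
    pose u := Num.min ((node 0%N + node 1%N) / 2) (node 0%N + e / 2).
    have uP : [/\ node 0%N < u, u < node 1%N & u < node 0%N + e].
      by rewrite /u; split; [rewrite lt_min; lra|rewrite gt_min; lra|rewrite gt_min; lra].
    case: uP => u1 u2 u3; apply: (signE 0%N u) => //.
    by rewrite /sg expr0 mul1r; apply: he; rewrite -node0; lra.
  have jn' := ltnW jn; have S0 := node_S j jn'; have S1 := node_S j.+1 jn.
  have [z1 z2] := node_in j.+1 (leqW jn).
  have mz := node_zero j jn.
  have d1 := dm _ z1 z2; have tz := turn _ z1 z2 mz.
  have dneg : 0 < sg j.+1 * m1 (node j.+1).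
    rewrite sgS ltNge; apply/negP => pos.
    have {}pos : 0 < sg j * m1 (node j.+1).
      rewrite lt_neqAle; apply/andP; split; last lra.
      by apply/negP => /eqP E; move: tz; case: (sg1 j) E => -> E; have -> : m1 (node j.+1) = 0 by [lra]; rewrite mul0r ltxx.
    have [e e0 [_ he]] := der_incr_at d1 pos.
    pose u := Num.max ((node j + node j.+1) / 2) (node j.+1 - e / 2).
    have uP : [/\ node j < u, u < node j.+1 & node j.+1 - e < u].
      by rewrite /u; split; [rewrite lt_max; lra|rewrite gt_max; lra|rewrite lt_max; lra].
    case: uP => u1 u2 u3; have := he u u3 u2; rewrite mz.
    by have := IH jn' u u1 u2; lra.
  have [e e0 [he _]] := der_incr_at d1 dneg.
  pose u := Num.min ((node j.+1 + node j.+2) / 2) (node j.+1 + e / 2).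
  have uP : [/\ node j.+1 < u, u < node j.+2 & u < node j.+1 + e].
    by rewrite /u; split; [rewrite lt_min; lra|rewrite gt_min; lra|rewrite gt_min; lra].
  case: uP => u1 u2 u3; apply: (signE j.+1 u) => //.
  by have := he u u1 u3; rewrite mz subr0.
(* At the end of piece [j] the function [m] leaves the sign [sg j], so [m1] has the sign [- sg j],
   and by [turn] the sign of [v1] is [sg j]. *)
have v_turn j : (j < n)%N -> incr_at (sg j) v (node j.+1).
  move=> jn; have [z1 z2] := node_in j.+1 (leqW jn).
  have mz := node_zero j jn; have S0 := node_S j (ltnW jn).
  apply: der_incr_at (dv _ z1 z2) _.
  have tz := turn _ z1 z2 mz; rewrite ltNge; apply/negP => neg.
  have pos : 0 < sg j * m1 (node j.+1) by case: (sg1 j) neg => -> *; nra.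
  have [e e0 [_ he]] := der_incr_at (dm _ z1 z2) pos.
  pose u := Num.max ((node j + node j.+1) / 2) (node j.+1 - e / 2).
  have uP : [/\ node j < u, u < node j.+1 & node j.+1 - e < u].
    by rewrite /u; split; [rewrite lt_max; lra|rewrite gt_max; lra|rewrite lt_max; lra].
  case: uP => u1 u2 u3; have := he u u3 u2; rewrite mz.
  by have := sgn_piece j (ltnW jn) u u1 u2; lra.
have mono j : (j <= n)%N -> smono (sg j) phi (node j) (node j.+1).
  move=> jn t u t1 tu u2.
  have [[aj _] [_ jb]] := (node_in j (leqW jn), node_in j.+1 jn).
  suff : sg j * phi t < sg j * phi u by lra.
  apply: (der_gt0_lt (f := fun x => sg j * phi x) (f1 := fun x => sg j * (m x * k x)) tu).
    move=> w w1 w2; have D : der phi w (m w * k w) by apply: dphi; lra.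
    by der_ring.
  move=> w w1 w2; rewrite mulrA mulr_gt0 //; last by apply: k0; lra.
  by apply: (sgn_piece j jn); lra.
have cphi p q : a <= p -> q <= b -> cont_on phi p q.
  by move=> h1 h2 t h3 h4; apply: der_continuous (dphi t _ _); lra.
have cv p q : a <= p -> q <= b -> cont_on v p q.
  by move=> h1 h2 t h3 h4; apply: der_continuous (dv t _ _); lra.
have simS p q : a <= p -> q <= b -> simple_on phi v p q.
  by move=> h1 h2 t u h3 h4 h5; apply: sim => //; lra.
have n0 : n = 0%N.
  apply/eqP; rewrite -leqn0 leqNgt; apply/negP => npos.
  (* Positivity at [b] makes the number of zeros even, so there are at least two. *)
  have sgn : sg n = 1.
    have [//|E] := sg1 n.
    have S0 := node_S n (leqnn n).
    have [e e0 he] := continuous_gt0_near (cm b (ltW ab) (lexx b)) mb.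
    pose u := Num.max ((node n + node n.+1) / 2) (node n.+1 - e / 2).
    have uP : [/\ node n < u, u < node n.+1 & node n.+1 - e < u].
      by rewrite /u; split; [rewrite lt_max; lra|rewrite gt_max; lra|rewrite lt_max; lra].
    case: uP => u1 u2 u3; have := sgn_piece n (leqnn n) u u1 u2.
    by have : 0 < m u by [apply: he; rewrite -nodeb; lra]; rewrite E; lra.
  have n2 : (1 < n)%N.
    by move: npos sgn; case: (n) => [|[|//]] // _; rewrite /sg expr1; lra.
  pose l j := `|phi (node j.+1) - phi (node j)|.
  (* [first_piece] makes piece 1 shorter than piece 0. If piece [j.+1] is shorter than piece [j], it
     must be longer than piece [j.+2] by [no_short_piece]. So the lengths decrease to the very end,
     where [last_piece] says the opposite. *)
  have ldec j : (j.+1 <= n)%N -> l j.+1 < l j.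
    elim: j => [_|j IH jn].
      have [L0 L1] := (node_S 0%N isT, node_S 1%N npos).
      have [n0a _] := node_in 0%N isT; have [_ n2b] := node_in 2%N npos.
      have m0 := mono 0%N isT; have m1' := mono 1%N npos.
      have vt := v_turn 0%N npos.
      move: (m0) (m1') (vt); rewrite sgS /sg expr0 => M0 M1 V0.
      have : phi (node 0%N) < phi (node 2%N).
        apply: (first_piece L0 L1 _ _ M0 M1 V0).
        - exact: cphi.
        - exact: cv.
        - exact: simS.
        - move=> t t1 t2; rewrite node0; apply: (vmax t _ _).1.
            apply: le_trans t1; apply: (inner _ _ _ _).1; last exact: node_zero.
            + by have [] := node_in 1%N isT.
            + by have [] := node_in 1%N isT.
          apply: le_trans t2 _; apply: (inner _ _ _ _).2; last exact: node_zero.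
          + by have [] := node_in 2%N npos.
          + by have [] := node_in 2%N npos.
      have A := M0 _ _ (lexx _) L0 (lexx _); have B := M1 _ _ (lexx _) L1 (lexx _).
      by rewrite /l => C; rewrite ltr0_norm ?gtr0_norm; lra.
    have jn1 := ltnW jn; have jn2 := ltnW jn1.
    have [L0 L1 L2] := And3 (node_S j jn2) (node_S j.+1 jn1) (node_S j.+2 jn).
    have [jA _] := node_in j (leqW jn2); have [_ jB] := node_in j.+3 jn.
    rewrite ltNge; apply/negP => le2.
    have M1 := mono j.+1 jn1; have M2 := mono j.+2 jn.
    have V1 := v_turn j jn1; have V2 := v_turn j.+1 jn.
    rewrite !sgS ?opprK in M1 M2 V2.
    apply: (no_short_piece (sg1 j) L0 L1 L2 _ _ (mono j jn2) M1 M2 V1 V2 _ _ le2).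
    - exact: cphi.
    - exact: cv.
    - exact: simS.
    - by apply: ltW; exact: IH.
  have := ldec n.-1; rewrite prednK // => /(_ (leqnn n)).
  have p1 : (0 < n.-1)%N by rewrite -ltnS prednK.
  have ple : (n.-1 <= n)%N by exact: leq_pred.
  have [L0 L1] := (node_S n.-1 ple, node_S n (leqnn n)).
  rewrite prednK // in L0.
  have M0 := mono n.-1 ple; have M1 := mono n (leqnn n); have V1 := v_turn n.-1.
  rewrite prednK // leqnn in V1; rewrite prednK // in M0.
  have sgp : sg n.-1 = -1 by have := sgS n.-1; rewrite prednK // sgn; lra.
  rewrite sgp in M0 V1; rewrite sgn in M1; have {}V1 := V1 isT.
  have [jA1 jA2] := node_in n.-1 (leqW (ple)); have [jB1 jB2] := node_in n (leqnSn _).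
  have : phi (node n.-1) < phi (node n.+1).
    apply: (last_piece L0 L1 _ _ M0 M1 V1).
    - by apply: cphi => //; rewrite nodeb.
    - by apply: cv => //; rewrite nodeb.
    - by apply: simS => //; rewrite nodeb.
    - move=> t t1 t2; rewrite nodeb; apply: (vmax t _ _).2.
        apply: le_trans t1; apply: (inner _ _ _ _).1 => //.
        by rewrite -(prednK p1); apply: node_zero; rewrite (prednK p1); case: (n) npos.
      apply: le_trans t2 _; apply: (inner _ _ _ _).2 => //.
      by rewrite -(prednK npos); apply: node_zero; rewrite (prednK npos).
  have A := M0 _ _ (lexx _) L0 (lexx _); have B := M1 _ _ (lexx _) L1 (lexx _).
  by rewrite /l prednK // => C; rewrite gtr0_norm ?ltr0_norm; lra.
move=> t; rewrite le_eqVlt => /predU1P[<- //|at_]; rewrite le_eqVlt => /predU1P[-> //|tb].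
have := sgn_piece 0%N (leq0n n) t; rewrite /sg expr0 mul1r; apply; first by rewrite node0.
by move: nodeb; rewrite n0 => ->.
Qed.

End Zeros.

(** * Convexity of an arc without inflection points *)

Section Angle.
Variable R : realType.
Implicit Types (f A B C phi : R -> R) (a b p q s t u w x y z e : R).

Lemma antiderivative f a b p q : a < p -> p <= q -> q < b ->
  (forall t, a < t -> t < b -> {for t, continuous f}) ->
  exists F : R -> R, forall t, p <= t -> t <= q -> der F t (f t).
Proof.
(* The margins on both sides make the derivative two-sided at [p] and [q] as well. *)
move=> ap pq qb cf; pose p' := (a + p) / 2; pose q' := (q + b) / 2.
exists (fun x => (\int[@lebesgue_measure R]_(t in [set` `[p', x]]) (f t))%R) => t pt tq.
have tq' : t < q' by rewrite /q'; lra.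
have [|||df E] := @continuous_FTC1_closed R f p' t q' tq'.
- apply: continuous_compact_integrable; first exact: segment_compact.
  apply: continuous_in_subspaceT => u; rewrite inE /= in_itv /= => /andP[h1 h2].
  by apply: cf; move: h1 h2; rewrite /p' /q'; lra.
- by rewrite /p'; lra.
- by apply: cf; lra.
by rewrite -[f t]E; exact: derivable_der.
Qed.

Lemma der_pow f t d c : der f t d -> 0 < f t ->
  der (fun x => expR (c * ln (f x))) t (c * d / f t * expR (c * ln (f t))).
Proof.
move=> df ft; have dln : der (fun x => ln (f x)) t ((f t)^-1 * d).
  by apply: der_comp df; exact: is_derive1_ln.
apply: der_eq.
  apply: (der_comp (f := expR)); first exact: is_derive_expR.
  by apply: derM dln; exact: der_cst.
by rewrite /=; field; rewrite gt_eqF.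
Qed.

Lemma der_cos phi t d : der phi t d -> der (fun x => cos (phi x)) t (- sin (phi t) * d).
Proof. by move=> dphi; apply: der_comp dphi; exact: is_derive_cos. Qed.

Lemma der_sin phi t d : der phi t d -> der (fun x => sin (phi x)) t (cos (phi t) * d).
Proof. by move=> dphi; apply: der_comp dphi; exact: is_derive_sin. Qed.

(** $(B^2 + C^2)^{-1/2}$, written with [expR] and [ln] so that [der_pow] differentiates it. *)
Definition invnorm (B C : R -> R) x := expR (- (1/2) * ln (B x ^+ 2 + C x ^+ 2)).

Lemma invnorm_gt0 B C t : 0 < invnorm B C t.
Proof. exact: expR_gt0. Qed.

Lemma invnormE B C t : 0 < B t ^+ 2 + C t ^+ 2 ->
  invnorm B C t ^+ 2 * (B t ^+ 2 + C t ^+ 2) = 1.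
Proof.
move=> r0; rewrite /invnorm -expRM_natl.
have -> : 2%:R * (- (1/2) * ln (B t ^+ 2 + C t ^+ 2)) = - ln (B t ^+ 2 + C t ^+ 2) by field.
by rewrite expRN lnK ?posrE // mulVf // gt_eqF.
Qed.

Lemma der_invnorm B C t (b1 c1 : R) : der B t b1 -> der C t c1 -> 0 < B t ^+ 2 + C t ^+ 2 ->
  der (invnorm B C) t (- (B t * b1 + C t * c1) / (B t ^+ 2 + C t ^+ 2) * invnorm B C t).
Proof.
move=> dB dC r0.
have dr : der (fun x => B x ^+ 2 + C x ^+ 2) t (2 * (B t * b1 + C t * c1)) by der_ring.
apply: (der_eq (der_pow (- (1/2)) dr r0)).
by rewrite /invnorm; field; rewrite gt_eqF.
Qed.

(** The angle is the integral of the angular speed. It is indeed an angle of [(B, C)], because in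
    the frame rotated by [phi] the normalised vector has components [U] and [W] with derivative
    zero, and they start at 1 and 0. *)
Lemma angle_lift B C (B1 C1 B2 C2 : R -> R) a b p q : a < p -> p <= q -> q < b ->
  (forall t, a < t -> t < b -> der B t (B1 t)) ->
  (forall t, a < t -> t < b -> der C t (C1 t)) ->
  (forall t, a < t -> t < b -> der B1 t (B2 t)) ->
  (forall t, a < t -> t < b -> der C1 t (C2 t)) ->
  (forall t, a < t -> t < b -> 0 < B t ^+ 2 + C t ^+ 2) -> 0 < C p ->
  exists phi, [/\ forall t, p <= t -> t <= q ->
      der phi t ((B t * C1 t - C t * B1 t) * invnorm B C t ^+ 2),
    forall t, p <= t -> t <= q -> B t * invnorm B C t = cos (phi t) /\
                                  C t * invnorm B C t = sin (phi t) &
    0 < phi p /\ phi p < pi].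
Proof.
move=> ap pq qb dB dC dB1 dC1 r0 Cp.
have ap' : a < p by []. have pb : p < b by lra.
pose sg := invnorm B C.
have sgE t : a < t -> t < b -> sg t ^+ 2 = (B t ^+ 2 + C t ^+ 2)^-1.
  move=> h1 h2; apply: (mulIf (x := B t ^+ 2 + C t ^+ 2)).
    by rewrite gt_eqF // r0.
  by rewrite invnormE ?r0 // mulVf // gt_eqF // r0.
have [|F dF] := @antiderivative
   (fun t => (B t * C1 t - C t * B1 t) * sg t ^+ 2) a b p q ap pq qb.
  move=> t h1 h2.
  have D1 := dB t h1 h2; have D2 := dC t h1 h2; have D3 := dB1 t h1 h2.
  have D4 := dC1 t h1 h2; have D5 := der_invnorm D1 D2 (r0 t h1 h2).
  apply: der_continuous; apply: derM; last by apply: derX; exact: D5.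
  by apply: derB; apply: derM; eassumption.
pose x0 := B p * sg p.
have x0C : x0 ^+ 2 + (C p * sg p) ^+ 2 = 1.
  by rewrite /x0 !exprMn -mulrDl mulrC invnormE // r0.
have C0 : 0 < C p * sg p by rewrite mulr_gt0 // invnorm_gt0.
have C02 : 0 < (C p * sg p) ^+ 2 by rewrite exprn_gt0.
have x01 : -1 < x0 /\ x0 < 1 by split; nra.
pose th := acos x0.
have cth : cos th = x0 by rewrite acosK // in_itv /=; lra.
have sth : sin th = C p * sg p.
  rewrite sin_acos; last by lra.
  have -> : 1 - x0 ^+ 2 = (C p * sg p) ^+ 2 by lra.
  by rewrite sqrtr_sqr gtr0_norm.
pose phi t := F t + (th - F p).
have dphi t : p <= t -> t <= q -> der phi t ((B t * C1 t - C t * B1 t) * sg t ^+ 2).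
  by move=> h1 h2; have D := dF t h1 h2; der_ring.
have phip : phi p = th by rewrite /phi; ring.
pose U t := (B t * cos (phi t) + C t * sin (phi t)) * sg t.
pose W t := (C t * cos (phi t) - B t * sin (phi t)) * sg t.
have dUW t : p <= t -> t <= q -> der U t 0 /\ der W t 0.
  move=> h1 h2; have [h3 h4] : a < t /\ t < b by lra.
  have D1 := dB t h3 h4; have D2 := dC t h3 h4; have D3 := dphi t h1 h2.
  have D4 := der_cos D3; have D5 := der_sin D3.
  have D6 := der_invnorm D1 D2 (r0 t h3 h4); rewrite -/sg in D6.
  have rn : B t ^+ 2 + C t ^+ 2 != 0 by rewrite gt_eqF // r0.
  rewrite sgE // in D4 D5.
  split; apply: der_eq.
  - apply: derM D6; apply: derD; apply: derM; eassumption.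
  - by rewrite /=; field.
  - apply: derM D6; apply: derB; apply: derM; eassumption.
  - by rewrite /=; field.
have cs2 t : cos (phi t) ^+ 2 + sin (phi t) ^+ 2 = 1 by exact: cos2Dsin2.
exists phi; split => //; last first.
  by rewrite phip /th; split; [apply: acos_gt0; lra|apply: acos_ltpi; lra].
move=> t pt tq.
have Ut : U t = 1.
  rewrite -(@der_eq0_cst _ U p t) //; last by move=> u h1 h2; apply: (dUW u _ _).1; lra.
  by rewrite /U phip cth sth /x0; move: x0C; rewrite /x0; lra.
have Wt : W t = 0.
  rewrite -(@der_eq0_cst _ W p t) //; last by move=> u h1 h2; apply: (dUW u _ _).2; lra.
  by rewrite /W phip cth sth /x0; ring.
have c2 := cs2 t; move: Ut Wt; rewrite /U /W; set c := cos _ in c2 *; set s := sin _ in c2 *.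
rewrite -/sg => Ut Wt.
have e1 : B t * sg t = c * 1 - s * 0 by rewrite -Ut -Wt -[LHS]mulr1 -c2; ring.
have e2 : C t * sg t = s * 1 + c * 0 by rewrite -Ut -Wt -[LHS]mulr1 -c2; ring.
by rewrite e1 e2; split; ring.
Qed.

End Angle.

(** * The curve near the base point *)

Section Convexity.
Variable R : realType.
Implicit Types (p q s t u w x y z e : R).

Variables (L : R) (A B C A1 B1 C1 A2 B2 C2 : R -> R).
Definition det3 (a b c a1 b1 c1 a2 b2 c2 : R) :=
  a * (b1 * c2 - c1 * b2) - b * (a1 * c2 - c1 * a2) + c * (a1 * b2 - b1 * a2).

Hypothesis L0 : 0 < L.
Hypotheses (dA : forall t, der A t (A1 t)) (dB : forall t, der B t (B1 t))
  (dC : forall t, der C t (C1 t)) (dA1 : forall t, der A1 t (A2 t))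
  (dB1 : forall t, der B1 t (B2 t)) (dC1 : forall t, der C1 t (C2 t)).
Hypotheses (perA : forall t, A (t + L) = A t) (perB : forall t, B (t + L) = B t)
  (perC : forall t, C (t + L) = C t).
Hypotheses (A00 : A 0 = 1) (B00 : B 0 = 0) (C00 : C 0 = 0)
  (B10 : B1 0 = 1) (C10 : C1 0 = 0).
Hypothesis D0 : forall t, 0 < t -> t < L ->
  0 < det3 (A t) (B t) (C t) (A1 t) (B1 t) (C1 t) (A2 t) (B2 t) (C2 t).
Hypothesis simple : forall s t k, s < t -> t < s + L ->
  A t = k * A s -> B t = k * B s -> C t = k * C s -> False.

Let m t := B t * C1 t - C t * B1 t.
Let m1 t := B t * C2 t - C t * B2 t.

Lemma der_periodic (f g : R -> R) : (forall t, der f t (g t)) ->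
  (forall t, f (t + L) = f t) -> forall t, g (t + L) = g t.
Proof.
move=> df pf t; apply: (der_unique (f := f) (t := t)); last exact: df.
have -> : f = (fun x => f (x + L)) by apply/funext => x; rewrite pf.
apply: der_eq.
  apply: (der_comp (f := f)); first exact: df.
  by apply: derD; [exact: der_id|exact: der_cst].
by rewrite addr0 mulr1.
Qed.

Lemma dm t : der m t (m1 t).
Proof. by rewrite /m /m1; der_ring. Qed.

(** In the affine coordinates [B / A] and [C / A] the slope [s] has derivative [A * D / M ^+ 2],
    where [D] is the determinant, so it increases through 0. Hence the curve lies above its tangent
    line, and the intercept term [w] with [m = M * w] is positive. As [D] is only known to be
    positive away from the base point, monotonicity replaces a Taylor expansion. *)
Lemma base_near : exists2 d, 0 < d & forall t, t != 0 -> - d < t -> t < d ->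
  [/\ 0 < m t, 0 < C t & 0 < t * B t].
Proof.
have pA1 := der_periodic dA perA; have pB1 := der_periodic dB perB.
have pC1 := der_periodic dC perC; have pA2 := der_periodic dA1 pA1.
have pB2 := der_periodic dB1 pB1; have pC2 := der_periodic dC1 pC1.
pose M t := B1 t * A t - B t * A1 t.
have dM t : der M t (B2 t * A t - B t * A2 t) by rewrite /M; der_ring.
have [|e1 e10 hA] := continuous_gt0_near (der_continuous (dA 0)); first by rewrite A00.
have [|e2 e20 hM] := continuous_gt0_near (der_continuous (dM 0)).
  by rewrite /M A00 B10 B00; lra.
have [|e3 e30 [hB1 hB2]] := der_pos_incr (dB 0); first by rewrite B10.
pose d := Num.min (Num.min e1 e2) (Num.min e3 L).
have [d0 d1 d2 d3 dL] : [/\ 0 < d, d <= e1, d <= e2, d <= e3 & d <= L].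
  by rewrite /d !lt_min e10 e20 e30 L0 !ge_min !lexx !orbT.
have A_gt0 t : - d < t -> t < d -> 0 < A t by move=> h1 h2; apply: hA; lra.
have M_gt0 t : - d < t -> t < d -> 0 < M t by move=> h1 h2; apply: hM; lra.
have D_gt0 t : t != 0 -> - d < t -> t < d ->
    0 < det3 (A t) (B t) (C t) (A1 t) (B1 t) (C1 t) (A2 t) (B2 t) (C2 t).
  move=> t0 h1 h2; have [tn|tp|/eqP] := ltgtP t 0; last by rewrite (negbTE t0).
    by have := D0 (t := t + L); rewrite perA perB perC pA1 pB1 pC1 pA2 pB2 pC2; apply; lra.
  by apply: D0; lra.
pose N t := C1 t * A t - C t * A1 t.
pose s t := N t / M t.
pose s1 t := A t * det3 (A t) (B t) (C t) (A1 t) (B1 t) (C1 t) (A2 t) (B2 t) (C2 t) / M t ^+ 2.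
have ds t : - d < t -> t < d -> der s t (s1 t).
  move=> h1 h2; have mt := M_gt0 t h1 h2; have mt0 : M t != 0 by rewrite gt_eqF.
  have dN : der N t (C2 t * A t - C t * A2 t) by rewrite /N; der_ring.
  apply: der_eq; first by apply: derM dN (derV mt0 (dM t)).
  by rewrite /s1 /det3; move: mt0; rewrite /M /N => mt0; field.
have s1_gt0 t : t != 0 -> - d < t -> t < d -> 0 < s1 t.
  by move=> h0 h1 h2; rewrite /s1 divr_gt0 ?mulr_gt0 ?exprn_gt0 ?A_gt0 ?M_gt0 ?D_gt0.
have s00 : s 0 = 0 by rewrite /s /N C10 C00; ring.
have sP t : t != 0 -> - d < t -> t < d -> 0 < t * s t.
  move=> t0 h1 h2; have [tn|tp|/eqP] := ltgtP t 0; last by rewrite (negbTE t0).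
    have : s t < s 0.
      apply: (der_gt0_lt (f := s) (f1 := s1) tn) => u u1 u2; first by apply: ds; lra.
      by apply: s1_gt0; [rewrite lt_eqF|lra|lra].
    by rewrite s00; nra.
  have : s 0 < s t.
    apply: (der_gt0_lt (f := s) (f1 := s1) tp) => u u1 u2; first by apply: ds; lra.
    by apply: s1_gt0; [rewrite gt_eqF|lra|lra].
  by rewrite s00; nra.
have BP t : t != 0 -> - d < t -> t < d -> 0 < t * B t.
  move=> t0 h1 h2; have [tn|tp|/eqP] := ltgtP t 0; last by rewrite (negbTE t0).
    by have : B t < B 0 by [apply: hB2; lra]; rewrite B00; nra.
  by have : B 0 < B t by [apply: hB1; lra]; rewrite B00; nra.
pose w t := B t / A t * s t - C t / A t.
pose w1 t := B t / A t * s1 t.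
have dw t : - d < t -> t < d -> der w t (w1 t).
  move=> h1 h2; have D1 := ds t h1 h2; have a0 := A_gt0 t h1 h2.
  have an : A t != 0 by rewrite gt_eqF.
  have mn : M t != 0 by rewrite gt_eqF // M_gt0.
  apply: der_eq.
    apply: derB; last exact: derM (dC t) (derV an (dA t)).
    by apply: derM D1; exact: derM (dB t) (derV an (dA t)).
  by rewrite /w1 /s /N; move: mn; rewrite /M => mn; field; rewrite an mn.
have w0 : w 0 = 0 by rewrite /w B00 C00; ring.
have w_gt0 t : t != 0 -> - d < t -> t < d -> 0 < w t.
  move=> t0 h1 h2; have [tn|tp|/eqP] := ltgtP t 0; last by rewrite (negbTE t0).
    rewrite -w0; apply: (der_lt0_gt (f := w) (f1 := w1) tn) => u u1 u2; first by apply: dw; lra.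
    have un : u != 0 by rewrite lt_eqF.
    have [g1 g2] : - d < u /\ u < d by lra.
    have := s1_gt0 u un g1 g2; have := BP u un g1 g2; have := A_gt0 u g1 g2 => a b c.
    rewrite /w1 pmulr_llt0 // pmulr_llt0 ?invr_gt0 //; nra.
  rewrite -w0; apply: (der_gt0_lt (f := w) (f1 := w1) tp) => u u1 u2; first by apply: dw; lra.
  have un : u != 0 by rewrite gt_eqF.
  have [g1 g2] : - d < u /\ u < d by lra.
  have := s1_gt0 u un g1 g2; have := BP u un g1 g2; have := A_gt0 u g1 g2 => a b c.
  have bu : 0 < B u by nra.
  exact: (mulr_gt0 (divr_gt0 bu a) c).
exists d => // t t0 h1 h2; split; last exact: BP.
  have -> : m t = M t * w t.
    have an : A t != 0 by rewrite gt_eqF // A_gt0.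
    have mn : M t != 0 by rewrite gt_eqF // M_gt0.
    by rewrite /w /s /N /m; move: mn; rewrite /M => mn; field; rewrite an mn.
  by rewrite mulr_gt0 ?M_gt0 ?w_gt0.
pose y t := C t / A t.
have dy u : - d < u -> u < d -> der y u (M u * s u / A u ^+ 2).
  move=> g1 g2; have an : A u != 0 by rewrite gt_eqF // A_gt0.
  have mn : M u != 0 by rewrite gt_eqF // M_gt0.
  apply: der_eq; first exact: derM (dC u) (derV an (dA u)).
  by rewrite /s /N; field; rewrite an mn.
have y0 : y 0 = 0 by rewrite /y C00 mul0r.
suff : 0 < y t by rewrite /y pmulr_lgt0 // invr_gt0 A_gt0.
rewrite -y0; have [tn|tp|/eqP] := ltgtP t 0; last by rewrite (negbTE t0).
  apply: (der_lt0_gt (f := y) (f1 := fun u => M u * s u / A u ^+ 2) tn) => u u1 u2.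
    by apply: dy; lra.
  have un : u != 0 by rewrite lt_eqF.
  have [g1 g2] : - d < u /\ u < d by lra.
  have := sP u un g1 g2; have mm := M_gt0 u g1 g2; have aa := A_gt0 u g1 g2 => b.
  by rewrite pmulr_llt0 ?invr_gt0 ?exprn_gt0 // pmulr_rlt0 //; nra.
apply: (der_gt0_lt (f := y) (f1 := fun u => M u * s u / A u ^+ 2) tp) => u u1 u2.
  by apply: dy; lra.
have un : u != 0 by rewrite gt_eqF.
have [g1 g2] : - d < u /\ u < d by lra.
have := sP u un g1 g2; have mm := M_gt0 u g1 g2; have aa := A_gt0 u g1 g2 => b.
by rewrite pmulr_lgt0 ?invr_gt0 ?exprn_gt0 // pmulr_rgt0 //; nra.
Qed.

End Convexity.

(** * Curves that make more than a full turn *)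

Section FullTurn.
Variable R : realType.
Implicit Types (p q s t u w x y z e : R).

(** The angle has passed [pi] by [y], so the next time that it is in the second quadrant it exceeds
    [5/2 * pi], whereas [a < pi / 2]. *)
Lemma angle_gap (a y z : R) : 0 < a -> a < pi -> 0 < cos a -> a <= y -> sin y <= 0 -> y <= z ->
  cos z < 0 -> 0 < sin z -> a + pi *+ 2 < z.
Proof.
move=> a0 api ca ay sy yz cz sz; have pi2 : pi *+ 2 = 2 * pi :> R by rewrite mulr_natl.
have yp : pi <= y.
  rewrite leNgt; apply/negP => lt; have := @sin_gt0_pi R y; lra.
have z2 : 2 * pi < z.
  rewrite ltNge; apply/negP => le; move: sz.
  have : 0 <= sin (z - pi) by apply: sin_ge0_pi; lra.
  by rewrite -[X in 0 < sin X](subrK pi) sinDpi; lra.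
have z5 : 5/2 * pi <= z.
  rewrite leNgt; apply/negP => lt; move: cz.
  have : 0 < cos (z - pi *+ 2) by apply: cos_gt0_pihalf; rewrite pi2; lra.
  by rewrite -[X in cos X < 0](subrK (pi *+ 2)) cosD2pi; lra.
have a2 : a < pi / 2.
  rewrite ltNge; apply/negP => le; move: ca.
  have : 0 <= sin (a - pi / 2) by apply: sin_ge0_pi; lra.
  by rewrite -[X in 0 < cos X](subrK (pi / 2)) cosDpihalf; lra.
by rewrite pi2; lra.
Qed.

(* After more than a full turn the initial and final branches of the curve
   [(phi, v)], both rising above [K], have to cross modulo a full turn. *)
Lemma full_turn (phi v : R -> R) (s0 t0 a b K : R) : s0 < t0 ->
  cont_on phi s0 t0 -> cont_on v s0 t0 ->
  (forall x y, s0 <= x -> x < y -> y <= t0 -> phi x < phi y) ->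
  (forall x, s0 <= x -> x <= t0 -> x < a -> 0 < cos (phi x)) ->
  (forall x, s0 <= x -> x <= t0 -> b < x -> cos (phi x) < 0) ->
  s0 < a -> b < t0 -> K < v s0 -> K < v t0 -> (forall x, a <= x -> x <= b -> v x < K) ->
  phi s0 + pi *+ 2 < phi t0 ->
  exists z w, [/\ s0 <= z, z < w, w <= t0, phi z = phi w - pi *+ 2 & v z = v w].
Proof.
move=> st0 cphi cv phi_lt left right s0a bt0 vs0 vt0 vK turn.
have cos_s0 := left s0 (lexx _) (ltW st0) s0a.
have cos_t0 := right t0 (ltW st0) (lexx _) bt0.
have pi0 := pi_gt0 R; have pi2 : pi *+ 2 = 2 * pi :> R by rewrite mulr_natl.
have phi_le x y : s0 <= x -> x <= y -> y <= t0 -> phi x <= phi y.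
  by move=> h1; rewrite le_eqVlt => /predU1P[-> //|h2] h3; exact/ltW/phi_lt.
have sub p q : s0 <= p -> q <= t0 -> cont_on phi p q.
  by move=> h1 h2 t h3 h4; apply: cphi; [exact: le_trans h3|exact: le_trans h2].
have subv p q : s0 <= p -> q <= t0 -> cont_on v p q.
  by move=> h1 h2 t h3 h4; apply: cv; [exact: le_trans h3|exact: le_trans h2].
have mid p q y : s0 <= p -> p <= q -> q <= t0 -> phi p <= y -> y <= phi q ->
    exists z, [/\ p <= z, z <= q & phi z = y].
  move=> h1 h2 h3 h4 h5; have [|z [z1 z2] ez] := ivt h2 (sub p q h1 h3) (y := y).
    by rewrite mulr_le0_ge0 ?subr_le0 ?subr_ge0.
  by exists z.
(* The initial branch over [[s0, s']] and the final branch over [[t', t0]] cover the same angles up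
   to a full turn. The signs of the cosine place [s'] and [t'] in [[a, b]], where [v < K], while
   [v > K] at [s0] and [t0]. This is the change of order that [crossing] needs. *)
have [s' [s'1 s'2 es']] : exists z, [/\ s0 <= z, z <= t0 & phi z = phi t0 - pi *+ 2].
  by apply: mid => //; [exact: ltW|lra|lra].
have [t' [t'1 t'2 et']] : exists z, [/\ s0 <= z, z <= t0 & phi z = phi s0 + pi *+ 2].
  by apply: mid => //; [exact: ltW|lra|lra].
have cos_s' : cos (phi s') < 0.
  by have := cos_t0; rewrite -[phi t0](subrK (pi *+ 2)) cosD2pi -es'.
have cos_t' : 0 < cos (phi t') by rewrite et' cosD2pi.
have as' : a <= s'.
  by rewrite leNgt; apply/negP => /(left s' s'1 s'2) h; move: (lt_trans h cos_s'); rewrite ltxx.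
have t'b : t' <= b.
  by rewrite leNgt; apply/negP => /(right t' t'1 t'2) h; move: (lt_trans h cos_t'); rewrite ltxx.
have s'b : s' <= b.
  rewrite leNgt; apply/negP => lt.
  have [||z [z1 z2 ez]] := mid s' t0 (phi s' + pi) s'1 s'2 (lexx _); [lra|lra|].
  have := right z (le_trans s'1 z1) z2 (lt_le_trans lt z1); rewrite ez cosDpi.
  by rewrite oppr_lt0 ltNge (ltW cos_s').
have at' : a <= t'.
  rewrite leNgt; apply/negP => lt.
  have [||z [z1 z2 ez]] := mid s0 t' (phi s0 + pi) (lexx _) t'1 t'2; [lra|lra|].
  have := left z z1 (le_trans z2 t'2) (le_lt_trans z2 lt); rewrite ez cosDpi.
  by rewrite oppr_gt0 ltNge (ltW cos_s0).
have vs' := vK s' as' s'b; have vt' := vK t' at' t'b.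
have sm1 : smono 1 phi s0 s'.
  by move=> z w z1 zw w1; rewrite mul1r subr_gt0; exact: phi_lt (le_trans w1 s'2).
have sm2 : smono 1 (fun x => phi x - pi *+ 2) t' t0.
  move=> z w z1 zw w1; rewrite mul1r subr_gt0 ltrD2r.
  exact: phi_lt (le_trans t'1 z1) zw w1.
have cphi2 : cont_on (fun x => phi x - pi *+ 2) t' t0.
  by move=> z z1 z2; apply: continuousB; [exact: (sub t' t0)|exact: cst_continuous].
have e1 : phi s0 = phi t' - pi *+ 2 by rewrite et' addrK.
have prod : (v s0 - v t') * (v s' - v t0) <= 0.
  by rewrite mulr_ge0_le0 // ?subr_ge0 ?subr_le0; apply/ltW; [exact: lt_trans vs0|exact: lt_trans vt0].
have [z [w [z1 z2 w1 w2 [ep ev]]]] := crossing (or_introl erefl) (or_introl erefl) s'1 t'2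
  (sub _ _ (lexx _) s'2) (subv _ _ (lexx _) s'2) cphi2 (subv _ _ t'1 (lexx _)) sm1 sm2
  (lexx _) t'2 t'2 (lexx _) e1 es' prod.
exists z, w; split=> //; rewrite ltNge; apply/negP => /(phi_le w z (le_trans t'1 w1)).
by move=> /(_ (le_trans z2 s'2)); rewrite ep; lra.
Qed.

End FullTurn.

(** * Global convexity of the arc *)

Section Convexity.
Variable R : realType.
Implicit Types (p q s t u w x y z e : R).

Variables (L : R) (A B C A1 B1 C1 A2 B2 C2 : R -> R).

Hypothesis L0 : 0 < L.
Hypotheses (dA : forall t, der A t (A1 t)) (dB : forall t, der B t (B1 t))
  (dC : forall t, der C t (C1 t)) (dA1 : forall t, der A1 t (A2 t))
  (dB1 : forall t, der B1 t (B2 t)) (dC1 : forall t, der C1 t (C2 t)).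
Hypotheses (perA : forall t, A (t + L) = A t) (perB : forall t, B (t + L) = B t)
  (perC : forall t, C (t + L) = C t).
Hypotheses (A00 : A 0 = 1) (B00 : B 0 = 0) (C00 : C 0 = 0)
  (B10 : B1 0 = 1) (C10 : C1 0 = 0).
Hypothesis D0 : forall t, 0 < t -> t < L ->
  0 < det3 (A t) (B t) (C t) (A1 t) (B1 t) (C1 t) (A2 t) (B2 t) (C2 t).
Hypothesis simple : forall s t k, s < t -> t < s + L ->
  A t = k * A s -> B t = k * B s -> C t = k * C s -> False.


Let m t := B t * C1 t - C t * B1 t.
Let m1 t := B t * C2 t - C t * B2 t.

Lemma bounded_on (f : R -> R) p q : (forall t, p <= t -> t <= q -> {for t, continuous f}) ->
  exists2 K, 0 < K & forall t, p <= t -> t <= q -> f t < K.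
Proof.
move=> cf; have [pq|qp] := leP p q; last by exists 1 => // t; lra.
have [|c cpq hc] := @EVT_max R f p q pq.
  by apply: continuous_in_subspaceT => t; rewrite inE /= in_itv /= => /andP[]; exact: cf.
exists (`|f c| + 1); first by have := normr_ge0 (f c); lra.
move=> t pt tq; have := hc t; rewrite in_itv /= pt tq => /(_ isT).
by have := ler_norm (f c); lra.
Qed.

(** On the cylinder the height is [A * invnorm B C]; at the base point [A] is 1 while [B] and [C]
    vanish, so the height exceeds any [K] nearby, on both sides. *)
Lemma tall_end K d : 0 < K -> 0 < d -> exists2 e, 0 < e & e <= d /\
  forall t, t != 0 -> - e < t -> t < e -> 0 < B t ^+ 2 + C t ^+ 2 -> K < A t * invnorm B C t.
Proof.
move=> K0 d0.
have [|e1 e10 h1] := continuous_gt0_near (der_continuous (dA 0)); first by rewrite A00.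
pose f t := A t ^+ 2 - K ^+ 2 * (B t ^+ 2 + C t ^+ 2).
have df : der f 0 (2 * A 0 * A1 0 - K ^+ 2 * (2 * B 0 * B1 0 + 2 * C 0 * C1 0)).
  by rewrite /f; der_ring.
have [|e2 e20 h2] := continuous_gt0_near (der_continuous df).
  by rewrite /f A00 B00 C00; lra.
exists (Num.min (Num.min e1 e2) d); first by rewrite !lt_min e10 e20 d0.
split; first by rewrite ge_min lexx orbT.
move=> t t0 t1 t2 r0; have [m1' m2' m3'] : [/\ - e1 < t, - e2 < t & t < e1 /\ t < e2].
  move: t1 t2; rewrite ltrNl !lt_min => /andP[/andP[? ?] _] /andP[/andP[? ?] _].
  by split; try lra; split.
have a0 : 0 < A t by apply: h1; lra.
have := h2 t; rewrite /f => H; have {H} : 0 < f t by apply: H; lra.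
rewrite /f => lt; have s0 := invnorm_gt0 B C t; have sE := invnormE r0.
set s := invnorm B C t in s0 sE *.
have : K ^+ 2 < (A t * s) ^+ 2.
  rewrite exprMn -subr_gt0.
  have -> : A t ^+ 2 * s ^+ 2 - K ^+ 2 =
     s ^+ 2 * (A t ^+ 2 - K ^+ 2 * (B t ^+ 2 + C t ^+ 2)).
    by rewrite -[in LHS](mulr1 (K ^+ 2)) -[in LHS]sE; ring.
  by rewrite mulr_gt0 // exprn_gt0.
by rewrite ltr_pXn2r // nnegrE ?mulr_ge0 ?ltW.
Qed.

Lemma convex t : 0 < t -> t < L -> 0 < m t /\ 0 < C t.
Proof.
move=> t_gt0 t_ltL.
have [d0 d0_gt0 near0] := base_near L0 dA dB dC dA1 dB1 dC1 perA perB perC A00 B00 C00 B10 C10 D0.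
have pB1 := der_periodic dB perB; have pC1 := der_periodic dC perC.
pose d := Num.min d0 (L / 4).
have [d_gt0 dd dL] : [/\ 0 < d, d <= d0 & d <= L / 4].
  by rewrite /d lt_min d0_gt0 /= !ge_min !lexx orbT; split=> //; lra.
have left_end x : 0 < x -> x < d -> [/\ 0 < m x, 0 < C x & 0 < B x].
  move=> x0 xd; have [|||h1 h2 h3] := near0 x; [by rewrite gt_eqF|lra|lra|].
  by split=> //; nra.
have right_end x : L - d < x -> x < L -> [/\ 0 < m x, 0 < C x & B x < 0].
  move=> x0 xd; have [|||h1 h2 h3] := near0 (x - L); [by rewrite lt_eqF //; lra|lra|lra|].
  rewrite -[x](subrK L) /m perB perC pB1 pC1; split=> //; nra.
have r0 x : 0 < x -> x < L -> 0 < B x ^+ 2 + C x ^+ 2.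
  move=> x0 xL; rewrite lt_neqAle addr_ge0 ?sqr_ge0 // andbT eq_sym; apply/negP.
  rewrite paddr_eq0 ?sqr_ge0 // !sqrf_eq0 => /andP[/eqP b0 /eqP c0].
  apply: (@simple 0 x (A x)) => //; [by rewrite add0r|by rewrite A00 mulr1| |].
    by rewrite b0 B00 mulr0.
  by rewrite c0 C00 mulr0.
pose sg := invnorm B C; pose v x := A x * sg x.
have sgE x : 0 < x -> x < L -> sg x ^+ 2 * (B x ^+ 2 + C x ^+ 2) = 1.
  by move=> h1 h2; apply: invnormE; exact: r0.
have sg0 x : 0 < sg x by exact: invnorm_gt0.
pose v1 x := sg x ^+ 3 * (A1 x * (B x ^+ 2 + C x ^+ 2) - A x * (B x * B1 x + C x * C1 x)).
have dv x : 0 < x -> x < L -> der v x (v1 x).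
  move=> h1 h2; have rx := r0 x h1 h2; have := sgE x h1 h2 => sx.
  apply: (der_eq (derM (dA x) (der_invnorm (dB x) (dC x) rx))).
  have -> : (B x ^+ 2 + C x ^+ 2)^-1 = sg x ^+ 2.
    by rewrite -[LHS]mul1r -sx mulfK // gt_eqF.
  rewrite -/sg /v1.
  have -> : A1 x * sg x = A1 x * sg x * (sg x ^+ 2 * (B x ^+ 2 + C x ^+ 2)) by rewrite sx mulr1.
  by ring.
(* [K] bounds the height away from the base point; the arc is then cut at [s0] and [t0], so close to
   the base point that the height there is above [K]. *)
have [K K0 vK] : exists2 K, 0 < K & forall x, d <= x -> x <= L - d -> v x < K.
  by apply: bounded_on => x h1 h2; apply: der_continuous (dv x _ _); lra.
have [e e0 [ed tall]] := tall_end K0 d_gt0.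
pose s0 := e / 2; pose t0 := L - e / 2.
have s0P : [/\ 0 < s0, s0 < d & s0 < L] by rewrite /s0; split; lra.
have t0P : [/\ 0 < t0, L - d < t0 & t0 < L] by rewrite /t0; split; lra.
case: s0P => s0_gt0 s0d s0L; case: t0P => t0_gt0 t0d t0L.
have st0 : s0 < t0 by rewrite /s0 /t0; lra.
have vs0 : K < v s0.
  by apply: tall; [rewrite gt_eqF|rewrite /s0; lra|rewrite /s0; lra|exact: r0].
have vt0 : K < v t0.
  have E : t0 - L + L = t0 by ring.
  rewrite /v /sg /invnorm -E perA perB perC; apply: tall.
  - have tn : t0 - L < 0 by rewrite /t0; lra.
    by rewrite lt_eqF.
  - by rewrite /t0; lra.
  - by rewrite /t0; lra.
  - by rewrite -(perB (t0 - L)) -(perC (t0 - L)) E; exact: r0.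
have [ms0 Cs0 Bs0] := left_end s0 s0_gt0 s0d.
have [mt0 Ct0 Bt0] := right_end t0 t0d t0L.
have [phi [dphi polar [phis0 phis1]]] :=
  @angle_lift R B C B1 C1 B2 C2 0 L s0 t0 s0_gt0 (ltW st0) t0L
   (fun x _ _ => dB x) (fun x _ _ => dC x) (fun x _ _ => dB1 x) (fun x _ _ => dC1 x) r0 Cs0.
rewrite -/sg in dphi polar.
have inside x : s0 <= x -> x <= t0 -> 0 < x /\ x < L.
  by move=> h1 h2; split; [exact: lt_le_trans h1|exact: le_lt_trans t0L].
(* Equal polar coordinates up to a multiple of [2 pi] mean equal points. *)
have collide x y : s0 <= x -> x <= t0 -> s0 <= y -> y <= t0 -> x < y ->
    cos (phi x) = cos (phi y) -> sin (phi x) = sin (phi y) -> v x = v y -> False.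
  move=> x1 x2 y1 y2 xy ec es ev; have [px1 px2] := polar x x1 x2.
  have [py1 py2] := polar y y1 y2; have sx := sg0 x; have sy := sg0 y.
  have syn : sg y != 0 by rewrite gt_eqF.
  have [x0 _] := inside x x1 x2; have [_ yL] := inside y y1 y2.
  have yxL : y < x + L by apply: (lt_trans yL); rewrite ltrDr.
  apply: (simple (k := sg x / sg y) xy yxL).
  - by rewrite mulrAC [sg x * _]mulrC -/(v x) ev /v mulfK.
  - by rewrite mulrAC [sg x * _]mulrC px1 ec -py1 mulfK.
  - by rewrite mulrAC [sg x * _]mulrC px2 es -py2 mulfK.
have mpos x : s0 <= x -> x <= t0 -> 0 < m x.
  apply: (@no_turning R phi v m (fun x => sg x ^+ 2) m1 v1 s0 t0 d (L - d)) => //.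
  - by move=> y _ _; rewrite exprn_gt0.
  - by move=> y _ _; apply: dm.
  - by move=> y y1 y2; have [? ?] := inside y y1 y2; exact: dv.
  (* Where [m] vanishes, the determinant reduces to a negative multiple of [m1 * v1]. So [D > 0]
     fixes the side to which the curve turns. *)
  - move=> y y1 y2 my; have [y3 y4] := inside y y1 y2.
    have ry := r0 y y3 y4; have Dy := D0 y3 y4.
    have : 0 < (B y ^+ 2 + C y ^+ 2) *
      det3 (A y) (B y) (C y) (A1 y) (B1 y) (C1 y) (A2 y) (B2 y) (C2 y) by rewrite mulr_gt0.
    have -> : (B y ^+ 2 + C y ^+ 2) *
      det3 (A y) (B y) (C y) (A1 y) (B1 y) (C1 y) (A2 y) (B2 y) (C2 y) =
      - m1 y * (A1 y * (B y ^+ 2 + C y ^+ 2) - A y * (B y * B1 y + C y * C1 y)) +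
      m y * (A2 y * (B y ^+ 2 + C y ^+ 2) - A y * (B y * B2 y + C y * C2 y)).
      by rewrite /m /m1 /det3; ring.
    rewrite my mul0r addr0 mulNr oppr_gt0 => neg.
    by rewrite /v1 mulrCA pmulr_rlt0 // exprn_gt0.
  - move=> x' y' x1 xy y1 ep ev; apply: (collide x' y' x1 _ _ y1 xy _ _ ev).
    + exact: le_trans (ltW xy) y1.
    + exact: le_trans x1 (ltW xy).
    + by rewrite ep.
    + by rewrite ep.
  - move=> y y1 y2 my; split; rewrite leNgt; apply/negP => yy.
      by have [h _ _] := left_end y (lt_le_trans s0_gt0 y1) yy; move: h; rewrite my ltxx.
    by have [h _ _] := right_end y yy (le_lt_trans y2 t0L); move: h; rewrite my ltxx.
  - by move=> y y1 y2; have h := vK y y1 y2; split; [exact: lt_trans vs0|exact: lt_trans vt0].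
have phi_lt x y : s0 <= x -> x < y -> y <= t0 -> phi x < phi y.
  move=> x1 xy y1; apply: (der_gt0_lt (f := phi) (f1 := fun x => m x * sg x ^+ 2) xy).
    by move=> z z1 z2; apply: dphi; [exact: le_trans z1|exact: le_trans y1].
  move=> z z1 z2; rewrite mulr_gt0 ?exprn_gt0 //; apply: mpos.
    exact: le_trans (ltW z1).
  exact: le_trans (ltW z2) y1.
have cphi : cont_on phi s0 t0 by move=> z z1 z2; exact: der_continuous (dphi z z1 z2).
have cv : cont_on v s0 t0.
  by move=> z z1 z2; have [h1 h2] := inside z z1 z2; exact: der_continuous (dv z h1 h2).
have sin_t0 : 0 < sin (phi t0).
  by rewrite -(polar t0 (ltW st0) (lexx _)).2 mulr_gt0.
have cosl x : s0 <= x -> x <= t0 -> x < d -> 0 < cos (phi x).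
  move=> x1 x2 xd; rewrite -(polar x x1 x2).1 mulr_gt0 //.
  by have [_ _] := left_end x (lt_le_trans s0_gt0 x1) xd.
have cosr x : s0 <= x -> x <= t0 -> L - d < x -> cos (phi x) < 0.
  move=> x1 x2 xd; rewrite -(polar x x1 x2).1 pmulr_llt0 //.
  by have [_ _] := right_end x xd (le_lt_trans x2 t0L).
(* The angle starts in the first quadrant and ends over the second. A point with [C x <= 0] in
   between means that [pi] has been passed, so more than a full turn has been made. *)
have Cpos x : s0 <= x -> x <= t0 -> 0 < C x.
  move=> x1 x2; rewrite ltNge; apply/negP => Cx.
  have sinx : sin (phi x) <= 0 by rewrite -(polar x x1 x2).2 pmulr_lle0.
  have turn : phi s0 + pi *+ 2 < phi t0.
    apply: (angle_gap phis0 phis1 (cosl _ (lexx _) (ltW st0) s0d) _ sinx _ _ sin_t0).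
    - by move: x1; rewrite le_eqVlt => /predU1P[-> //|x1]; apply/ltW/phi_lt.
    - by move: x2; rewrite le_eqVlt => /predU1P[-> //|x2]; apply/ltW/phi_lt.
    - exact: cosr (ltW st0) (lexx _) t0d.
  have [z [w [z1 zw w1 ep ev]]] :=
    full_turn st0 cphi cv phi_lt cosl cosr s0d t0d vs0 vt0 vK turn.
  apply: (collide z w z1 _ _ w1 zw _ _ ev).
  - exact: le_trans (ltW zw) w1.
  - exact: le_trans z1 (ltW zw).
  - by rewrite -[phi w](subrK (pi *+ 2)) cosD2pi -ep.
  - by rewrite -[phi w](subrK (pi *+ 2)) sinD2pi -ep.
have [t1|t1] := ltP t d; first by have [h1 h2 _] := left_end t t_gt0 t1; split; [exact: h1|exact: h2].
have [t2|t2] := ltP (L - d) t.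
  by have [h1 h2 _] := right_end t t2 t_ltL; split; [exact: h1|exact: h2].
have ts : s0 <= t by exact: le_trans (ltW s0d) t1.
have tt : t <= t0 by exact: le_trans t2 (ltW t0d).
by split; [exact: mpos|exact: Cpos].
Qed.

End Convexity.

(** * Third order equations *)

Section ThirdOrder.
Variable R : realType.
Implicit Types (w n k al be : R -> R) (P : R -> Prop) (a b t s x : R).

(* [w] solves [w''' = al w + be w'] wherever [P] holds. *)
Definition solves P al be w (w1 w2 : R -> R) := forall t, P t ->
  [/\ der w t (w1 t), der w1 t (w2 t) & der w2 t (al t * w t + be t * w1 t)].

Lemma der_quad P al be w (w1 w2 be1 : R -> R) t : solves P al be w w1 w2 -> P t ->
  der be t (be1 t) ->
  der (fun t => w t * w2 t - 1/2 * w1 t ^+ 2 - 1/2 * be t * w t ^+ 2) t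
      ((al t - be1 t / 2) * w t ^+ 2).
Proof.
move=> sw Pt dbe; have [d0 d1 d2] := sw t Pt.
by der_auto; rewrite /=; field.
Qed.

Lemma der_wronskian P al be w (w1 w2 : R -> R) n (n1 n2 : R -> R) t :
  solves P al be w w1 w2 -> solves P al be n n1 n2 -> P t ->
  der (fun t => n1 t * w t - n t * w1 t) t (n2 t * w t - n t * w2 t) /\
  der (fun t => n2 t * w t - n t * w2 t) t
      (n2 t * w1 t - n1 t * w2 t + be t * (n1 t * w t - n t * w1 t)).
Proof.
move=> sw sn Pt; have [d0 d1 d2] := sw t Pt; have [e0 e1 e2] := sn t Pt.
by split; der_ring.
Qed.

Lemma der_ratio P al be w (w1 w2 : R -> R) n (n1 n2 : R -> R) t :
  solves P al be w w1 w2 -> solves P al be n n1 n2 -> P t -> w t != 0 ->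
  der (fun t => n t / w t) t ((n1 t * w t - n t * w1 t) / w t ^+ 2).
Proof.
move=> sw sn Pt w0; have [d0 _ _] := sw t Pt; have [e0 _ _] := sn t Pt.
by der_auto; rewrite /=; field.
Qed.

(* With [x = n / w] and [g = (m / w)^2], the second derivative of [g] with
   respect to [x] is [-4 (w w'' - w'^2/2 - be w^2/2)]. *)
Lemma der_slope P al be w (w1 w2 : R -> R) n (n1 n2 : R -> R) t :
  solves P al be w w1 w2 -> solves P al be n n1 n2 -> P t -> w t != 0 ->
  let m t := n1 t * w t - n t * w1 t in let m1 t := n2 t * w t - n t * w2 t in
  der (fun t => 2 * (m1 t - m t * w1 t / w t)) t
      (- 4 * (w t * w2 t - 1/2 * w1 t ^+ 2 - 1/2 * be t * w t ^+ 2) * (m t / w t ^+ 2)).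
Proof.
move=> sw sn Pt w0 m m1; have [d0 d1 d2] := sw t Pt; have [e0 e1 e2] := sn t Pt.
have [dm dm1] := der_wronskian sw sn Pt.
apply: der_eq.
  by apply: derM (der_cst _ _) (derB dm1 (derM (derM dm d1) (derV w0 d0))).
by rewrite /m /m1 /=; field.
Qed.

Lemma der_height P al be w (w1 w2 : R -> R) n (n1 n2 : R -> R) t :
  solves P al be w w1 w2 -> solves P al be n n1 n2 -> P t -> w t != 0 ->
  let m t := n1 t * w t - n t * w1 t in let m1 t := n2 t * w t - n t * w2 t in
  der (fun t => m t / w t) t ((m1 t * w t - m t * w1 t) / w t ^+ 2).
Proof.
move=> sw sn Pt w0 m m1; have [d0 d1 d2] := sw t Pt.
have [dm dm1] := der_wronskian sw sn Pt.
apply: der_eq; first exact: derM dm (derV w0 d0).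
by rewrite /m /m1 /=; field.
Qed.

(* As [q >= 0], the quantity [w w'' - w'^2/2 - be w^2/2] increases, hence [g'] is
   bounded above and [g] cannot blow up at [b]. *)
Lemma end_blowup a b al be (be1 : R -> R) w (w1 w2 : R -> R) n (n1 n2 : R -> R) X :
  a < b -> (forall t, a < t -> t < b -> 0 < w t) ->
  solves (fun t => a < t < b) al be w w1 w2 -> solves (fun t => a < t < b) al be n n1 n2 ->
  (forall t, a < t -> t < b -> der be t (be1 t)) ->
  (forall t, a < t -> t < b -> 0 < n1 t * w t - n t * w1 t) ->
  (forall t, a < t -> t < b -> 0 <= al t - be1 t / 2) ->
  (forall t, a < t -> t < b -> `|n t / w t| <= X) ->
  exists K, forall t, (a + b) / 2 <= t -> t < b ->
    ((n1 t * w t - n t * w1 t) / w t) ^+ 2 <= K.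
Proof.
move=> ab w0 sw sn dbe m0 q0 xX; pose c := (a + b) / 2.
have [ac cb] : a < c /\ c < b by rewrite /c; lra.
pose m t := n1 t * w t - n t * w1 t; pose m1 t := n2 t * w t - n t * w2 t.
pose x t := n t / w t; pose x1 t := m t / w t ^+ 2.
pose Q t := w t * w2 t - 1/2 * w1 t ^+ 2 - 1/2 * be t * w t ^+ 2.
pose g1 t := 2 * (m1 t - m t * w1 t / w t).
have x10 t : a < t -> t < b -> 0 < x1 t.
  by move=> h1 h2; rewrite /x1 divr_gt0 ?exprn_gt0 ?w0 //; exact: m0.
have dx t : a < t -> t < b -> der x t (x1 t).
  by move=> h1 h2; apply: (der_ratio sw sn); rewrite ?h1 ?h2 // gt_eqF // w0.
have dQ t : a < t -> t < b -> der Q t ((al t - be1 t / 2) * w t ^+ 2).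
  by move=> h1 h2; apply: (der_quad sw); rewrite ?h1 ?h2 //; exact: dbe.
have dg1 t : a < t -> t < b -> der g1 t (- 4 * Q t * x1 t).
  by move=> h1 h2; apply: (der_slope sw sn); rewrite ?h1 ?h2 // gt_eqF // w0.
have dg t : a < t -> t < b -> der (fun t => (m t / w t) ^+ 2) t (g1 t * x1 t).
  move=> h1 h2; have wn : w t != 0 by rewrite gt_eqF // w0.
  have tab : a < t < b by rewrite h1 h2.
  apply: (der_eq (derX 2 (der_height sw sn tab wn))).
  by rewrite /g1 /x1 /m /m1 /=; field.
have Qc t : c <= t -> t < b -> Q c <= Q t.
  move=> ct tb; apply: (der_ge0_le ct (f1 := fun t => (al t - be1 t / 2) * w t ^+ 2)).
    by move=> s s1 s2; apply: dQ; lra.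
  by move=> s s1 s2; rewrite mulr_ge0 ?exprn_ge0 ?q0 // ?ltW ?w0; lra.
pose k := `|4 * Q c|.
have X0 : 0 <= X by apply: le_trans (xX c ac cb); exact: normr_ge0.
pose K1 := `|g1 c| + k * (2 * X).
have k0 : 0 <= k by exact: normr_ge0.
have K10 : 0 <= K1 by rewrite addr_ge0 ?normr_ge0 // mulr_ge0 //; lra.
have xd t : c <= t -> t < b -> x t - x c <= 2 * X.
  move=> ct tb; have := xX t (lt_le_trans ac ct) tb; have := xX c ac cb.
  by rewrite !ler_norml -/(x t) -/(x c) => /andP[? ?] /andP[? ?]; lra.
have kQ : - k <= 4 * Q c by rewrite /k lerNl -normrN ler_norm.
have g1K t : c <= t -> t < b -> g1 t <= K1.
  move=> ct tb.
  have : g1 t - k * x t <= g1 c - k * x c.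
    apply: (der_le0_ge (f := fun t => g1 t - k * x t)
      (f1 := fun t => - 4 * Q t * x1 t - k * x1 t) ct) => s s1 s2.
      have [as_ sb] : a < s /\ s < b by lra.
      apply: (der_eq (derB (dg1 s as_ sb) (derM (der_cst _ _) (dx s as_ sb)))).
      by rewrite /=; ring.
    have [as_ sb] : a < s /\ s < b by lra.
    have sx := x10 s as_ sb; have := Qc s (ltW s1) sb => sQ.
    by rewrite -mulrBl pmulr_lle0 //; lra.
  have := ler_norm (g1 c); have := ler_wpM2l k0 (xd t ct tb); rewrite /K1; lra.
exists ((m c / w c) ^+ 2 + K1 * (2 * X)) => t ct tb.
have : (m t / w t) ^+ 2 - K1 * x t <= (m c / w c) ^+ 2 - K1 * x c.
  apply: (der_le0_ge (f := fun t => (m t / w t) ^+ 2 - K1 * x t)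
    (f1 := fun t => g1 t * x1 t - K1 * x1 t) ct) => s s1 s2.
    have [as_ sb] : a < s /\ s < b by lra.
    apply: (der_eq (derB (dg s as_ sb) (derM (der_cst _ _) (dx s as_ sb)))).
    by rewrite /=; ring.
  have [as_ sb] : a < s /\ s < b by lra.
  by rewrite -mulrBl pmulr_lle0 ?x10 // subr_le0 g1K // ltW.
have := ler_wpM2l K10 (xd t ct tb); rewrite -/(m t) /x; lra.
Qed.

Lemma der_opp_arg (f : R -> R) t d : der f (- t) d -> der (fun s => f (- s)) t (- d).
Proof.
move=> df; have dN : der (fun s : R => - s) t (-1) by apply: derN; exact: der_id.
by apply: (der_eq (der_comp df dN)); rewrite mulrN1.
Qed.

(** Reversal of time: the equation keeps its form with [al] negated, so [q] changes sign, and [n] is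
    negated to keep the Wronskian positive. *)
Lemma start_blowup a b al be (be1 : R -> R) w (w1 w2 : R -> R) n (n1 n2 : R -> R) X :
  a < b -> (forall t, a < t -> t < b -> 0 < w t) ->
  solves (fun t => a < t < b) al be w w1 w2 -> solves (fun t => a < t < b) al be n n1 n2 ->
  (forall t, a < t -> t < b -> der be t (be1 t)) ->
  (forall t, a < t -> t < b -> 0 < n1 t * w t - n t * w1 t) ->
  (forall t, a < t -> t < b -> al t - be1 t / 2 <= 0) ->
  (forall t, a < t -> t < b -> `|n t / w t| <= X) ->
  exists K, forall t, a < t -> t <= (a + b) / 2 ->
    ((n1 t * w t - n t * w1 t) / w t) ^+ 2 <= K.
Proof.
move=> ab w0 sw sn dbe m0 q0 xX.
have [||t /andP[t1 t2]|t /andP[t1 t2]|t t1 t2|t t1 t2|t t1 t2|t t1 t2|K hK] :=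
  @end_blowup (- b) (- a) (fun t => - al (- t)) (fun t => be (- t)) (fun t => - be1 (- t))
  (fun t => w (- t)) (fun t => - w1 (- t)) (fun t => w2 (- t))
  (fun t => - n (- t)) (fun t => n1 (- t)) (fun t => - n2 (- t)) X.
- by lra.
- by move=> t t1 t2; apply: w0; lra.
- have tab : a < - t < b by lra.
  have [d0 d1 d2] := sw (- t) tab.
  have D0 := der_opp_arg d0; have D1 := der_opp_arg d1; have D2 := der_opp_arg d2.
  split; first exact: D0.
  + by apply: (der_eq (derN D1)); rewrite opprK.
  + by apply: (der_eq D2); ring.
- have tab : a < - t < b by lra.
  have [d0 d1 d2] := sn (- t) tab.
  have D0 := der_opp_arg d0; have D1 := der_opp_arg d1; have D2 := der_opp_arg d2.
  split.
  + by apply: (der_eq (derN D0)); rewrite opprK.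
  + exact: D1.
  + by apply: (der_eq (derN D2)); ring.
- by apply: der_opp_arg; apply: dbe; lra.
- by have := m0 (- t); lra.
- by have := q0 (- t); lra.
- by rewrite mulNr normrN; apply: xX; lra.
exists K => t t1 t2; have := hK (- t); rewrite opprK.
rewrite (_ : n1 t * w t - - n t * - w1 t = n1 t * w t - n t * w1 t); last by ring.
by apply; lra.
Qed.

End ThirdOrder.

(** * Inverse functions and patterns of signs *)

Section InverseDerivative.
Variable R : realType.
Implicit Types (a b t s x y z : R).

Lemma der_inverse (X X1 tau : R -> R) a b (Y : set R) y :
  (forall t, a < t -> t < b -> der X t (X1 t)) ->
  (forall t, a < t -> t < b -> 0 < X1 t) -> open Y -> Y y ->
  (forall z, Y z -> [/\ a < tau z, tau z < b & X (tau z) = z]) ->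
  der tau y (X1 (tau y))^-1.
Proof.
move=> dX X10 oY Yy tauP; have [at_ tb Xt] := tauP y Yy.
have inc s t : a < s -> s < t -> t < b -> X s < X t.
  move=> h1 st h2; apply: (der_gt0_lt (f := X) (f1 := X1) st) => u u1 u2; last by apply: X10; lra.
  by apply: dX; lra.
have nab : \forall s \near tau y, a < s < b by exact: near_itv.
rewrite -{1}Xt; apply: is_derive_inverse.
- have cX := der_continuous (dX _ at_ tb).
  have : \forall s \near tau y, Y (X s) by apply: cX; rewrite Xt; exact: open_near.
  apply: filter_app; apply: filterS nab => s /andP[as_ sb] YX.
  have [h1 h2 h3] := tauP _ YX.
  have [lt|lt|//] := ltgtP (tau (X s)) s.
    by have := inc _ _ h1 lt sb; rewrite h3 ltxx.
  by have := inc _ _ as_ lt h2; rewrite h3 ltxx.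
- by apply: filterS nab => s /andP[h1 h2]; exact: der_continuous (dX s h1 h2).
- exact: dX.
- by rewrite gt_eqF // X10.
Qed.

Lemma second_order_pos (f f1 : R -> R) d : (forall t, der f t (f1 t)) -> der f1 0 d ->
  f 0 = 0 -> f1 0 = 0 -> 0 < d ->
  exists2 e, 0 < e & forall t, - e < t -> t < e -> 0 <= f t.
Proof.
move=> df df1 f0 f10 d0; have [e e0 [h1 h2]] := der_pos_incr df1 d0.
exists e => // t t1 t2; rewrite -f0; have [t0|t0] := leP 0 t.
  apply: (der_ge0_le (f1 := f1) t0) => s s1 s2; first exact: df.
  by rewrite -f10 ltW // h1 // add0r; lra.
apply: (der_le0_ge (f1 := f1) (ltW t0)) => s s1 s2; first exact: df.
by rewrite -f10 ltW // h2 // sub0r; lra.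
Qed.

(** [u] and [v] need not be distinct, nor satisfy [Z]: if there are fewer than two such points they
    are filled in, so that the interval is always cut into three pieces. *)
Lemma at_most_two (Z : R -> Prop) a b : a < b ->
  ~ (exists t1 t2 t3, [/\ a < t1, t1 < t2, t2 < t3, t3 < b & [/\ Z t1, Z t2 & Z t3]]) ->
  exists u v, [/\ a < u, u <= v, v < b &
    forall t, a < t -> t < b -> Z t -> t = u \/ t = v].
Proof.
move=> ab no3.
have [[z [az zb Zz]]|noz] := pselect (exists z, [/\ a < z, z < b & Z z]); last first.
  exists ((a + b) / 2), ((a + b) / 2); split; [lra|exact: lexx|lra|].
  by move=> t at_ tb Zt; exfalso; apply: noz; exists t.
have [[y [ay yb Zy yz]]|noy] := pselect (exists y, [/\ a < y, y < b, Z y & y <> z]); last first.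
  exists z, z; split => // t at_ tb Zt; left; apply: contrapT => tz.
  by apply: noy; exists t.
wlog : y z az zb Zz ay yb Zy yz / y < z.
  move=> H; have [lt|lt|//] := ltgtP y z; first exact: (H y z).
  by apply: (H z y) => //; exact: nesym.
move=> {}yz'; exists y, z; split => //; first exact: ltW.
move=> t at_ tb Zt; apply: contrapT => /not_orP[ty tz]; apply: no3.
have [lt|lt|//] := ltgtP t y; first by exists t, y, z.
have [lt'|lt'|//] := ltgtP t z; first by exists y, t, z.
by exists y, z, t.
Qed.

Lemma sign_on (q : R -> R) a b : (forall t, a < t -> t < b -> {for t, continuous q}) ->
  (forall t, a < t -> t < b -> q t != 0) ->
  exists s, (s = 1 \/ s = -1) /\ forall t, a < t -> t < b -> 0 < s * q t.
Proof.
move=> cq q0; have [ab|ba] := ltP a b; last first.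
  by exists 1; split=> [|t at_ tb]; [left|lra].
have [am mb] : a < (a + b) / 2 /\ (a + b) / 2 < b by lra.
have ns t at_ tb := nonzero_sign cq q0 am mb (t := t) at_ tb.
have [neg|pos|z] := ltgtP (q ((a + b) / 2)) 0.
- by exists (-1); split=> [|t at_ tb]; [right|have := ns t at_ tb; nra].
- by exists 1; split=> [|t at_ tb]; [left|have := ns t at_ tb; nra].
- by have := q0 _ am mb; rewrite z eqxx.
Qed.

End InverseDerivative.

(** * Three zeros of q beyond a base point *)

Section ThreeZeros.
Variable R : realType.
Implicit Types (p q s t u w x y z e : R).

Variables (L : R) (A B C A1 B1 C1 A2 B2 C2 : R -> R).

Hypothesis L0 : 0 < L.
Hypotheses (dA : forall t, der A t (A1 t)) (dB : forall t, der B t (B1 t))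
  (dC : forall t, der C t (C1 t)) (dA1 : forall t, der A1 t (A2 t))
  (dB1 : forall t, der B1 t (B2 t)) (dC1 : forall t, der C1 t (C2 t)).
Hypotheses (perA : forall t, A (t + L) = A t) (perB : forall t, B (t + L) = B t)
  (perC : forall t, C (t + L) = C t).
Hypotheses (A00 : A 0 = 1) (B00 : B 0 = 0) (C00 : C 0 = 0)
  (B10 : B1 0 = 1) (C10 : C1 0 = 0).
Hypothesis D0 : forall t, 0 < t -> t < L ->
  0 < det3 (A t) (B t) (C t) (A1 t) (B1 t) (C1 t) (A2 t) (B2 t) (C2 t).
Hypothesis simple : forall s t k, s < t -> t < s + L ->
  A t = k * A s -> B t = k * B s -> C t = k * C s -> False.

Variables (psi psi1 al be be1 a1 a2 b1 b2 c1 c2 : R -> R).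
Let P t := 0 < t < L.
Let a t := psi t * A t.
Let b t := psi t * B t.
Let c t := psi t * C t.
Hypothesis psi0 : forall t, P t -> 0 < psi t.
Hypothesis dpsi : forall t, P t -> der psi t (psi1 t).
Hypotheses (sa : solves P al be a a1 a2) (sb : solves P al be b b1 b2)
  (sc : solves P al be c c1 c2).
Hypothesis det1 : forall t, P t ->
  det3 (a t) (b t) (c t) (a1 t) (b1 t) (c1 t) (a2 t) (b2 t) (c2 t) = 1.
Hypothesis dbe : forall t, P t -> der be t (be1 t).
Hypothesis cq : forall t, P t -> {for t, continuous (fun t => al t - be1 t / 2)}.

(** The affine coordinate with the tangent line [C = 0] at infinity; with this sign it increases, by
    [m_gt0]. *)
Let X t := - B t / C t.

Lemma C_gt0 t : P t -> 0 < C t.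
Proof.
move=> /andP[t1 t2].
by have [] := convex L0 dA dB dC dA1 dB1 dC1 perA perB perC A00 B00 C00 B10 C10 D0 simple t1 t2.
Qed.

Lemma m_gt0 t : P t -> 0 < b t * c1 t - c t * b1 t.
Proof.
move=> Pt; have /andP[t1 t2] := Pt.
have [mt _] := convex L0 dA dB dC dA1 dB1 dC1 perA perB perC A00 B00 C00 B10 C10 D0 simple t1 t2.
have [db _ _] := sb Pt; have [dc _ _] := sc Pt.
have eb := der_unique db (derM (dpsi Pt) (dB t)).
have ec := der_unique dc (derM (dpsi Pt) (dC t)).
have -> : b t * c1 t - c t * b1 t = psi t ^+ 2 * (B t * C1 t - C t * B1 t).
  by rewrite eb ec /b /c; ring.
by rewrite mulr_gt0 // exprn_gt0 // psi0.
Qed.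

(** To first order at the base point [B] is [t] and [C] is 0. So [B] outweighs any multiple of [C],
    with a positive sign after 0 and a negative one before [L]. *)
Lemma X_ends y : exists2 e, 0 < e &
  (forall t, 0 < t -> t < e -> X t < y) /\ (forall t, L - e < t -> t < L -> y < X t).
Proof.
pose Y := `|y|.
have d1 : der (fun t => B t - Y * C t) 0 1.
  by der_auto; rewrite /= B10 C10; ring.
have d2 : der (fun t => B t + Y * C t) 0 1.
  by der_auto; rewrite /= B10 C10; ring.
have [e1 e10 [h1 _]] := der_pos_incr d1 ltr01.
have [e2 e20 [_ h2]] := der_pos_incr d2 ltr01.
have yY : y <= Y by exact: ler_norm.
have Yy : - Y <= y by rewrite lerNl /Y -normrN ler_norm.
pose e := Num.min (Num.min e1 e2) L.
have [e0 ee1 ee2 eL] : [/\ 0 < e, e <= e1, e <= e2 & e <= L].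
  by rewrite /e !lt_min e10 e20 L0 !ge_min !lexx !orbT.
exists e => //; split=> t t1 t2.
  have Ct : 0 < C t by apply: C_gt0; apply/andP; split; lra.
  have := h1 t t1; rewrite B00 C00 => H.
  rewrite /X ltr_pdivrMr //.
  have {}H : 0 < B t - Y * C t by have : 0 - Y * 0 < B t - Y * C t by [apply: H; lra]; lra.
  nra.
have Ct : 0 < C t by apply: C_gt0; apply/andP; split; lra.
have := h2 (t - L); rewrite B00 C00 => H.
have {H} : B (t - L) + Y * C (t - L) < 0 + Y * 0 by apply: H; lra.
rewrite -(perB (t - L)) -(perC (t - L)) subrK => H.
rewrite /X ltr_pdivlMr //; nra.
Qed.

Lemma three_zeros : exists t1 t2 t3, [/\ 0 < t1, t1 < t2, t2 < t3, t3 < L &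
  [/\ al t1 - be1 t1 / 2 = 0, al t2 - be1 t2 / 2 = 0 & al t3 - be1 t3 / 2 = 0]].
Proof.
apply: contrapT => no3.
have [u [v [u0 uv vL qz]]] := at_most_two L0 no3.
have Pin t : 0 < t -> t < L -> P t by move=> h1 h2; rewrite /P h1 h2.
have c0 t : P t -> 0 < c t by move=> Pt; rewrite mulr_gt0 ?psi0 ?C_gt0.
have cn t : P t -> c t != 0 by move=> /c0 ?; rewrite gt_eqF.
have cN t : P t -> C t != 0 by move=> /C_gt0 ?; rewrite gt_eqF.
have pn t : P t -> psi t != 0 by move=> /psi0 ?; rewrite gt_eqF.
pose nb t := - b t; pose nb1 t := - b1 t; pose nb2 t := - b2 t.
have sn : solves P al be nb nb1 nb2.
  move=> t Pt; have [d0 d1 d2] := sb Pt; split; try exact: derN.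
  by apply: (der_eq (derN d2)); rewrite /nb /nb1; ring.
pose m t := nb1 t * c t - nb t * c1 t; pose m1 t := nb2 t * c t - nb t * c2 t.
have m0 t : P t -> 0 < m t.
  by move=> /m_gt0; rewrite /m /nb /nb1; lra.
pose X1 t := m t / c t ^+ 2.
have XE t : P t -> X t = nb t / c t.
  by move=> Pt; rewrite /X /nb /b /c; field; rewrite pn ?cN.
have dX t : 0 < t -> t < L -> der X t (X1 t).
  move=> t1 t2; have Pt := Pin t t1 t2.
  apply: (der_near (f := fun t => nb t / c t)); last exact: der_ratio sc sn Pt (cn t Pt).
  by apply: filterS (near_itv t1 t2) => s Ps; rewrite XE.
have X10 t : 0 < t -> t < L -> 0 < X1 t.
  by move=> t1 t2; rewrite /X1 divr_gt0 ?exprn_gt0 ?c0 ?m0 ?Pin.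
have X_lt s t : 0 < s -> s < t -> t < L -> X s < X t.
  move=> s1 st tL; apply: (der_gt0_lt (f := X) (f1 := X1) st) => w w1 w2.
    by apply: dX; lra.
  by apply: X10; lra.
have X_le s t : 0 < s -> s <= t -> t < L -> X s <= X t.
  by move=> s1; rewrite le_eqVlt => /predU1P[-> //|st] tL; apply/ltW/X_lt.
have Xsurj y : exists t, P t /\ X t = y.
  have [e e0 [h1 h2]] := X_ends y.
  pose d := Num.min (e / 2) (L / 4).
  have [d0 de dL] : [/\ 0 < d, d < e & d <= L / 4].
    rewrite /d lt_min gt_min ge_min lexx orbT; split=> //; first by apply/andP; split; lra.
    by apply/orP; left; lra.
  have [|||t [t1 t2] Xt] := @ivt _ X d (L - d) y.
  - by lra.
  - by move=> t t1 t2; apply: der_continuous (dX t _ _); lra.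
  - rewrite mulr_le0_ge0 // ?subr_le0 ?subr_ge0 ltW //.
      by apply: h1.
    by apply: h2; lra.
  by exists t; split=> //; apply: Pin; lra.
have [tau tauP] := choice Xsurj.
have tauIn y : 0 < tau y /\ tau y < L by have [/andP[]] := tauP y.
have tauK y : X (tau y) = y by have [] := tauP y.
have Pt y : P (tau y) by have [] := tauP y.
have dtau y : der tau y (X1 (tau y))^-1.
  apply: (@der_inverse R X X1 tau 0 L setT y dX X10 openT) => // z _.
  by split; [case: (tauIn z)|case: (tauIn z)|].
have tau_lt x y : x < y -> tau x < tau y.
  move=> xy; rewrite ltNge; apply/negP => le.
  have [[t1 t2] [t3 t4]] := (tauIn x, tauIn y).
  by have := X_le _ _ t3 le t2; rewrite !tauK; lra.
have tau_le_of x t : P t -> x <= X t -> tau x <= t.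
  move=> /andP[t1 t2]; rewrite -{1}(tauK x) => le; rewrite leNgt; apply/negP => lt.
  by have [t3 t4] := tauIn x; have := X_lt _ _ t1 lt t4; lra.
have tau_ge_of x t : P t -> X t <= x -> t <= tau x.
  move=> /andP[t1 t2]; rewrite -{1}(tauK x) => le; rewrite leNgt; apply/negP => lt.
  by have [t3 t4] := tauIn x; have := X_lt _ _ t3 lt t2; lra.
have X1n y : X1 (tau y) != 0 by have [t1 t2] := tauIn y; rewrite gt_eqF // X10.
have der_tau (f : R -> R) f1 y : der f (tau y) (f1 * X1 (tau y)) ->
    der (fun x => f (tau x)) y f1.
  by move=> df; apply: (der_eq (der_comp df (dtau y))); rewrite mulfK.
pose Q t := c t * c2 t - 1/2 * c1 t ^+ 2 - 1/2 * be t * c t ^+ 2.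
pose Phi t := (a1 t * c t - a t * c1 t) / m t.
pose h t := m t / c t.
pose h1 t := (m1 t * c t - m t * c1 t) / m t.
have mn t : P t -> m t != 0 by move=> /m0 ?; rewrite gt_eqF.
have prof : profile (fun x => A (tau x) / C (tau x)) (fun x => Phi (tau x))
   (fun x => h (tau x)) (fun x => h1 (tau x)) (fun x => - 4 * Q (tau x)).
  split.
  - move=> x; have Px := Pt x; apply: (der_tau (fun t => A t / C t)).
    have [t1 t2] := tauIn x.
    apply: (der_near (f := fun t => a t / c t)).
      by apply: filterS (near_itv t1 t2) => s Ps; rewrite /a /c -mulf_div divff ?mul1r ?pn.
    apply: (der_eq (der_ratio sc sa Px (cn _ Px))).
    by rewrite /Phi /X1; field; rewrite cn ?mn.
  - move=> x; have Px := Pt x; apply: (der_tau Phi).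
    have [dk _] := der_wronskian sc sa Px; have [dm _] := der_wronskian sc sn Px.
    apply: (der_eq (derM dk (derV (mn _ Px) dm))).
    have := det1 Px; rewrite /h /X1 /m1 /det3.
    have := cn _ Px; have := mn _ Px; rewrite /m /nb /nb1 /nb2.
    set t := tau x => mt ct E.
    (* Times [m ^+ 2], the derivative of [Phi] along the parameter is [c] times the determinant
       [det1]. This is where $F'' = h^{-3}$ comes from. *)
    apply: (mulIf (x := (- b1 t * c t - - b t * c1 t) ^+ 2)); first by rewrite expf_neq0.
    transitivity (c t * (a t * (b1 t * c2 t - c1 t * b2 t) - b t * (a1 t * c2 t - c1 t * a2 t) +
        c t * (a1 t * b2 t - b1 t * a2 t))); first by field.
    by rewrite E; field; rewrite ct mt.
  - by move=> x; rewrite /h divr_gt0 ?m0 ?c0 // Pt.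
  - move=> x; have Px := Pt x; apply: (der_tau h).
    apply: (der_eq (der_height sc sn Px (cn _ Px))).
    by rewrite /h1 /X1 -/(m _) -/(m1 _); field; rewrite cn ?mn.
  - move=> x; have Px := Pt x; have [t1 t2] := tauIn x.
    apply: (der_tau (fun t => 2 * (h t * h1 t))).
    apply: (der_near (f := fun t => 2 * (m1 t - m t * c1 t / c t))).
      by apply: filterS (near_itv t1 t2) => s Ps; rewrite /h /h1; field; rewrite cn ?mn.
    exact: der_slope sc sn Px (cn _ Px).
  (* Near the base point [A] exceeds any multiple of [B] in absolute value; division by [C] turns
     this into growth faster than linear. The right end is reached through the period. *)
  - move=> K; have K0 : 0 <= `|K| by exact: normr_ge0.
    pose f1 t := A t - `|K| * B t; pose f2 t := A t + `|K| * B t.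
    have df1 : der f1 0 (A1 0 - `|K| * B1 0) by rewrite /f1; der_ring.
    have df2 : der f2 0 (A1 0 + `|K| * B1 0) by rewrite /f2; der_ring.
    have [|e1 e10 g1] := continuous_gt0_near (der_continuous df1).
      by rewrite /f1 A00 B00; lra.
    have [|e2 e20 g2] := continuous_gt0_near (der_continuous df2).
      by rewrite /f2 A00 B00; lra.
    pose e := Num.min (Num.min e1 e2) (L / 2).
    have [e0 ee1 ee2 eL] : [/\ 0 < e, e <= e1, e <= e2 & e <= L / 2].
      by rewrite /e !lt_min e10 e20 !ge_min !lexx !orbT; split=> //; lra.
    have Pe1 : P (e / 2) by apply: Pin; lra.
    have Pe2 : P (L - e / 2) by apply: Pin; lra.
    exists (Num.max (Num.max (X (L - e / 2)) (- X (e / 2))) 0) => x.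
    rewrite !ge_max => /andP[/andP[x1 x2] x0].
    have Kx : K * x <= `|K| * x by rewrite ler_wpM2r // ler_norm.
    split; apply: (le_trans Kx).
      have tl := tau_ge_of x _ Pe2 x1; have [t1 t2] := tauIn x.
      have := g2 (tau x - L); rewrite /f2 -(perA (tau x - L)) -(perB (tau x - L)) subrK => H.
      have {}H : 0 < A (tau x) + `|K| * B (tau x) by apply: H; lra.
      have Ct := C_gt0 (Pt x); rewrite ler_pdivlMr // -{1}(tauK x) /X.
      have -> : `|K| * (- B (tau x) / C (tau x)) * C (tau x) = - (`|K| * B (tau x)).
        by field; rewrite gt_eqF.
      by lra.
    have tl := tau_le_of (- x) _ Pe1 _; have {}tl : tau (- x) <= e / 2 by apply: tl; lra.
    have [t1 t2] := tauIn (- x).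
    have := g1 (tau (- x)); rewrite /f1 => H.
    have {}H : 0 < A (tau (- x)) - `|K| * B (tau (- x)) by apply: H; lra.
    have Ct := C_gt0 (Pt (- x)); rewrite ler_pdivlMr //.
    have xE : x = B (tau (- x)) / C (tau (- x)).
      by rewrite -[LHS]opprK -{1}(tauK (- x)) /X mulNr opprK.
    move: xE Ct H; set t := tau (- x) => xE Ct H.
    have -> : `|K| * x * C t = `|K| * B t by rewrite xE; field; rewrite gt_eqF.
    by lra.
(* The quotient $F/X^2$ is $AC/B^2$, and near the base point $B$ is $t$ and $C$ is $C''(0) t^2/2$ to
   leading order. The two ends of the graph approach the same point, so they share the rate
   [C2 0 / 2]. *)
have asym e : 0 < e -> exists Y, forall x, Y <= x ->
  `|A (tau x) / C (tau x) - (C2 0 / 2) * x ^+ 2| <= e * x ^+ 2 /\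
  `|A (tau (- x)) / C (tau (- x)) - (C2 0 / 2) * x ^+ 2| <= e * x ^+ 2.
  move=> e0; set k := C2 0 / 2.
  pose f1 t := e * B t ^+ 2 - (A t * C t - k * B t ^+ 2).
  pose f2 t := e * B t ^+ 2 + (A t * C t - k * B t ^+ 2).
  pose f11 t := 2 * e * (B t * B1 t) - (A1 t * C t + A t * C1 t - 2 * k * (B t * B1 t)).
  pose f21 t := 2 * e * (B t * B1 t) + (A1 t * C t + A t * C1 t - 2 * k * (B t * B1 t)).
  have [|||||e1 e10 g1] := @second_order_pos R f1 f11 (2 * e).
  - by move=> t; rewrite /f1 /f11; der_ring.
  - by rewrite /f11; der_auto; rewrite /= A00 B00 C00 B10 C10 /k; field.
  - by rewrite /f1 B00 C00; ring.
  - by rewrite /f11 B00 C00 C10; ring.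
  - by lra.
  have [|||||e2 e20 g2] := @second_order_pos R f2 f21 (2 * e).
  - by move=> t; rewrite /f2 /f21; der_ring.
  - by rewrite /f21; der_auto; rewrite /= A00 B00 C00 B10 C10 /k; field.
  - by rewrite /f2 B00 C00; ring.
  - by rewrite /f21 B00 C00 C10; ring.
  - by lra.
  pose d := Num.min (Num.min e1 e2) (L / 2).
  have [d0 de1 de2 dL] : [/\ 0 < d, d <= e1, d <= e2 & d <= L / 2].
    by rewrite /d !lt_min e10 e20 !ge_min !lexx !orbT; split=> //; lra.
  have Pe1 : P (d / 2) by apply: Pin; lra.
  have Pe2 : P (L - d / 2) by apply: Pin; lra.
  have key t : P t -> 0 <= f1 t -> 0 <= f2 t ->
      `|A t / C t - k * X t ^+ 2| <= e * X t ^+ 2.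
    move=> Pt'; rewrite /f1 /f2 => F1 F2; have Ct := C_gt0 Pt'; have Cn := cN t Pt'.
    have -> : A t / C t - k * X t ^+ 2 = (A t * C t - k * B t ^+ 2) / C t ^+ 2.
      by rewrite /X; field.
    have -> : e * X t ^+ 2 = (e * B t ^+ 2) / C t ^+ 2 by rewrite /X; field.
    rewrite normrM [X in _ * X <= _]ger0_norm ?invr_ge0 ?sqr_ge0 //.
    by rewrite ler_pM2r ?invr_gt0 ?exprn_gt0 // ler_norml; apply/andP; split; lra.
  exists (Num.max (X (L - d / 2)) (- X (d / 2))) => x.
  rewrite ge_max => /andP[x1 x2]; split.
    have tl := tau_ge_of x _ Pe2 x1; have [t1 t2] := tauIn x.
    have := key (tau x) (Pt x); rewrite tauK; apply.
      have := g1 (tau x - L); rewrite /f1 -(perA (tau x - L)) -(perB (tau x - L)).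
      by rewrite -(perC (tau x - L)) subrK; apply; lra.
    have := g2 (tau x - L); rewrite /f2 -(perA (tau x - L)) -(perB (tau x - L)).
    by rewrite -(perC (tau x - L)) subrK; apply; lra.
  have tl : tau (- x) <= d / 2 by apply: tau_le_of => //; lra.
  have [t1 t2] := tauIn (- x).
  have := key (tau (- x)) (Pt (- x)); rewrite tauK sqrrN; apply.
    by apply: g1; lra.
  by apply: g2; lra.
pose q t := al t - be1 t / 2.
have dQ t : P t -> der (fun t => - 4 * Q t) t (- 4 * (q t * c t ^+ 2)).
  by move=> Pt'; apply: (der_eq (derM (der_cst _ _) (der_quad sc Pt' (dbe Pt')))); rewrite /q /=; ring.
(* $g'' = -4 Q$ and $Q' = q c^2$, so a sign [s] of [q] makes $g''$ monotone with the sign [- s]. *)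
have mono lo hi s : 0 <= lo -> hi <= L -> s = 1 \/ s = -1 ->
  (forall t, lo < t -> t < hi -> 0 < s * q t) ->
  mono_on (- s) (fun x => - 4 * Q (tau x)) (fun x => lo <= tau x <= hi).
  move=> lo0 hiL s1 sq x y /andP[x1 x2] /andP[y1 y2] xy.
  have txy := tau_lt x y xy; have [t1 t2] := tauIn x; have [t3 t4] := tauIn y.
  have : s * (- 4 * Q (tau y)) < s * (- 4 * Q (tau x)).
    apply: (der_lt0_gt (f := fun t => s * (- 4 * Q t))
      (f1 := fun t => s * (- 4 * (q t * c t ^+ 2))) txy) => t g1 g2.
      have Pt' : P t by apply: Pin; lra.
      by apply: (der_eq (derM (der_cst _ _) (dQ t Pt'))); rewrite /=; ring.
    have Pt' : P t by apply: Pin; lra.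
    have sqt : 0 < s * q t by apply: sq; lra.
    have : 0 < s * q t * c t ^+ 2 by rewrite mulr_gt0 // exprn_gt0 // c0.
    by lra.
  by lra.
have qn lo hi : 0 <= lo -> hi <= L -> (forall t, lo < t -> t < hi -> t <> u /\ t <> v) ->
  exists s, (s = 1 \/ s = -1) /\ forall t, lo < t -> t < hi -> 0 < s * q t.
  move=> lo0 hiL tn; apply: sign_on => t t1 t2.
    by apply: cq; apply: Pin; lra.
  apply/eqP => qt; have [tu tv] := tn t t1 t2.
  have t0L : 0 < t /\ t < L by lra.
  by have [] := qz t t0L.1 t0L.2 qt.
have [s1 [s1E sq1]] : exists s, (s = 1 \/ s = -1) /\ forall t, 0 < t -> t < u -> 0 < s * q t.
  by apply: qn; [lra|lra|move=> t t1 t2; split; lra].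
have [s2 [s2E sq2]] : exists s, (s = 1 \/ s = -1) /\ forall t, u < t -> t < v -> 0 < s * q t.
  by apply: qn; [lra|lra|move=> t t1 t2; split; lra].
have [s3 [s3E sq3]] : exists s, (s = 1 \/ s = -1) /\ forall t, v < t -> t < L -> 0 < s * q t.
  by apply: qn; [lra|lra|move=> t t1 t2; split; lra].
have flip s : s = 1 \/ s = -1 -> - s = 1 \/ - s = -1.
  by case=> ->; [right|left; rewrite opprK].
have Pu : P u by apply: Pin; lra.
have Pv : P v by apply: Pin; lra.
apply: (@profile_False _ _ _ _ _ _ (C2 0 / 2) (X u) (X v) (- s1) (- s2) (- s3) prof asym).
- by apply: X_le; lra.
- exact: flip.
- exact: flip.
- exact: flip.
- move=> x y x1 y1 xy; apply: (mono 0 u s1 (lexx 0) _ s1E sq1) => //; first lra.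
    by have [t1 _] := tauIn x; rewrite (ltW t1) tau_le_of.
  by have [t1 _] := tauIn y; rewrite (ltW t1) tau_le_of.
- move=> x y /andP[x1 x2] /andP[y1 y2] xy.
  apply: (mono u v s2 (ltW u0) (ltW vL) s2E sq2) => //.
    by rewrite tau_le_of // tau_ge_of.
  by rewrite tau_le_of // tau_ge_of.
- move=> x y x1 y1 xy; apply: (mono v L s3 _ (lexx L) s3E sq3) => //; first lra.
    by have [_ t1] := tauIn x; rewrite (ltW t1) tau_ge_of.
  by have [_ t1] := tauIn y; rewrite (ltW t1) tau_ge_of.
Qed.

End ThreeZeros.

(** * The unimodular lift *)

Section Hat.
Variable R : realType.
Implicit Types (f : R -> R) (s t : R).

Lemma smoothD U f (g : R -> R) : open U -> smooth_on U f -> smooth_on U g -> smooth_on U (fun x => f x + g x).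
Proof. by move=> oU sf sg n; apply: CnD. Qed.
Lemma smoothB U f (g : R -> R) : open U -> smooth_on U f -> smooth_on U g -> smooth_on U (fun x => f x - g x).
Proof. by move=> oU sf sg n; apply: CnB. Qed.
Lemma smoothM U f (g : R -> R) : open U -> smooth_on U f -> smooth_on U g -> smooth_on U (fun x => f x * g x).
Proof. by move=> oU sf sg n; apply: CnM. Qed.
Lemma smoothN U f : open U -> smooth_on U f -> smooth_on U (fun x => - f x).
Proof. by move=> oU sf n; apply: CnN. Qed.
Lemma smooth_cst U (c : R) : open U -> smooth_on U (fun=> c).
Proof. by move=> oU n; apply: Cn_cst. Qed.
Lemma smoothV U f : open U -> (forall t, U t -> f t != 0) -> smooth_on U f ->
  smooth_on U (fun x => (f x)^-1).
Proof. by move=> oU f0 sf n; apply: CnV. Qed.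
Lemma smooth_pow U f (c : R) : open U -> (forall t, U t -> 0 < f t) -> smooth_on U f ->
  smooth_on U (fun x => expR (c * ln (f x))).
Proof. by move=> oU f0 sf n; apply: Cn_exp => //; apply: CnM => //; [exact: Cn_cst|apply: Cn_ln]. Qed.

Definition wronski3 (G0 G1 G2 : R -> R) t :=
  det3 (G0 t) (G1 t) (G2 t) (derive1 G0 t) (derive1 G1 t) (derive1 G2 t)
    (derive1 (derive1 G0) t) (derive1 (derive1 G1) t) (derive1 (derive1 G2) t).

Lemma smooth_det3 U f0 f1 f2 g0 g1 g2 h0 h1 h2 : open U ->
  smooth_on U f0 -> smooth_on U f1 -> smooth_on U f2 ->
  smooth_on U g0 -> smooth_on U g1 -> smooth_on U g2 ->
  smooth_on U h0 -> smooth_on U h1 -> smooth_on U h2 ->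
  smooth_on U (fun t => det3 (f0 t) (f1 t) (f2 t) (g0 t) (g1 t) (g2 t) (h0 t) (h1 t) (h2 t)).
Proof.
move=> oU *; rewrite /det3.
by repeat first [eassumption | apply: (smoothD oU) | apply: (smoothN oU) | apply: (smoothM oU)].
Qed.

Lemma smooth_wronski3 U (G0 G1 G2 : R -> R) : open U -> smooth_on U G0 -> smooth_on U G1 ->
  smooth_on U G2 -> smooth_on U (wronski3 G0 G1 G2).
Proof.
by move=> oU s0 s1 s2; apply: smooth_det3 => //; repeat (apply: smooth_d); eassumption.
Qed.

(* The lift [psi * G] of determinant 1, where [psi = D^(-1/3)], satisfies a
   third order equation without second order term. *)
Record hat (G0 G1 G2 psi al be : R -> R) (U : set R) : Prop := Hat {
  hat_psi : smooth_on U psi;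
  hat_al : smooth_on U al;
  hat_be : smooth_on U be;
  hat_gt0 : forall t, U t -> 0 < psi t;
  hat_D : forall t, U t -> psi t ^+ 3 * wronski3 G0 G1 G2 t = 1;
  hat_solves0 : let y := fun t => psi t * G0 t in
    solves U al be y (derive1 y) (derive1 (derive1 y));
  hat_solves1 : let y := fun t => psi t * G1 t in
    solves U al be y (derive1 y) (derive1 (derive1 y));
  hat_solves2 : let y := fun t => psi t * G2 t in
    solves U al be y (derive1 y) (derive1 (derive1 y));
  hat_det : forall t, U t -> wronski3 (fun t => psi t * G0 t) (fun t => psi t * G1 t)
    (fun t => psi t * G2 t) t = 1 }.

Lemma open_gt0 f : (forall t, {for t, continuous f}) -> open [set t | 0 < f t].
Proof.
move=> cf; rewrite openE => t /= ft; have [e e0 he] := continuous_gt0_near (cf t) ft.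
apply/nbhs_ballP; exists e => //= s; rewrite ball_itv // => /andP[]; exact: he.
Qed.

Lemma det3_scale (p p1 p2 a b c a1 b1 c1 a2 b2 c2 : R) :
  det3 (p * a) (p * b) (p * c) (p1 * a + p * a1) (p1 * b + p * b1) (p1 * c + p * c1)
    (p2 * a + 2 * p1 * a1 + p * a2) (p2 * b + 2 * p1 * b1 + p * b2)
    (p2 * c + 2 * p1 * c1 + p * c2) = p ^+ 3 * det3 a b c a1 b1 c1 a2 b2 c2.
Proof. by rewrite /det3; ring. Qed.

Lemma det3_cramer (a b c a1 b1 c1 a2 b2 c2 a3 b3 c3 : R) :
  [/\ a3 * det3 a b c a1 b1 c1 a2 b2 c2 = det3 a3 b3 c3 a1 b1 c1 a2 b2 c2 * a +
        det3 a b c a3 b3 c3 a2 b2 c2 * a1 + det3 a b c a1 b1 c1 a3 b3 c3 * a2,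
      b3 * det3 a b c a1 b1 c1 a2 b2 c2 = det3 a3 b3 c3 a1 b1 c1 a2 b2 c2 * b +
        det3 a b c a3 b3 c3 a2 b2 c2 * b1 + det3 a b c a1 b1 c1 a3 b3 c3 * b2 &
      c3 * det3 a b c a1 b1 c1 a2 b2 c2 = det3 a3 b3 c3 a1 b1 c1 a2 b2 c2 * c +
        det3 a b c a3 b3 c3 a2 b2 c2 * c1 + det3 a b c a1 b1 c1 a3 b3 c3 * c2].
Proof. by rewrite /det3; split; ring. Qed.

Lemma solve_unit (x d y z e w : R) : x * d = y + z + e * w -> d = 1 -> e = 0 -> x = y + z.
Proof. by move=> + d1 e0; rewrite d1 e0 mulr1 mul0r addr0. Qed.

Lemma der_det3 (f0 f1 f2 g0 g1 g2 h0 h1 h2 : R -> R) (k0 k1 k2 : R) t :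
  der f0 t (g0 t) -> der f1 t (g1 t) -> der f2 t (g2 t) ->
  der g0 t (h0 t) -> der g1 t (h1 t) -> der g2 t (h2 t) ->
  der h0 t k0 -> der h1 t k1 -> der h2 t k2 ->
  der (fun t => det3 (f0 t) (f1 t) (f2 t) (g0 t) (g1 t) (g2 t) (h0 t) (h1 t) (h2 t)) t
    (det3 (f0 t) (f1 t) (f2 t) (g0 t) (g1 t) (g2 t) k0 k1 k2).
Proof.
move=> *; rewrite /det3; apply: der_eq.
  apply: derD; [apply: derB|]; (apply: derM; [eassumption|]);
    by apply: derB; apply: derM; eassumption.
by rewrite /=; ring.
Qed.

Lemma der_scale (p f : R -> R) U t : open U -> smooth_on U p -> smooth_on U f -> U t ->
  derive1 (fun t => p t * f t) t = derive1 p t * f t + p t * derive1 f t.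
Proof.
by move=> oU sp sf Ut; apply: der_val; apply: derM; exact: smooth_der Ut.
Qed.

Lemma der2_scale (p f : R -> R) U t : open U -> smooth_on U p -> smooth_on U f -> U t ->
  derive1 (derive1 (fun t => p t * f t)) t =
    derive1 (derive1 p) t * f t + 2 * derive1 p t * derive1 f t + p t * derive1 (derive1 f) t.
Proof.
move=> oU sp sf Ut; apply: der_val.
apply: (der_near (f := fun t => derive1 p t * f t + p t * derive1 f t)).
  by apply: filterS (open_near oU Ut) => s Us; rewrite (der_scale oU).
have D0 := smooth_der sp Ut; have D1 := smooth_der (smooth_d sp) Ut.
have D2 := smooth_der sf Ut; have D3 := smooth_der (smooth_d sf) Ut.
apply: (der_eq (derD (derM D1 D2) (derM D0 D3))).
by rewrite mulrDl mul1r mulrDl !addrA.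
Qed.

Lemma hat_exists (G0 G1 G2 : R -> R) : smooth_on setT G0 -> smooth_on setT G1 ->
  smooth_on setT G2 -> exists psi al be, hat G0 G1 G2 psi al be [set t | 0 < wronski3 G0 G1 G2 t].
Proof.
move=> s0 s1 s2; set D := wronski3 G0 G1 G2; set U := [set t | 0 < D t].
have sD : smooth_on setT D by apply: smooth_wronski3 => //; exact: openT.
have oU : open U by apply: open_gt0 => t; apply: (smooth_continuous sD).
have [psi [psi0 spsi psiE]] : exists psi : R -> R, [/\ forall t, 0 < psi t, smooth_on U psi &
    forall t, U t -> psi t ^+ 3 * D t = 1].
  exists (fun t => expR (- (1/3) * ln (D t))); split.
  - by move=> t; exact: expR_gt0.
  - by apply: smooth_pow => //; exact: smooth_sub sD.
  move=> t Ut; rewrite -expRM_natl.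
  have -> : 3%:R * (- (1/3) * ln (D t)) = - ln (D t) by field.
  by rewrite expRN lnK ?posrE // mulVf // gt_eqF.
have sU f : smooth_on setT f -> smooth_on U f by exact: smooth_sub.
have [s0' s1' s2'] := And3 (sU _ s0) (sU _ s1) (sU _ s2).
have det1' t : U t -> wronski3 (fun t => psi t * G0 t) (fun t => psi t * G1 t)
    (fun t => psi t * G2 t) t = 1.
  move=> Ut; rewrite /wronski3.
  rewrite (der_scale oU spsi s0' Ut) (der_scale oU spsi s1' Ut) (der_scale oU spsi s2' Ut).
  rewrite (der2_scale oU spsi s0' Ut) (der2_scale oU spsi s1' Ut) (der2_scale oU spsi s2' Ut).
  rewrite det3_scale.
  exact: psiE.
have sy f : smooth_on U f -> smooth_on U (fun t => psi t * f t).
  by move=> sf; apply: smoothM.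
have [sy0 sy1 sy2] := And3 (sy _ s0') (sy _ s1') (sy _ s2').
set y0 := (fun t => psi t * G0 t) in det1' sy0.
set y1 := (fun t => psi t * G1 t) in det1' sy1.
set y2 := (fun t => psi t * G2 t) in det1' sy2.
pose al t := det3 (derive1 (derive1 (derive1 y0)) t) (derive1 (derive1 (derive1 y1)) t)
  (derive1 (derive1 (derive1 y2)) t) (derive1 y0 t) (derive1 y1 t) (derive1 y2 t)
  (derive1 (derive1 y0) t) (derive1 (derive1 y1) t) (derive1 (derive1 y2) t).
pose be t := det3 (y0 t) (y1 t) (y2 t) (derive1 (derive1 (derive1 y0)) t)
  (derive1 (derive1 (derive1 y1)) t) (derive1 (derive1 (derive1 y2)) t)
  (derive1 (derive1 y0) t) (derive1 (derive1 y1) t) (derive1 (derive1 y2) t).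
(* The derivative of the constant determinant is the coefficient of the second derivatives in
   Cramer's rule, so these drop out of the equation. *)
have det0 t : U t -> det3 (y0 t) (y1 t) (y2 t) (derive1 y0 t) (derive1 y1 t) (derive1 y2 t)
    (derive1 (derive1 (derive1 y0)) t) (derive1 (derive1 (derive1 y1)) t)
    (derive1 (derive1 (derive1 y2)) t) = 0.
  move=> Ut; apply: (der_unique (f := wronski3 y0 y1 y2) (t := t)); last first.
    apply: (der_near (f := fun=> 1)); last exact: der_cst.
    by apply: filterS (open_near oU Ut) => s Us; rewrite det1'.
  apply: der_det3; try exact: smooth_der Ut.
  - exact: smooth_der (smooth_d sy0) Ut.
  - exact: smooth_der (smooth_d sy1) Ut.
  - exact: smooth_der (smooth_d sy2) Ut.
  - exact: smooth_der (smooth_d (smooth_d sy0)) Ut.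
  - exact: smooth_der (smooth_d (smooth_d sy1)) Ut.
  - exact: smooth_der (smooth_d (smooth_d sy2)) Ut.
have cramer f : smooth_on U f -> (forall t, U t ->
     derive1 (derive1 (derive1 f)) t = al t * f t + be t * derive1 f t) ->
     solves U al be f (derive1 f) (derive1 (derive1 f)).
  move=> sf E t Ut; split; first exact: smooth_der sf Ut.
    exact: smooth_der (smooth_d sf) Ut.
  by apply: (der_eq (smooth_der (smooth_d (smooth_d sf)) Ut)); exact: E.
have sal : smooth_on U al by apply: smooth_det3 => //; repeat (apply: smooth_d); eassumption.
have sbe : smooth_on U be by apply: smooth_det3 => //; repeat (apply: smooth_d); eassumption.
have cr t := det3_cramer (y0 t) (y1 t) (y2 t) (derive1 y0 t) (derive1 y1 t) (derive1 y2 t)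
  (derive1 (derive1 y0) t) (derive1 (derive1 y1) t) (derive1 (derive1 y2) t)
  (derive1 (derive1 (derive1 y0)) t) (derive1 (derive1 (derive1 y1)) t)
  (derive1 (derive1 (derive1 y2)) t).
have [e0 [e1 e2]] : (forall t, U t -> derive1 (derive1 (derive1 y0)) t = al t * y0 t + be t * derive1 y0 t) /\
  (forall t, U t -> derive1 (derive1 (derive1 y1)) t = al t * y1 t + be t * derive1 y1 t) /\
  (forall t, U t -> derive1 (derive1 (derive1 y2)) t = al t * y2 t + be t * derive1 y2 t).
  split; [|split] => t Ut; have [c0 c1 c2] := cr t; have d1 := det1' t Ut;
    rewrite /wronski3 in d1; have d0 := det0 t Ut.
  - exact: (solve_unit c0 d1 d0).
  - exact: (solve_unit c1 d1 d0).
  - exact: (solve_unit c2 d1 d0).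
exists psi, al, be; split.
- exact: spsi.
- exact: sal.
- exact: sbe.
- by move=> t _; exact: psi0.
- exact: psiE.
- exact: (cramer _ sy0 e0).
- exact: (cramer _ sy1 e1).
- exact: (cramer _ sy2 e2).
- exact: det1'.
Qed.

Definition cross_nz (a b c a' b' c' : R) : Prop :=
  ~ [/\ b * c' - c * b' = 0, c * a' - a * c' = 0 & a * b' - b * a' = 0].

(** With $v = (a, b, c)$ and $v' = (a', b', c')$, the rows are the basis dual to $v, v', v \times
    v'$, of determinant $1/N$ for $N = |v \times v'|^2$. Its positivity preserves the sign of
    [wronski3] under the change of frame. *)
Lemma dual_frame (a b c a' b' c' : R) : cross_nz a b c a' b' c' ->
  exists p q r p' q' r' p'' q'' r'',
  [/\ [/\ p * a + q * b + r * c = 1, p' * a + q' * b + r' * c = 0 &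
          p'' * a + q'' * b + r'' * c = 0],
      [/\ p * a' + q * b' + r * c' = 0, p' * a' + q' * b' + r' * c' = 1 &
          p'' * a' + q'' * b' + r'' * c' = 0] &
      0 < det3 p q r p' q' r' p'' q'' r''].
Proof.
move=> nz; pose x := b * c' - c * b'; pose y := c * a' - a * c'; pose z := a * b' - b * a'.
pose N := x ^+ 2 + y ^+ 2 + z ^+ 2.
have N0 : N != 0.
  apply/eqP => N0; apply: nz.
  have := sqr_ge0 x; have := sqr_ge0 y; have := sqr_ge0 z => z0 y0 x0.
  have [xx yy zz] : [/\ x ^+ 2 == 0, y ^+ 2 == 0 & z ^+ 2 == 0].
    by move: N0; rewrite /N => N0; split; apply/eqP; lra.
  by move: xx yy zz; rewrite !sqrf_eq0 => /eqP ? /eqP ? /eqP ?.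
have Np : 0 < N by rewrite lt_neqAle eq_sym N0 /N !addr_ge0 ?sqr_ge0.
exists ((b' * z - c' * y) / N), ((c' * x - a' * z) / N), ((a' * y - b' * x) / N),
  ((y * c - z * b) / N), ((z * a - x * c) / N), ((x * b - y * a) / N), (x / N), (y / N), (z / N).
split.
- by split; move: N0; rewrite /N /x /y /z => N0; field.
- by split; move: N0; rewrite /N /x /y /z => N0; field.
suff -> : det3 ((b' * z - c' * y) / N) ((c' * x - a' * z) / N) ((a' * y - b' * x) / N)
  ((y * c - z * b) / N) ((z * a - x * c) / N) ((x * b - y * a) / N) (x / N) (y / N) (z / N)
  = N^-1 by rewrite invr_gt0.
by rewrite /det3; move: N0; rewrite /N /x /y /z => N0; field.
Qed.

End Hat.

(** * Arcs between consecutive inflection points *)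

Section Arc.
Variable R : realType.
Implicit Types (f : R -> R) (s t : R).

Definition lin3 (p q r : R) (f g h : R -> R) t := p * f t + q * g t + r * h t.

Lemma der_lin3 p q r f (g h : R -> R) t a b c : der f t a -> der g t b -> der h t c ->
  der (lin3 p q r f g h) t (p * a + q * b + r * c).
Proof. by move=> df dg dh; rewrite /lin3; der_ring. Qed.

Lemma solves_lin3 (P : R -> Prop) al be f (f1 f2 g g1 g2 h h1 h2 : R -> R) p q r :
  solves P al be f f1 f2 -> solves P al be g g1 g2 -> solves P al be h h1 h2 ->
  solves P al be (lin3 p q r f g h) (lin3 p q r f1 g1 h1) (lin3 p q r f2 g2 h2).
Proof.
move=> sf sg sh t Pt; have [a0 a1 a2] := sf t Pt; have [b0 b1 b2] := sg t Pt.
have [c0 c1 c2] := sh t Pt; split; try exact: der_lin3.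
by apply: (der_eq (der_lin3 p q r a2 b2 c2)); rewrite /lin3; ring.
Qed.

Lemma smooth_lin3 U p q r f (g h : R -> R) : open U -> smooth_on U f -> smooth_on U g ->
  smooth_on U h -> smooth_on U (lin3 p q r f g h).
Proof.
move=> oU sf sg sh; rewrite /lin3.
by repeat first [eassumption | apply: (smoothD oU) | apply: (smoothM oU) | apply: (smooth_cst _ oU)].
Qed.

(** The factor [ps] multiplies the Wronskian by [ps ^+ 2] and the denominator by [ps]. So
    [m / (ps * w)] is [ps] times a quotient that is at least $(1/2)/2$, which gives the constant
    16. *)
Lemma chart_bounds (ps dps w n dw dn : R) : 0 < ps -> 1/2 < w -> w < 2 -> -1 < n -> n < 1 ->
  1/2 < dn * w - n * dw ->
  let m := (dps * n + ps * dn) * (ps * w) - ps * n * (dps * w + ps * dw) in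
  [/\ 0 < ps * w, 0 < m, `|ps * n / (ps * w)| <= 2 & ps ^+ 2 <= 16 * (m / (ps * w)) ^+ 2].
Proof.
move=> p0 w1 w2 n1 n2 m1 m.
have mE : m = ps ^+ 2 * (dn * w - n * dw) by rewrite /m; ring.
have w0 : 0 < w by lra.
rewrite mE; split.
- by rewrite mulr_gt0.
- by rewrite mulr_gt0 ?exprn_gt0 //; lra.
- rewrite -mulf_div divff ?gt_eqF // mul1r ler_norml ler_pdivlMr // ler_pdivrMr //.
  by apply/andP; split; lra.
- have -> : ps ^+ 2 * (dn * w - n * dw) / (ps * w) = ps * ((dn * w - n * dw) / w).
    by field; rewrite !gt_eqF.
  have mw : 1/4 <= (dn * w - n * dw) / w by rewrite ler_pdivlMr //; lra.
  rewrite exprMn mulrCA ler_peMr ?exprn_ge0 ?(ltW p0) //.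
  by move: mw; move: (_ / w) => u mw; rewrite expr2; nra.
Qed.

Variables (G0 G1 G2 psi al be : R -> R).
Hypotheses (s0 : smooth_on setT G0) (s1 : smooth_on setT G1) (s2 : smooth_on setT G2).
Variable U : set R.
Hypothesis oU : open U.
Hypothesis H : hat G0 G1 G2 psi al be U.
Let D := wronski3 G0 G1 G2.

Definition cross_at (G0 G1 G2 : R -> R) t :=
  cross_nz (G0 t) (G1 t) (G2 t) (derive1 G0 t) (derive1 G1 t) (derive1 G2 t).

Lemma smooth_D : smooth_on setT D.
Proof. by apply: smooth_wronski3 => //; exact: openT. Qed.

Lemma sder f t : smooth_on setT f -> der f t (derive1 f t).
Proof. by move=> sf; exact: smooth_der sf _. Qed.

Lemma small_near f t0 c : {for t0, continuous f} -> f t0 = 0 -> 0 < c ->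
  exists2 e, 0 < e & forall t, t0 - e < t -> t < t0 + e -> f t < c.
Proof.
move=> cf f0 c0; have [||e e0 he] := @continuous_gt0_near R (fun t => c - f t) t0.
- by apply: continuousB; [exact: cst_continuous|].
- by rewrite f0 subr0.
by exists e => // t h1 h2; have := he t h1 h2; rewrite subr_gt0.
Qed.

Lemma mid_right (a b t : R) : a < b -> b - (b - a) / 2 < t -> a < t /\ (a + b) / 2 <= t.
Proof. by move=> *; lra. Qed.

Lemma mid_left (a b t : R) : a < b -> t < a + (b - a) / 2 -> t < b /\ t <= (a + b) / 2.
Proof. by move=> *; lra. Qed.

Lemma pick_near (t1 t2 t0 e e' : R) : t1 < t2 -> 0 < e -> 0 < e' -> t0 = t1 \/ t0 = t2 ->
  exists t, [/\ t0 - e < t, t < t0 + e, t0 - e' < t, t < t0 + e' & t1 < t /\ t < t2].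
Proof.
move=> t12 e0 e'0 t0E; pose d := Num.min (Num.min (e / 2) (e' / 2)) ((t2 - t1) / 2).
have [d0 de de' dt] : [/\ 0 < d, d <= e / 2, d <= e' / 2 & d <= (t2 - t1) / 2].
  rewrite /d !lt_min !ge_min !lexx !orbT; split=> //.
  by apply/andP; split; [apply/andP; split|]; lra.
by case: t0E => ->; [exists (t1 + d)|exists (t2 - d)]; split; try split; lra.
Qed.

Lemma gap_le (e a t0 t : R) : e <= a -> t0 - e < t -> t < t0 + e -> t0 - a < t /\ t < t0 + a.
Proof. by move=> *; lra. Qed.

(* A chart [x = n / w] around [t0] in which [x(t0) = 0] and [x'(t0) = 1]. *)
Lemma end_chart t0 : cross_at G0 G1 G2 t0 -> exists p q r p' q' r',
  let w := lin3 p q r G0 G1 G2 in let n := lin3 p' q' r' G0 G1 G2 in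
  exists2 e, 0 < e & forall t, t0 - e < t -> t < t0 + e ->
    [/\ 1/2 < w t, w t < 2, -1 < n t, n t < 1 & 1/2 < derive1 n t * w t - n t * derive1 w t].
Proof.
move=> /dual_frame[p [q [r [p' [q' [r' [p'' [q'' [r'' [[e1 e2 e3] [e4 e5 e6] _]]]]]]]]]].
exists p, q, r, p', q', r'; move=> w n.
have sw : smooth_on setT w by apply: smooth_lin3 => //; exact: openT.
have sn : smooth_on setT n by apply: smooth_lin3 => //; exact: openT.
have dE a b c : derive1 (lin3 a b c G0 G1 G2) t0 =
    a * derive1 G0 t0 + b * derive1 G1 t0 + c * derive1 G2 t0.
  by apply: der_val; apply: der_lin3; exact: sder.
have w1 : w t0 = 1 by exact: e1.
have n0 : n t0 = 0 by exact: e2.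
have dw0 : derive1 w t0 = 0 by rewrite dE.
have dn1 : derive1 n t0 = 1 by rewrite dE.
have cont f : smooth_on setT f -> {for t0, continuous f}.
  by move=> sf; apply: (smooth_continuous sf).
have oT : open [set: R] by exact: openT.
have [||a1 a10 A1] := @continuous_gt0_near R (fun t => w t - 1/2) t0.
- by apply: cont; apply: smoothB => //; exact: smooth_cst.
- by rewrite w1; lra.
have [||a2 a20 A2] := @continuous_gt0_near R (fun t => 2 - w t) t0.
- by apply: cont; apply: smoothB => //; exact: smooth_cst.
- by rewrite w1; lra.
have [||a3 a30 A3] := @continuous_gt0_near R (fun t => n t + 1) t0.
- by apply: cont; apply: smoothD => //; exact: smooth_cst.
- by rewrite n0; lra.
have [||a4 a40 A4] := @continuous_gt0_near R (fun t => 1 - n t) t0.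
- by apply: cont; apply: smoothB => //; exact: smooth_cst.
- by rewrite n0; lra.
have [||a5 a50 A5] := @continuous_gt0_near R
    (fun t => derive1 n t * w t - n t * derive1 w t - 1/2) t0.
- apply: cont; apply: smoothB => //; last exact: smooth_cst.
  by apply: smoothB => //; apply: smoothM => //; exact: smooth_d.
- by rewrite w1 n0 dw0 dn1; lra.
pose e := Num.min (Num.min (Num.min a1 a2) (Num.min a3 a4)) a5.
have [e0 ea1 ea2 [ea3 ea4 ea5]] : [/\ 0 < e, e <= a1, e <= a2 & [/\ e <= a3, e <= a4 & e <= a5]].
  by rewrite /e !lt_min a10 a20 a30 a40 a50 !ge_min !lexx !orbT.
exists e => // t t1 t2.
have [[l1 r1] [l2 r2]] := (gap_le ea1 t1 t2, gap_le ea2 t1 t2).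
have [[l3 r3] [l4 r4] [l5 r5]] := And3 (gap_le ea3 t1 t2) (gap_le ea4 t1 t2) (gap_le ea5 t1 t2).
have B1 := A1 t l1 r1; have B2 := A2 t l2 r2; have B3 := A3 t l3 r3.
have B4 := A4 t l4 r4; have B5 := A5 t l5 r5.
clear -B1 B2 B3 B4 B5; split; lra.
Qed.

(** As $\psi^3 D = 1$, a bound on [psi] keeps [D] away from 0; [1 <= K] turns [psi t ^+ 2 <= K] into
    [psi t <= K]. *)
Lemma psi_bounded_pos K t : 1 <= K -> U t -> psi t ^+ 2 <= K -> K ^- 3 <= D t.
Proof.
move=> K1 Ut pK; have p0 := hat_gt0 H Ut; have pD := hat_D H Ut.
have pK' : psi t <= K by nra.
have K0 : 0 < K ^+ 3 by apply: exprn_gt0; lra.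
have p3 : psi t ^+ 3 <= K ^+ 3 by rewrite lerXn2r ?nnegrE //; lra.
have D0 : 0 < D t by rewrite -(pmulr_rgt0 _ (exprn_gt0 3 p0)) pD.
rewrite -(ler_pM2l K0) divff ?gt_eqF //.
by apply: le_trans (_ : psi t ^+ 3 * D t <= _); [rewrite pD|rewrite ler_pM2r].
Qed.

(* [psi] tends to infinity at a zero of [D], whereas a sign of [q] would keep the
   quotient [(m / w)^2 >= psi^2 / 16] bounded at one of the two ends. *)
Lemma arc_zero t1 t2 : t1 < t2 -> D t1 = 0 -> D t2 = 0 ->
  cross_at G0 G1 G2 t1 -> cross_at G0 G1 G2 t2 -> (forall t, t1 < t -> t < t2 -> U t) ->
  exists t, [/\ t1 < t, t < t2 & al t - derive1 be t / 2 = 0].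
Proof.
move=> t12 D1 D2 c1 c2 inU; apply: contrapT => noz.
pose q t := al t - derive1 be t / 2.
have dbe t : U t -> der be t (derive1 be t) by move=> Ut; exact: smooth_der (hat_be H) Ut.
have sq : smooth_on U q.
  apply: smoothB => //; first exact: hat_al H.
  by apply: smoothM => //; [apply: smooth_d; exact: hat_be H|exact: smooth_cst].
have [||s [sE sP]] := @sign_on R q t1 t2.
- by move=> t h1 h2; apply: (smooth_continuous sq); exact: inU.
- by move=> t h1 h2; apply/eqP => qt; apply: noz; exists t.
pose y0 t := psi t * G0 t; pose y1 t := psi t * G1 t; pose y2 t := psi t * G2 t.
have S0 := hat_solves0 H; have S1 := hat_solves1 H; have S2 := hat_solves2 H.
have Cd K : 1 <= K -> forall t0, D t0 = 0 -> exists2 e, 0 < e &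
    forall t, t0 - e < t -> t < t0 + e -> D t < K ^- 3.
  move=> K1 t0 D0; apply: small_near; [|exact: D0|].
    exact: (smooth_continuous smooth_D).
  by rewrite invr_gt0 exprn_gt0 // (lt_le_trans ltr01 K1).
have chart t0 : cross_at G0 G1 G2 t0 -> exists e (w w1 w2 n n1 n2 : R -> R),
   [/\ 0 < e, solves U al be w w1 w2, solves U al be n n1 n2 &
   forall t, U t -> t0 - e < t -> t < t0 + e ->
     [/\ 0 < w t, 0 < n1 t * w t - n t * w1 t, `|n t / w t| <= 2 &
       psi t ^+ 2 <= 16 * ((n1 t * w t - n t * w1 t) / w t) ^+ 2]].
  move=> /end_chart[p [q0 [r [p' [q' [r' [e e0 he]]]]]]].
  exists e, (lin3 p q0 r y0 y1 y2), (lin3 p q0 r (derive1 y0) (derive1 y1) (derive1 y2)),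
    (lin3 p q0 r (derive1 (derive1 y0)) (derive1 (derive1 y1)) (derive1 (derive1 y2))),
    (lin3 p' q' r' y0 y1 y2), (lin3 p' q' r' (derive1 y0) (derive1 y1) (derive1 y2)),
    (lin3 p' q' r' (derive1 (derive1 y0)) (derive1 (derive1 y1)) (derive1 (derive1 y2))).
  split; [exact: e0|exact: (solves_lin3 p q0 r S0 S1 S2)|exact: (solves_lin3 p' q' r' S0 S1 S2)|].
  move=> t Ut h1 h2; have [w1 w2 n1 n2 m1] := he t h1 h2.
  have p0 := hat_gt0 H Ut.
  have dsc G : smooth_on setT G -> derive1 (fun t => psi t * G t) t =
      derive1 psi t * G t + psi t * derive1 G t.
    by move=> sG; apply: (der_scale oU (hat_psi H) _ Ut); exact: smooth_sub sG.
  have dl a b c : derive1 (lin3 a b c G0 G1 G2) t =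
      a * derive1 G0 t + b * derive1 G1 t + c * derive1 G2 t.
    by apply: der_val; apply: der_lin3; exact: sder.
  have wE a b c : lin3 a b c y0 y1 y2 t = psi t * lin3 a b c G0 G1 G2 t.
    by rewrite /lin3 /y0 /y1 /y2; ring.
  have w1E a b c : lin3 a b c (derive1 y0) (derive1 y1) (derive1 y2) t =
      derive1 psi t * lin3 a b c G0 G1 G2 t + psi t * derive1 (lin3 a b c G0 G1 G2) t.
    by rewrite /lin3 (dsc _ s0) (dsc _ s1) (dsc _ s2) -/(lin3 a b c G0 G1 G2) dl; ring.
  rewrite !wE !w1E.
  exact: (chart_bounds _ p0 w1 w2 n1 n2 m1).
have contra K t0 : D t0 = 0 -> forall e, 0 < e ->
    (forall t, t0 - e < t -> t < t0 + e -> t1 < t -> t < t2 -> psi t ^+ 2 <= K) ->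
    (t0 = t1 \/ t0 = t2) -> False.
  move=> D0 e e0 hK t0E; pose K' := Num.max 1 K.
  have K1 : 1 <= K' by rewrite /K' le_max lexx.
  have KK : K <= K' by rewrite /K' le_max lexx orbT.
  have [e' e'0 he'] := Cd K' K1 t0 D0.
  have [t [h1 h2 h3 h4 [h5 h6]]] := pick_near t12 e0 e'0 t0E.
  have lt := he' t h3 h4; have le := le_trans (hK t h1 h2 h5 h6) KK.
  by have := psi_bounded_pos K1 (inU t h5 h6) le; rewrite leNgt lt.
have sub al' be' (w w1 w2 : R -> R) a b : t1 <= a -> b <= t2 ->
    solves U al' be' w w1 w2 -> solves (fun t => a < t < b) al' be' w w1 w2.
  by move=> ta bt sw t /andP[h1 h2]; apply: sw; apply: inU;
    [exact: le_lt_trans h1|exact: lt_le_trans bt].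
(* For [q > 0] the quotient stays bounded at [t2], for [q < 0] at [t1]. *)
case: sE => sE; subst s.
- have [e [w [w1 [w2 [n [n1 [n2 [e0 sw sn hw]]]]]]]] := chart t2 c2.
  pose a := Num.max t1 (t2 - e).
  have [a2 a1 ae] : [/\ a < t2, t1 <= a & t2 - e <= a].
    by rewrite /a gt_max !le_max !lexx orbT t12; split=> //=; rewrite ltrBlDr ltrDl.
  have hh t : a < t -> t < t2 -> [/\ U t, 0 < w t, 0 < n1 t * w t - n t * w1 t,
      `|n t / w t| <= 2 & psi t ^+ 2 <= 16 * ((n1 t * w t - n t * w1 t) / w t) ^+ 2].
    move=> h1 h2; have Ut : U t by apply: inU => //; exact: le_lt_trans h1.
    have r1 : t < t2 + e by rewrite (lt_trans h2) // ltrDl.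
    by have [] := hw t Ut (le_lt_trans ae h1) r1.
  have w0 t : a < t -> t < t2 -> 0 < w t by move=> h1 h2; have [] := hh t h1 h2.
  have [||||K hK] := @end_blowup R a t2 al be (derive1 be) w w1 w2 n n1 n2 2 a2 w0
     (sub _ _ _ _ _ _ _ a1 (lexx t2) sw) (sub _ _ _ _ _ _ _ a1 (lexx t2) sn).
  + by move=> t h1 h2; have [Ut _ _ _ _] := hh t h1 h2; exact: dbe.
  + by move=> t h1 h2; have [] := hh t h1 h2.
  + by move=> t h1 h2; apply: ltW; have := sP t (le_lt_trans a1 h1) h2; rewrite mul1r.
  + by move=> t h1 h2; have [] := hh t h1 h2.
  apply: (contra (16 * K) t2 D2 ((t2 - a) / 2)); last by right.
    by rewrite divr_gt0 // subr_gt0.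
  move=> t h1 h2 h3 h4; have [at_ mt] := mid_right a2 h1.
  have [_ _ _ _ h] := hh t at_ h4; apply: (le_trans h); rewrite ler_pM2l //.
  exact: hK.
- have [e [w [w1 [w2 [n [n1 [n2 [e0 sw sn hw]]]]]]]] := chart t1 c1.
  pose b := Num.min t2 (t1 + e).
  have [b2 b1 be_] : [/\ t1 < b, b <= t2 & b <= t1 + e].
    by rewrite /b lt_min !ge_min !lexx orbT t12; split=> //=; rewrite ltrDl.
  have hh t : t1 < t -> t < b -> [/\ U t, 0 < w t, 0 < n1 t * w t - n t * w1 t,
      `|n t / w t| <= 2 & psi t ^+ 2 <= 16 * ((n1 t * w t - n t * w1 t) / w t) ^+ 2].
    move=> h1 h2; have Ut : U t by apply: inU => //; exact: lt_le_trans b1.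
    have r1 : t1 - e < t by rewrite ltrBlDr (lt_trans h1) // ltrDl.
    by have [] := hw t Ut r1 (lt_le_trans h2 be_).
  have w0 t : t1 < t -> t < b -> 0 < w t by move=> h1 h2; have [] := hh t h1 h2.
  have [||||K hK] := @start_blowup R t1 b al be (derive1 be) w w1 w2 n n1 n2 2 b2 w0
     (sub _ _ _ _ _ _ _ (lexx t1) b1 sw) (sub _ _ _ _ _ _ _ (lexx t1) b1 sn).
  + by move=> t h1 h2; have [Ut _ _ _ _] := hh t h1 h2; exact: dbe.
  + by move=> t h1 h2; have [] := hh t h1 h2.
  + by move=> t h1 h2; apply: ltW; have := sP t h1 (lt_le_trans h2 b1); rewrite mulN1r oppr_gt0.
  + by move=> t h1 h2; have [] := hh t h1 h2.
  apply: (contra (16 * K) t1 D1 ((b - t1) / 2)); last by left.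
    by rewrite divr_gt0 // subr_gt0.
  move=> t h1 h2 h3 h4; have [tb mt] := mid_left b2 h2.
  have [_ _ _ _ h] := hh t h3 tb; apply: (le_trans h); rewrite ler_pM2l //.
  exact: hK.
Qed.

End Arc.

(** * Points and curves of the projective plane *)

Local Open Scope quotient_scope.

Section Points.
Variable R : realType.
Implicit Types (p q : P2 R) (v w : 'rV[R]_3) (A M N : 'M[R]_3) (a b c x y t : R).

Definition rep p : 'rV[R]_3 := set_val (repr p).

Lemma rep_neq0 p : rep p != 0.
Proof. exact: (set_mem (valP (repr p))). Qed.

Lemma nonzero_in v : v != 0 -> v \in @nonzero_vec R.
Proof. by move=> v0; rewrite inE. Qed.

Definition nzvec v (v0 : v != 0) : set_type (@nonzero_vec R) := exist _ v (nonzero_in v0).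

Definition P2_of v (v0 : v != 0) : P2 R := \pi_(P2 R) (nzvec v0).

Lemma eq_point p q k : rep q = k *: rep p -> p = q.
Proof.
move=> E; rewrite -[p]reprK -[q]reprK; apply/eqmodP/asboolP.
by exists k.
Qed.

Lemma rep_point v (v0 : v != 0) : exists2 k, k != 0 & rep (P2_of v0) = k *: v.
Proof.
have : proportional (nzvec v0) (repr (P2_of v0)).
  by apply/eqmodP; rewrite reprK.
move=> /asboolP[k E]; exists k; last exact: E.
apply/eqP => k0; have := rep_neq0 (P2_of v0); rewrite /rep E k0 scale0r eqxx.
by [].
Qed.

Lemma hcoordE A p : hcoord A p = rep p *m A.
Proof. by []. Qed.

Definition vec3 a b c : 'rV[R]_3 := \row_(j < 3) nth 0 [:: a; b; c] j.

Lemma vec3E a b c : (vec3 a b c 0 0 = a) * (vec3 a b c 0 1 = b) * (vec3 a b c 0 2%:R = c).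
Proof. by rewrite !mxE. Qed.

Lemma sum3E (F : 'I_3 -> R) : \sum_(j < 3) F j = F 0 + F 1 + F 2%:R.
Proof.
rewrite !big_ord_recl big_ord0 addr0 addrA; congr (F _ + F _ + F _); exact: val_inj.
Qed.

Lemma vec3_eta v : v = vec3 (v 0 0) (v 0 1) (v 0 2%:R).
Proof.
apply/rowP => j; rewrite mxE; case: j => -[|[|[|//]]] i /=; congr (v _ _); exact: val_inj.
Qed.

Lemma vec3Z k a b c : k *: vec3 a b c = vec3 (k * a) (k * b) (k * c).
Proof. by rewrite [LHS]vec3_eta !mxE. Qed.

Lemma mulmx3E v A j : (v *m A) 0 j = v 0 0 * A 0 j + v 0 1 * A 1 j + v 0 2%:R * A 2%:R j.
Proof. by rewrite mxE sum3E. Qed.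

Lemma hcoord_neq0 A p : A \in unitmx -> hcoord A p != 0.
Proof.
move=> uA; apply/eqP => E; have /eqP := rep_neq0 p; apply.
by rewrite -[rep p](mulmxK uA) -hcoordE E mul0mx.
Qed.

Lemma eq_chart A p q : A \in unitmx -> in_chart A p -> in_chart A q ->
  chart_x A p = chart_x A q -> chart_y A p = chart_y A q -> p = q.
Proof.
rewrite /in_chart /chart_x /chart_y => uA p0 q0 ex ey.
apply: (@eq_point _ _ (hcoord A q 0 0 / hcoord A p 0 0)).
rewrite -[rep q](mulmxK uA) -[rep p](mulmxK uA) -!hcoordE scalemxAl; congr (_ *m _).
set k := _ / _; rewrite [LHS]vec3_eta [X in _ *: X]vec3_eta vec3Z /k; congr vec3.
- by rewrite divfK.
- by rewrite -mulrA [_^-1 * _]mulrC ex mulrC divfK.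
- by rewrite -mulrA [_^-1 * _]mulrC ey mulrC divfK.
Qed.

(** Openness in the quotient is tested on the preimage, and there scaling invariance allows the
    chosen representative to be replaced by the given vector. *)
Lemma open_P2 (P : 'rV[R]_3 -> Prop) : open [set v | P v] ->
  (forall v k, k != 0 -> P v -> P (k *: v)) -> open [set q : P2 R | P (rep q)].
Proof.
move=> oP sP; rewrite /open /= /quotient_open.
have -> : \pi_(P2 R) @^-1` [set q | P (rep q)] = @set_val _ (@nonzero_vec R) @^-1` [set v | P v].
  apply/seteqP; split => -[v /= vin] /=.
    have v0 : v != 0 := set_mem vin.
    have -> : (\pi_(P2 R) (exist _ v vin : set_type (@nonzero_vec R))) = P2_of v0.
      by rewrite /P2_of; congr (\pi _); exact: val_inj.
    have [k k0 E] := rep_point v0; rewrite E => /(sP _ k^-1).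
    by rewrite scalerA mulVf // scale1r invr_eq0; apply.
  have v0 : v != 0 := set_mem vin.
  have -> : (\pi_(P2 R) (exist _ v vin : set_type (@nonzero_vec R))) = P2_of v0.
    by rewrite /P2_of; congr (\pi _); exact: val_inj.
  by have [k k0 ->] := rep_point v0; exact: sP.
by exists [set v | P v].
Qed.

Lemma continuous_coord (j : 'I_3) A : continuous (fun v => (v *m A) 0 j).
Proof.
have -> : (fun v => (v *m A) 0 j) = (fun v => v 0 0 * A 0 j + v 0 1 * A 1 j + v 0 2%:R * A 2%:R j).
  by apply/funext => v; rewrite mulmx3E.
have cc i c : continuous (fun v : 'rV[R]_3 => v 0 i * c).
  move=> v; apply: (@continuousM _ _ (fun v : 'rV[R]_3 => v 0 i) (fun=> c)).
    exact: coord_continuous.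
  exact: cst_continuous.
move=> v.
apply: (@continuousD _ _ _ (fun v : 'rV[R]_3 => v 0 0 * A 0 j + v 0 1 * A 1 j)
  (fun v : 'rV[R]_3 => v 0 2%:R * A 2%:R j)); last exact: cc.
apply: (@continuousD _ _ _ (fun v : 'rV[R]_3 => v 0 0 * A 0 j)
  (fun v : 'rV[R]_3 => v 0 1 * A 1 j)); exact: cc.
Qed.

Lemma continuous_vec (V : R -> 'rV[R]_3) x :
  (forall j, {for x, continuous (fun x => V x 0 j)}) -> {for x, continuous V}.
Proof.
move=> cV; apply/cvgrPdist_lt => e e0.
have H j : \forall y \near x, `|V x 0 j - V y 0 j| < e by have /cvgrPdist_lt := cV j; apply.
near=> y.
have h0 : `|V x 0 0 - V y 0 0| < e by near: y; exact: (H 0).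
have h1 : `|V x 0 1 - V y 0 1| < e by near: y; exact: (H 1).
have h2 : `|V x 0 2%:R - V y 0 2%:R| < e by near: y; exact: (H 2%:R).
rewrite /Num.norm /= mx_normrE; apply/bigmax_ltP; split => // -[i j] _ /=.
rewrite (ord1 i) !mxE; case: j => -[|[|[|//]]] k.
- by rewrite (_ : Ordinal k = 0) //; exact: val_inj.
- by rewrite (_ : Ordinal k = 1) //; exact: val_inj.
- by rewrite (_ : Ordinal k = 2%:R) //; exact: val_inj.
Unshelve. all: by end_near. Qed.

Lemma continuous_point (V : R -> 'rV[R]_3) (V0 : forall x, V x != 0) x :
  (forall j, {for x, continuous (fun x => V x 0 j)}) ->
  {for x, continuous (fun x => P2_of (V0 x))}.
Proof.
move=> cV; rewrite /P2_of.
apply: (@continuous_comp _ _ _ (fun x => nzvec (V0 x)) (\pi_(P2 R))); last first.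
  exact: pi_continuous.
move=> /= W [_ [[W' oW' <-] W'V W'W]].
have := continuous_vec cV; move=> /(_ W').
have : nbhs (V x) W' by apply: open_nbhs_nbhs.
move=> nW /(_ nW) H1.
apply: (@filterS _ (nbhs x) _ (V @^-1` W')); last exact: H1.
by move=> y Wy; exact: (W'W (nzvec (V0 y))).
Qed.

End Points.

(** * The circle parametrised by the angle *)

Section Angles.
Variable R : realType.
Implicit Types (s t a b : R).

Lemma angle_period t : angle (t + 2 * pi) = angle t.
Proof. by apply: val_inj; rewrite /= mulr_natl cosD2pi sinD2pi. Qed.

Lemma angle_periodn t (n : nat) : angle (t + n%:R * (2 * pi)) = angle t.
Proof.
elim: n => [|n IH]; first by rewrite mul0r addr0.
by rewrite -addn1 natrD mulrDl mul1r addrA angle_period.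
Qed.

Lemma angle_reduce t a : exists t', [/\ a <= t', t' < a + 2 * pi & angle t' = angle t].
Proof.
have p0 : 0 < 2 * pi :> R by rewrite mulr_gt0 // pi_gt0.
pose n := Num.floor ((t - a) / (2 * pi)); pose t' := t - n%:~R * (2 * pi).
have n1 : n%:~R * (2 * pi) <= t - a by rewrite -ler_pdivlMr // Num.Theory.floor_le.
have n2 : t - a < (n%:~R + 1) * (2 * pi).
  rewrite -ltr_pdivrMr // -[1]/(1%:~R) -intrD; exact: Num.Theory.floorD1_gt.
exists t'; split; rewrite /t'; [lra|lra|].
case: n {t' n1 n2} => n; rewrite ?NegzE.
  by rewrite -[in RHS](subrK (n%:R * (2 * pi)) t) angle_periodn.
by rewrite mulrNz mulNr opprK angle_periodn.
Qed.

Lemma angle_surj (z : circle R) : exists t, angle t = z.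
Proof.
have zE := set_mem (valP z); have := zE; rewrite /circle /= => E.
set x := (val z).1 in E; set y := (val z).2 in E.
have xx : -1 <= x <= 1 by have := sqr_ge0 y; nra.
have sE : sin (acos x) = `|y|.
  by rewrite sin_acos // -sqrtr_sqr; congr (Num.sqrt _); lra.
have [y0|y0] := leP 0 y.
  exists (acos x); apply: val_inj; rewrite /= sE acosK ?in_itv //= ger0_norm //.
  by rewrite /x /y -surjective_pairing.
exists (- acos x); apply: val_inj; rewrite /= cosN sinN sE acosK ?in_itv //= ltr0_norm // opprK.
by rewrite /x /y -surjective_pairing.
Qed.

(** Half angles: [cos (t - s) = 1] would make the sine of [(t - s) / 2] vanish, but this number lies
    strictly between 0 and [pi]. *)
Lemma angle_inj s t : s < t -> t < s + 2 * pi -> angle s <> angle t.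
Proof.
move=> st ts /(congr1 val)[ec es].
have c1 : cos (t - s) = 1 by rewrite cosB -ec -es -!expr2 cos2Dsin2.
have := @sin_gt0_pi R ((t - s) / 2); have : cos ((t - s) / 2 + (t - s) / 2) = 1.
  by rewrite (_ : (t - s) / 2 + (t - s) / 2 = t - s) //; field.
rewrite cosD; have := cos2Dsin2 ((t - s) / 2) => e1 e2 h.
have : 0 < sin ((t - s) / 2) by apply: h; lra.
nra.
Qed.

End Angles.

(** * Homogeneous lifts of the curve *)

Section Lifts.
Variables (R : realType) (gamma : circle R -> P2 R).
Implicit Types (p q : P2 R) (M N : 'M[R]_3) (G : R -> R) (s t : R).
Let c t := gamma (angle t).
Hypothesis gamma_inj : injective gamma.

(** The factor [k] depends on [t] without any regularity, because so does the representative chosen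
    by [repr]. *)
Definition hlift M G0 G1 G2 : Prop :=
  [/\ M \in unitmx, [/\ smooth_on setT G0, smooth_on setT G1 & smooth_on setT G2] &
   forall t, exists2 k, k != 0 & hcoord M (c t) = k *: vec3 (G0 t) (G1 t) (G2 t)].

Lemma lift_mul M N G0 G1 G2 : hlift M G0 G1 G2 -> N \in unitmx ->
  hlift (M *m N) (lin3 (N 0 0) (N 1 0) (N 2%:R 0) G0 G1 G2)
    (lin3 (N 0 1) (N 1 1) (N 2%:R 1) G0 G1 G2)
    (lin3 (N 0 2%:R) (N 1 2%:R) (N 2%:R 2%:R) G0 G1 G2).
Proof.
move=> [uM [s0 s1 s2] hG] uN; split.
- by rewrite unitmx_mul uM uN.
- by split; apply: smooth_lin3 => //; exact: openT.
- move=> t; have [k k0 E] := hG t; exists k => //.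
  rewrite hcoordE mulmxA -hcoordE E -scalemxAl; congr (_ *: _).
  rewrite [LHS]vec3_eta !mulmx3E !vec3E /lin3.
  by congr vec3; ring.
Qed.

Lemma lift_chart M G0 G1 G2 t : hlift M G0 G1 G2 -> G0 t != 0 ->
  [/\ in_chart M (c t), chart_x M (c t) = G1 t / G0 t & chart_y M (c t) = G2 t / G0 t].
Proof.
move=> [uM _ hG] g0; have [k k0 E] := hG t; rewrite /in_chart /chart_x /chart_y E.
by rewrite vec3Z !vec3E; split; [rewrite mulf_neq0|rewrite -mulf_div divff ?mul1r..].
Qed.

Lemma lift_neq0 M G0 G1 G2 t : hlift M G0 G1 G2 -> ~ [/\ G0 t = 0, G1 t = 0 & G2 t = 0].
Proof.
move=> [uM _ hG] [g0 g1 g2]; have [k k0 E] := hG t.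
have /eqP := hcoord_neq0 (c t) uM; apply; rewrite E g0 g1 g2.
by apply/rowP => j; rewrite !mxE; case: j => -[|[|[|//]]] i /=; rewrite mulr0.
Qed.

Lemma lift_simple M G0 G1 G2 s t k : hlift M G0 G1 G2 -> s < t -> t < s + 2 * pi ->
  G0 t = k * G0 s -> G1 t = k * G1 s -> G2 t = k * G2 s -> False.
Proof.
move=> L st ts e0 e1 e2; apply: (angle_inj st ts); apply: gamma_inj.
have [uM _ hG] := L; have [a a0 Ea] := hG s; have [b b0 Eb] := hG t.
apply: (@eq_point _ _ _ (b * k / a)).
rewrite -[rep (gamma (angle t))](mulmxK uM) -[rep (gamma (angle s))](mulmxK uM).
rewrite -!hcoordE scalemxAl Ea Eb e0 e1 e2 !vec3Z; congr (vec3 _ _ _ *m _); field; exact: a0.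
Qed.

Lemma cross_parallel (a b d x y z : R) : ~ [/\ a = 0, b = 0 & d = 0] ->
  b * z - d * y = 0 -> d * x - a * z = 0 -> a * y - b * x = 0 ->
  exists k, [/\ x = k * a, y = k * b & z = k * d].
Proof.
move=> nz h1 h2 h3.
have [a0|a0] := eqVneq a 0; last first.
  exists (x / a); split; first by rewrite divfK.
    by apply: (mulfI a0); rewrite mulrA mulrCA divff // mulr1; lra.
  by apply: (mulfI a0); rewrite mulrA mulrCA divff // mulr1; lra.
have [b0|b0] := eqVneq b 0; last first.
  exists (y / b); split; last 1 first.
  - by apply: (mulfI b0); rewrite mulrA mulrCA divff // mulr1; lra.
  - by apply: (mulfI b0); rewrite mulrA mulrCA divff // mulr1; lra.
  - by rewrite divfK.
have [d0|d0] := eqVneq d 0; first by exfalso; exact: nz.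
exists (z / d); split; last by rewrite divfK.
- by apply: (mulfI d0); rewrite mulrA mulrCA divff // mulr1; lra.
- by apply: (mulfI d0); rewrite mulrA mulrCA divff // mulr1; lra.
Qed.

Lemma sqr_pos (k : R) : k != 0 -> 0 < k ^+ 2.
Proof. by move=> k0; rewrite lt_neqAle sqr_ge0 eq_sym sqrf_eq0 k0. Qed.

Lemma open_pos (F : 'rV[R]_3 -> R) : continuous F -> open [set v | 0 < F v].
Proof.
move=> /continuousP /(_ _ (@open_gt R 0)).
by [].
Qed.

Lemma contM (F H : 'rV[R]_3 -> R) : continuous F -> continuous H -> continuous (fun v => F v * H v).
Proof. by move=> cF cH v; exact: continuousM (cF v) (cH v). Qed.
Lemma contD (F H : 'rV[R]_3 -> R) : continuous F -> continuous H -> continuous (fun v => F v + H v).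
Proof. by move=> cF cH v; exact: continuousD (cF v) (cH v). Qed.
Lemma contB (F H : 'rV[R]_3 -> R) : continuous F -> continuous H -> continuous (fun v => F v - H v).
Proof. by move=> cF cH v; exact: continuousB (cF v) (cH v). Qed.
Lemma contC (a : R) : continuous (fun v : 'rV[R]_3 => a).
Proof. by move=> v; exact: cst_continuous. Qed.

(** Both conclusions are contained in the single inequality $z_1^2 < \eta^2 z_0^2$, which is
    invariant under scaling, so that [open_P2] applies. *)
Lemma chart_near M p eta : in_chart M p -> chart_x M p = 0 -> 0 < eta ->
  \forall q \near p, in_chart M q /\ `|chart_x M q| < eta.
Proof.
move=> p0 px e0.
pose F (v : 'rV[R]_3) := eta * eta * ((v *m M) 0 0 * (v *m M) 0 0) - (v *m M) 0 1 * (v *m M) 0 1.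
have cF : continuous F.
  apply: contB; last by apply: contM; exact: continuous_coord.
  by apply: contM; [exact: contC|apply: contM; exact: continuous_coord].
have FZ v k : k != 0 -> 0 < F v -> 0 < F (k *: v).
  move=> k0 Fv; have -> : F (k *: v) = k ^+ 2 * F v by rewrite /F -!scalemxAl !mxE; ring.
  exact: (mulr_gt0 (sqr_pos k0) Fv).
have oP := open_P2 (open_pos cF) FZ.
have pP : 0 < F (rep p).
  move: p0 px; rewrite /in_chart /chart_x /F -hcoordE => p0 /eqP.
  rewrite mulf_eq0 invr_eq0 (negbTE p0) orbF => /eqP ->.
  rewrite mul0r subr0 -!expr2; apply: mulr_gt0; apply: sqr_pos; last exact: p0.
  by rewrite gt_eqF.
have : nbhs p [set q : P2 R | 0 < F (rep q)] by apply: open_nbhs_nbhs; split.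
apply: filterS => q /=; rewrite /F -hcoordE /in_chart /chart_x.
set a := hcoord M q 0 0; set b := hcoord M q 0 1 => ab.
have a0 : a != 0 by apply/eqP => a0; move: ab; rewrite a0; nra.
split=> //; rewrite normrM normfV ltr_pdivrMr ?normr_gt0 //.
rewrite -(ltr_pXn2r (n := 2)) ?nnegrE ?mulr_ge0 ?normr_ge0 ?(ltW e0) //.
rewrite exprMn !real_normK ?num_real //; nra.
Qed.

(** In the coordinates [M], [Q / S] is $|v \times G(t_0)|^2 / |v|^2$ up to sign changes inside the
    squares: a measure of the distance to [c t0]. By injectivity it has a positive minimum [eps] on
    the compact range of the remaining parameters, and [Q < eps * S] is the neighbourhood sought. *)
Lemma local_curve M G0 G1 G2 t0 d : hlift M G0 G1 G2 -> 0 < d -> d < pi ->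
  \forall q \near c t0, range gamma q -> exists t, [/\ t0 - d <= t, t <= t0 + d & c t = q].
Proof.
move=> L d0 dpi; have [uM [s0 s1 s2] hG] := L.
pose a := G0 t0; pose b := G1 t0; pose e := G2 t0.
pose x (v : 'rV[R]_3) := b * (v *m M) 0 2%:R - e * (v *m M) 0 1.
pose y (v : 'rV[R]_3) := e * (v *m M) 0 0 - a * (v *m M) 0 2%:R.
pose z (v : 'rV[R]_3) := a * (v *m M) 0 1 - b * (v *m M) 0 0.
pose S (v : 'rV[R]_3) := (v *m M) 0 0 * (v *m M) 0 0 + (v *m M) 0 1 * (v *m M) 0 1 +
  (v *m M) 0 2%:R * (v *m M) 0 2%:R.
pose Q (v : 'rV[R]_3) := x v * x v + y v * y v + z v * z v.
pose xt t := b * G2 t - e * G1 t; pose yt t := e * G0 t - a * G2 t.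
pose zt t := a * G1 t - b * G0 t.
pose St t := G0 t * G0 t + G1 t * G1 t + G2 t * G2 t.
pose Qt t := xt t * xt t + yt t * yt t + zt t * zt t.
have oT : open [set: R] by exact: openT.
have sSt : smooth_on setT St.
  by rewrite /St; repeat first [eassumption | apply: (smoothD oT) | apply: (smoothM oT)].
have sQt : smooth_on setT Qt.
  rewrite /Qt /xt /yt /zt.
  by repeat first [eassumption | apply: (smoothD oT) | apply: (smoothM oT) | apply: (smoothN oT) | apply: (smooth_cst _ oT)].
have St0 t : 0 < St t.
  rewrite /St -!expr2 lt_neqAle !addr_ge0 ?sqr_ge0 // andbT eq_sym; apply/negP.
  rewrite !paddr_eq0 ?addr_ge0 ?sqr_ge0 // !sqrf_eq0 => /andP[/andP[/eqP g0 /eqP g1] /eqP g2].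
  by apply: (lift_neq0 (t := t) L).
have Qt0 t : t0 < t -> t < t0 + 2 * pi -> 0 < Qt t.
  move=> h1 h2; rewrite /Qt -!expr2 lt_neqAle !addr_ge0 ?sqr_ge0 // andbT eq_sym; apply/negP.
  rewrite !paddr_eq0 ?addr_ge0 ?sqr_ge0 // !sqrf_eq0 => /andP[/andP[/eqP g0 /eqP g1] /eqP g2].
  have [k [k1 k2 k3]] := @cross_parallel a b e (G0 t) (G1 t) (G2 t) (lift_neq0 (t := t0) L) g0 g1 g2.
  exact: (lift_simple L h1 h2 k1 k2 k3).
pose h t := Qt t / St t.
have [||m mab hm] := @EVT_min R h (t0 + d) (t0 + 2 * pi - d).
- lra.
- apply: continuous_in_subspaceT => t _; apply: continuousM.
    exact: (smooth_continuous sQt).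
  apply: continuousV; first by rewrite gt_eqF.
  exact: (smooth_continuous sSt).
move: mab; rewrite in_itv /= => /andP[m1 m2].
pose eps := h m; have eps0 : 0 < eps by rewrite /eps /h divr_gt0 // Qt0; lra.
pose F v := eps * S v - Q v.
have cc j : continuous (fun v : 'rV[R]_3 => (v *m M) 0 j) by exact: continuous_coord.
have clin k l i j : continuous (fun v : 'rV[R]_3 => k * (v *m M) 0 i - l * (v *m M) 0 j).
  by apply: contB; apply: contM; first [exact: contC | exact: cc].
have cx : continuous x := clin b e 2%:R 1.
have cy : continuous y := clin e a 0 2%:R.
have cz : continuous z := clin a b 1 0.
have cS : continuous S.
  exact: (contD (contD (contM (cc 0) (cc 0)) (contM (cc 1) (cc 1))) (contM (cc 2%:R) (cc 2%:R))).
have cQ : continuous Q := contD (contD (contM cx cx) (contM cy cy)) (contM cz cz).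
have cF : continuous F := contB (contM (@contC eps) cS) cQ.
have FZ v k : k != 0 -> 0 < F v -> 0 < F (k *: v).
  move=> k0 Fv; have -> : F (k *: v) = k ^+ 2 * F v.
    by rewrite /F /S /Q /x /y /z -!scalemxAl !mxE; ring.
  exact: (mulr_gt0 (sqr_pos k0) Fv).
have FE t : exists2 k, k != 0 & F (rep (c t)) = k ^+ 2 * (eps * St t - Qt t).
  have [k k0 E] := hG t; exists k => //.
  by rewrite /F /S /Q /x /y /z -hcoordE E vec3Z !vec3E /St /Qt /xt /yt /zt; ring.
have pP : 0 < F (rep (c t0)).
  have [k k0 ->] := FE t0; rewrite mulr_gt0 ?sqr_pos //.
  have -> : Qt t0 = 0 by rewrite /Qt /xt /yt /zt /a /b /e; ring.
  by rewrite subr0 mulr_gt0.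
have : nbhs (c t0) [set q : P2 R | 0 < F (rep q)].
  by apply: open_nbhs_nbhs; split => //; exact: open_P2 (open_pos cF) FZ.
apply: filterS => q /= qP [w _ wq]; have [t1 t1w] := angle_surj w.
have [t [ta tb te]] := angle_reduce t1 (t0 - d).
have ctq : c t = q by rewrite /c te t1w.
have [le|lt] := leP t (t0 + d); first by exists t.
move: qP; rewrite -ctq; have [k k0 ->] := FE t; rewrite pmulr_rgt0 ?sqr_pos // subr_gt0.
have : eps <= h t by apply: hm; rewrite in_itv /=; apply/andP; split; lra.
by rewrite /h ler_pdivlMr // leNgt => /negP.
Qed.

End Lifts.

(** * Local graphs and multiplicities *)

Section LocalGraph.
Variables (R : realType) (gamma : circle R -> P2 R).
Implicit Types (p q : P2 R) (M N : 'M[R]_3) (G : R -> R) (s t : R).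
Let c t := gamma (angle t).
Hypothesis gamma_inj : injective gamma.

Lemma open_itv (a b : R) : open [set t | a < t < b].
Proof.
rewrite openE => t /= /andP[at_ tb]; exact: near_itv.
Qed.

(** The affine coordinate [X = G1 / G0] is inverted by [tau], and [f] is [G2 / G0] read along [tau].
    That no other branch of the curve enters the neighbourhood is [local_curve], which is why [e] is
    also kept below [pi]. *)
Lemma graph_of_lift M G0 G1 G2 t0 : hlift gamma M G0 G1 G2 ->
  0 < G0 t0 -> G1 t0 = 0 -> G2 t0 = 0 -> 0 < derive1 G1 t0 -> derive1 G2 t0 = 0 ->
  exists (U V : set R) (f tau : R -> R),
   [/\ [/\ open U, open V, U t0, V 0 & tau 0 = t0],
       [/\ forall t, U t -> G0 t != 0, forall x, V x -> U (tau x),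
           smooth_on V tau & smooth_on V f],
       forall x, V x -> G1 (tau x) / G0 (tau x) = x /\ f x = G2 (tau x) / G0 (tau x) &
       graph_at (range gamma) (c t0) M f].
Proof.
move=> L g0 g10 g20 dg1 dg2; have [uM [s0 s1 s2] _] := L.
have oT : open [set: R] by exact: openT.
pose m t := derive1 G1 t * G0 t - G1 t * derive1 G0 t.
have sm : smooth_on setT m.
  by apply: smoothB => //; apply: smoothM => //; exact: smooth_d.
have sc (F : R -> R) t : smooth_on setT F -> {for t, continuous F}.
  by move=> sF; apply: (smooth_continuous sF).
have [e1 e10 h1] := continuous_gt0_near (sc _ t0 s0) g0.
have [|e2 e20 h2] := continuous_gt0_near (sc _ t0 sm).
  by rewrite /m g10 mul0r subr0 mulr_gt0.
pose e := Num.min (Num.min e1 e2) pi.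
have [e_gt0 ee1 ee2 epi] : [/\ 0 < e, e <= e1, e <= e2 & e <= pi].
  by rewrite /e !lt_min e10 e20 pi_gt0 !ge_min !lexx !orbT.
pose U := [set t | t0 - e < t < t0 + e].
have oU : open U by exact: open_itv.
have G0U t : U t -> 0 < G0 t.
  by move=> /andP[a b]; have [l r] := gap_le ee1 a b; exact: h1.
have G0n t : U t -> G0 t != 0 by move=> /G0U ?; rewrite gt_eqF.
have mU t : U t -> 0 < m t.
  by move=> /andP[a b]; have [l r] := gap_le ee2 a b; exact: h2.
pose X t := G1 t / G0 t; pose Y t := G2 t / G0 t; pose X1 t := m t / G0 t ^+ 2.
have sub F : smooth_on setT F -> smooth_on U F by exact: smooth_sub.
have sY : smooth_on U Y by apply: smoothM; [exact: oU|exact: sub|apply: smoothV => //; exact: sub].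
have sX1 : smooth_on U X1.
  apply: smoothM => //; first exact: sub.
  apply: smoothV => //; first by move=> t Ut; rewrite expf_neq0 // G0n.
  by move=> n; apply: CnX => //; exact: sub.
have X10 t : U t -> 0 < X1 t by move=> Ut; rewrite divr_gt0 ?exprn_gt0 ?mU ?G0U.
have dX t : U t -> der X t (X1 t).
  move=> Ut; have n0 := G0n t Ut.
  have D0 : der G0 t (derive1 G0 t) by exact: smooth_der s0 _.
  have D1 : der G1 t (derive1 G1 t) by exact: smooth_der s1 _.
  by apply: (der_eq (derM D1 (derV n0 D0))); rewrite /X1 /m; field.
pose d := e / 2.
have [d0 dpi de] : [/\ 0 < d, d < pi & d < e].
  have p0 := pi_gt0 R; move: epi e_gt0; rewrite /d => epi e_gt0; split; lra.
have inU t : t0 - d <= t -> t <= t0 + d -> U t.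
  by move=> a b; apply/andP; split; [apply: lt_le_trans a|apply: le_lt_trans b _];
    rewrite ?ltrD2l ?ltrN2.
have pq : t0 - d <= t0 + d by rewrite lerD2l ge0_cp ?(ltW d0).
have X_lt t u : t0 - d <= t -> t < u -> u <= t0 + d -> X t < X u.
  move=> a tu b; apply: (der_gt0_lt (f := X) (f1 := X1) tu) => s s1' s2'.
    by apply/dX/inU; [exact: le_trans s1'|exact: le_trans b].
  by apply/X10/inU; [exact: le_trans (ltW s1')|exact: le_trans (ltW s2') b].
have [|tau [ctau tauK tauP]] := inc_inverse pq _ X_lt.
  by move=> t a b; apply: der_continuous (dX t (inU t a b)).
pose V := [set x | X (t0 - d) < x < X (t0 + d)].
have oV : open V by exact: open_itv.
have t0l : t0 - d < t0 by rewrite ltrBlDr ltrDl.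
have t0r : t0 < t0 + d by rewrite ltrDl.
have X0 : X t0 = 0 by rewrite /X g10 mul0r.
have V0 : V 0.
  apply/andP; rewrite -X0; split; apply: X_lt => //; exact: ltW.
have tau0 : tau 0 = t0 by rewrite -X0 tauK ?ltW.
have tauV x : V x -> [/\ t0 - d <= tau x, tau x <= t0 + d & X (tau x) = x].
  by move=> /andP[a b]; apply: tauP; exact: ltW.
have tauU x : V x -> U (tau x) by move=> /tauV[a b _]; exact: inU.
have dtau x : V x -> der tau x (X1 (tau x))^-1.
  move=> Vx; apply: (@der_inverse R X X1 tau (t0 - e) (t0 + e) V x) => //.
  - by move=> t a b; apply: dX; apply/andP.
  - by move=> t a b; apply: X10; apply/andP.
  - by move=> z Vz; have /andP[a b] := tauU z Vz; have [_ _ E] := tauV z Vz.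
have stau : smooth_on V tau.
  by move=> n; apply: (Cn_inverse (U := U) (x1 := X1)) => // t Ut; rewrite gt_eqF // X10.
pose f x := Y (tau x).
have sf : smooth_on V f by move=> n; apply: (Cn_comp (V := U)).
exists U, V, f, tau; split => //.
- by split => //; apply/andP; split; rewrite ?ltrBlDr ltrDl.
- by move=> x Vx; have [_ _ E] := tauV x Vx.
have Ut0 : U t0 by apply/andP; split; rewrite ?ltrBlDr ltrDl.
have [p0 px py] := lift_chart L (G0n t0 Ut0).
rewrite g10 mul0r in px; rewrite g20 mul0r in py.
split => //.
- apply/smooth_nearP; have /nbhs_ballP[r /= r0 rV] := open_near oV V0.
  by exists r => //; exact: smooth_sub sf.
- split; first by rewrite /f tau0 /Y g20 mul0r.
  have D2 : der G2 t0 (derive1 G2 t0) by exact: smooth_der s2 _.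
  have D0 : der G0 t0 (derive1 G0 t0) by exact: smooth_der s0 _.
  have dY : der Y t0 0.
    by apply: (der_eq (derM D2 (derV (G0n _ Ut0) D0))); rewrite g20 dg2 !mul0r addr0.
  apply: der_val; have := dtau 0 V0; rewrite tau0 => D.
  have dYt : der Y (tau 0) 0 by rewrite tau0.
  by apply: (der_eq (der_comp dYt D)); rewrite mul0r.
have [r r0 rV] : exists2 r, 0 < r & forall x, `|x| < r -> V x.
  have [r r0 hr] := near_gap (open_near oV V0).
  by exists r => // x; rewrite ltr_norml => /andP[a b]; apply: hr; rewrite ?sub0r ?add0r.
near=> q.
have [q0 qx] : in_chart M q /\ `|chart_x M q| < r.
  by near: q; exact: chart_near.
split.
  move=> Cq; have [t [a b ctq]] : exists t, [/\ t0 - d <= t, t <= t0 + d & c t = q].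
    by move: Cq; near: q; exact: local_curve L d0 dpi.
  have Ut := inU t a b; have [t1 tx ty] := lift_chart L (G0n t Ut).
  by rewrite -ctq tx ty /f tauK.
move=> qy; have Vx := rV _ qx; have [a b E] := tauV _ Vx.
have Ut := inU _ a b; have [t1 tx ty] := lift_chart L (G0n _ Ut).
have -> : q = c (tau (chart_x M q)).
  by apply: (eq_chart uM q0 t1); [rewrite tx -[LHS]E|rewrite ty qy].
by exists (angle (tau (chart_x M q))).
Unshelve. all: by end_near. Qed.

End LocalGraph.

(** * Determinants and changes of frame *)

Section Matrices.
Variable R : realType.

Definition mx3 (a b c a' b' c' a'' b'' c'' : R) : 'M[R]_3 :=
  \matrix_(i < 3, j < 3) nth 0 (nth [::] [:: [:: a; b; c]; [:: a'; b'; c']; [:: a''; b''; c'']] i) j.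

Lemma mx3_unit (a b c a' b' c' a'' b'' c'' : R) : det3 a b c a' b' c' a'' b'' c'' != 0 ->
  mx3 a b c a' b' c' a'' b'' c'' \in unitmx.
Proof.
set d := det3 _ _ _ _ _ _ _ _ _ => d0.
pose B := mx3 ((b' * c'' - c' * b'') / d) ((c * b'' - b * c'') / d) ((b * c' - c * b') / d)
  ((c' * a'' - a' * c'') / d) ((a * c'' - c * a'') / d) ((c * a' - a * c') / d)
  ((a' * b'' - b' * a'') / d) ((b * a'' - a * b'') / d) ((a * b' - b * a') / d).
suff /mulmx1_unit[] : mx3 a b c a' b' c' a'' b'' c'' *m B = 1%:M by [].
apply/matrixP => i j; rewrite mxE sum3E !mxE.
case: i => -[|[|[|//]]] i; case: j => -[|[|[|//]]] j; rewrite /= -?val_eqE /=;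
  move: d0; rewrite /d /det3 => d0; by field.
Qed.

Lemma det3_kernel (p q r a b c a' b' c' a'' b'' c'' : R) : ~ [/\ p = 0, q = 0 & r = 0] ->
  p * a + q * b + r * c = 0 -> p * a' + q * b' + r * c' = 0 ->
  p * a'' + q * b'' + r * c'' = 0 -> det3 a b c a' b' c' a'' b'' c'' = 0.
Proof.
move=> nz e1 e2 e3; set d := det3 _ _ _ _ _ _ _ _ _.
have hp : p * d = 0.
  have -> : p * d = (p * a + q * b + r * c) * (b' * c'' - c' * b'') -
    (p * a' + q * b' + r * c') * (b * c'' - c * b'') +
    (p * a'' + q * b'' + r * c'') * (b * c' - c * b') by rewrite /d /det3; ring.
  by rewrite e1 e2 e3; ring.
have hq : q * d = 0.
  have -> : q * d = (p * a + q * b + r * c) * (c' * a'' - a' * c'') -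
    (p * a' + q * b' + r * c') * (c * a'' - a * c'') +
    (p * a'' + q * b'' + r * c'') * (c * a' - a * c') by rewrite /d /det3; ring.
  by rewrite e1 e2 e3; ring.
have hr : r * d = 0.
  have -> : r * d = (p * a + q * b + r * c) * (a' * b'' - b' * a'') -
    (p * a' + q * b' + r * c') * (a * b'' - b * a'') +
    (p * a'' + q * b'' + r * c'') * (a * b' - b * a') by rewrite /d /det3; ring.
  by rewrite e1 e2 e3; ring.
apply: contrapT => /eqP d0; apply: nz.
by split; apply: (mulIf d0); rewrite mul0r.
Qed.

Lemma det3_mul (n0 n1 n2 m0 m1 m2 l0 l1 l2 a b c a' b' c' a'' b'' c'' : R) :
  det3 (n0 * a + n1 * b + n2 * c) (m0 * a + m1 * b + m2 * c) (l0 * a + l1 * b + l2 * c)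
    (n0 * a' + n1 * b' + n2 * c') (m0 * a' + m1 * b' + m2 * c') (l0 * a' + l1 * b' + l2 * c')
    (n0 * a'' + n1 * b'' + n2 * c'') (m0 * a'' + m1 * b'' + m2 * c'')
    (l0 * a'' + l1 * b'' + l2 * c'') =
  det3 n0 n1 n2 m0 m1 m2 l0 l1 l2 * det3 a b c a' b' c' a'' b'' c''.
Proof. by rewrite /det3; ring. Qed.

Lemma derive1_lin3 U (p q r : R) (F G H : R -> R) t : smooth_on U F -> smooth_on U G ->
  smooth_on U H -> U t -> derive1 (lin3 p q r F G H) t =
  lin3 p q r (derive1 F) (derive1 G) (derive1 H) t.
Proof. by move=> sF sG sH Ut; apply: der_val; apply: der_lin3; exact: smooth_der Ut. Qed.

Lemma derive2_lin3 U (p q r : R) (F G H : R -> R) t : open U -> smooth_on U F ->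
  smooth_on U G -> smooth_on U H -> U t -> derive1 (derive1 (lin3 p q r F G H)) t =
  lin3 p q r (derive1 (derive1 F)) (derive1 (derive1 G)) (derive1 (derive1 H)) t.
Proof.
move=> oU sF sG sH Ut; apply: der_val.
apply: (der_near (f := lin3 p q r (derive1 F) (derive1 G) (derive1 H))).
  by apply: filterS (open_near oU Ut) => s Us; rewrite (derive1_lin3 p q r sF sG sH Us).
by apply: der_lin3; apply: (@smooth_der _ U _ _ _ Ut); exact: smooth_d.
Qed.

Lemma wronski3_lin3 U (n0 n1 n2 m0 m1 m2 l0 l1 l2 : R) (F G H : R -> R) t : open U ->
  smooth_on U F -> smooth_on U G -> smooth_on U H -> U t ->
  wronski3 (lin3 n0 n1 n2 F G H) (lin3 m0 m1 m2 F G H) (lin3 l0 l1 l2 F G H) t =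
  det3 n0 n1 n2 m0 m1 m2 l0 l1 l2 * wronski3 F G H t.
Proof.
move=> oU sF sG sH Ut.
rewrite /wronski3 (derive1_lin3 n0 n1 n2 sF sG sH Ut) (derive1_lin3 m0 m1 m2 sF sG sH Ut).
rewrite (derive1_lin3 l0 l1 l2 sF sG sH Ut) (derive2_lin3 n0 n1 n2 oU sF sG sH Ut).
rewrite (derive2_lin3 m0 m1 m2 oU sF sG sH Ut) (derive2_lin3 l0 l1 l2 oU sF sG sH Ut).
exact: det3_mul.
Qed.

End Matrices.

(** * Multiplicity of intersection *)

Section Multiplicity.
Variable R : realType.
Implicit Types (p q : P2 R) (A M N : 'M[R]_3) (f g : R -> R).

(** The multiplicity is the least order in which the derivatives differ, infinite if there is none;
    [0 < n] keeps that order away from 0, where [multiplicity] is false. *)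
Lemma multiplicity_geI C D p A f g n : graph_at C p A f -> graph_at D p A g -> (0 < n)%N ->
  (forall j, (j < n)%N -> derive1n j f 0 = derive1n j g 0) -> multiplicity_ge C D p n.
Proof.
move=> gC gD n0 E.
have [all_eq|/existsNP[j0 j0P]] := pselect (forall j, derive1n j f 0 = derive1n j g 0).
  by exists None; split=> //; right; exists A, f, g.
have ex : exists j, `[< derive1n j f 0 <> derive1n j g 0 >] by exists j0; apply/asboolP.
have [k /asboolP kP kmin] := ex_minnP ex.
have nk : (n <= k)%N by rewrite leqNgt; apply/negP => /E.
case: k kP kmin nk => [|k] kP kmin nk; first by move: nk; rewrite leqNgt n0.
exists (Some k.+1); split=> //; right; exists A, f, g; split=> //; split=> // j jk.
apply: contrapT => jP; have := kmin j; rewrite leqNgt ltnS jk.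
by move=> /(_ _) /=; move=> h; have : false by apply: h; apply/asboolP.
Qed.

Lemma graph_x_axis M p : M \in unitmx -> in_chart M p -> chart_x M p = 0 -> chart_y M p = 0 ->
  graph_at (x_axis M) p M (fun=> 0).
Proof.
move=> uM p0 px py; split=> //.
- by apply/smooth_nearP; exists 1 => // n; apply: Cn_cst; exact: ball_open.
- by split=> //; apply: der_val; exact: der_cst.
- apply: filterS (chart_near p0 px ltr01) => q [q0 _]; rewrite /x_axis /chart_y /=.
  split=> [->|/eqP]; first by rewrite mul0r.
  by rewrite mulf_eq0 invr_eq0 (negbTE q0) orbF => /eqP.
Qed.

Lemma unit_last (B : 'M[R]_3) : B \in unitmx -> B 0 2%:R = 0 -> B 1 2%:R = 0 -> B 2%:R 2%:R != 0.
Proof.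
move=> uB b0 b1; apply/eqP => b2; have : B *m delta_mx 2%:R (0 : 'I_1) = 0.
  apply/matrixP => i j; rewrite mxE sum3E !mxE (ord1 j).
  rewrite (_ : (0 == 2%:R :> 'I_3) = false) // (_ : (1 == 2%:R :> 'I_3) = false) //.
  rewrite eqxx /= !mulr0 !add0r (_ : B i 2%:R = 0) ?mul0r //; case: i => -[|[|[|//]]] i.
  - by rewrite (_ : Ordinal i = 0) //; exact: val_inj.
  - by rewrite (_ : Ordinal i = 1) //; exact: val_inj.
  - by rewrite (_ : Ordinal i = 2%:R) //; exact: val_inj.
move=> /(congr1 (mulmx (invmx B))); rewrite mulKmx // mulmx0 => /matrixP/(_ 2%:R 0).
by rewrite !mxE !eqxx => /eqP; rewrite oner_eq0.
Qed.

(** The coordinates [A0] that define the line and the coordinates [A] that show it as a graph are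
    unrelated. In the latter it reads $\beta_0 + \beta_1 x + \beta_2 g(x) = 0$; since [g] and its
    derivative vanish at 0, so do $\beta_0$ and $\beta_1$, and [g] is zero near 0. *)
Lemma graph_line A0 A p g : A0 \in unitmx -> graph_at (x_axis A0) p A g -> derive1n 2 g 0 = 0.
Proof.
move=> uA0 [uA [p0 px py] /smooth_nearP[e e0 sg] [g0 g1] gr].
have oB : open (ball (0 : R) e) by exact: ball_open.
have B0 : ball (0 : R) e 0 by exact: ballxx.
pose V x := vec3 1 x (g x) *m invmx A.
have VA x : V x *m A = vec3 1 x (g x) by rewrite mulmxKV.
have V0 x : V x != 0.
  apply/eqP => E; have := VA x; rewrite E mul0mx => /rowP/(_ 0); rewrite !mxE /=.
  by move=> /esym/eqP; rewrite oner_eq0.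
pose Q (x : R) : P2 R := P2_of (V0 x).
have QA x : [/\ in_chart A (Q x), chart_x A (Q x) = x & chart_y A (Q x) = g x].
  have [k k0 E] := rep_point (V0 x).
  rewrite /in_chart /chart_x /chart_y hcoordE E -scalemxAl VA vec3Z !vec3E mulr1.
  by split=> //; rewrite mulrAC divff ?mul1r.
have Q0 : Q 0 = p.
  have [q0 qx qy] := QA 0; apply: (eq_chart uA q0 p0); first by rewrite qx px.
  by rewrite qy py.
have cQ : {for 0, continuous Q}.
  apply: continuous_point => j.
  have -> : (fun x => V x 0 j) = (fun x => 1 * invmx A 0 j + x * invmx A 1 j + g x * invmx A 2%:R j).
    by apply/funext => x; rewrite /V mulmx3E !vec3E.
  have dg : der g 0 0 by exact: der_eq (smooth_der sg B0) g1.
  by apply: (@der_continuous _ _ _ (invmx A 1 j)); der_auto; rewrite /=; ring.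
pose B := invmx A *m A0.
have uB : B \in unitmx by rewrite unitmx_mul unitmx_inv uA.
have ell : \forall x \near 0, B 0 2%:R + x * B 1 2%:R + g x * B 2%:R 2%:R = 0.
  have nQ : nbhs (Q 0) (fun q => x_axis A0 q <-> chart_y A q = g (chart_x A q)) by rewrite Q0.
  have nx : nbhs (0 : R) (fun x => x_axis A0 (Q x) <-> chart_y A (Q x) = g (chart_x A (Q x))) := cQ _ nQ.
  apply: (@filterS _ (nbhs (0 : R)) _ _ _ _ nx) => x; have [_ qx qy] := QA x; rewrite qx qy.
  move=> [_ /(_ erefl)]; rewrite /x_axis /= hcoordE; have [k k0 ->] := rep_point (V0 x).
  rewrite -scalemxAl mxE => /eqP; rewrite mulf_eq0 (negbTE k0) /= /V -mulmxA mulmx3E !vec3E mul1r.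
  by move=> /eqP.
have b0 : B 0 2%:R = 0 by have := nbhs_singleton ell; rewrite g0 !mul0r !addr0.
have b1 : B 1 2%:R = 0.
  have dg : der g 0 0 by exact: der_eq (smooth_der sg B0) g1.
  have D : der (fun x => B 0 2%:R + x * B 1 2%:R + g x * B 2%:R 2%:R) 0 (B 1 2%:R).
    by der_auto; rewrite /=; ring.
  by apply: (der_unique D); apply: (der_near (f := fun=> 0)); [apply: filterS ell => x ->|exact: der_cst].
have b2 := unit_last uB b0 b1.
rewrite (@derive1n_near _ 2 g (fun=> 0)).
  have D0 : derive1 (fun=> 0 : R) = (fun=> 0 : R) by apply/funext => x; apply: der_val; exact: der_cst.
  by rewrite derive1Sn D0 derive1Sn D0.
apply: filterS ell => x; rewrite b0 b1 mulr0 !add0r => /eqP.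
by rewrite mulf_eq0 (negbTE b2) orbF => /eqP.
Qed.

End Multiplicity.

(** * Inflection points as zeros of the determinant *)

Section Special.
Variables (R : realType) (gamma : circle R -> P2 R).
Implicit Types (M N : 'M[R]_3) (s t : R).
Let c t := gamma (angle t).
Hypothesis gamma_inj : injective gamma.
Let C := range gamma.
Let oT : open [set: R] := @openT R.

Lemma det3_frame (x y z : R) : det3 1 0 0 0 1 0 x y z = z.
Proof. by rewrite /det3; ring. Qed.

Lemma derive1n_zero j : derive1n j (fun=> 0) (0 : R) = 0 :> R.
Proof.
elim: j => // j IH; rewrite derive1Sn (_ : derive1 _ = fun=> 0) //.
by apply/funext => x; apply: der_val; exact: der_cst.
Qed.

Lemma lift_lin3 M G0 G1 G2 (p q r p' q' r' p'' q'' r'' : R) : hlift gamma M G0 G1 G2 ->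
  det3 p q r p' q' r' p'' q'' r'' != 0 ->
  exists M', hlift gamma M' (lin3 p q r G0 G1 G2) (lin3 p' q' r' G0 G1 G2)
    (lin3 p'' q'' r'' G0 G1 G2).
Proof.
move=> L d0; have uN : mx3 p p' p'' q q' q'' r r' r'' \in unitmx.
  by apply: mx3_unit; move: d0; rewrite (_ : det3 p q r _ _ _ _ _ _ = det3 p p' p'' q q' q'' r r' r'') // /det3; ring.
by eexists; have := lift_mul L uN; rewrite !mxE /=; apply.
Qed.

Lemma frame_lift M G0 G1 G2 t0 : hlift gamma M G0 G1 G2 -> cross_at G0 G1 G2 t0 ->
  exists M' H0 H1 H2,
  [/\ hlift gamma M' H0 H1 H2, [/\ H0 t0 = 1, H1 t0 = 0 & H2 t0 = 0],
      [/\ derive1 H0 t0 = 0, derive1 H1 t0 = 1 & derive1 H2 t0 = 0],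
      forall a, (forall t, [/\ G0 (t + a) = G0 t, G1 (t + a) = G1 t & G2 (t + a) = G2 t]) ->
        forall t, [/\ H0 (t + a) = H0 t, H1 (t + a) = H1 t & H2 (t + a) = H2 t] &
      exists2 k, 0 < k & forall t, wronski3 H0 H1 H2 t = k * wronski3 G0 G1 G2 t].
Proof.
move=> L; have [_ [s0 s1 s2] _] := L.
move=> /dual_frame[p [q [r [p' [q' [r' [p'' [q'' [r'' [[e1 e2 e3] [e4 e5 e6] d0]]]]]]]]]].
have [|M' L'] := lift_lin3 L (p := p) (q := q) (r := r) (p' := p') (q' := q') (r' := r')
  (p'' := p'') (q'' := q'') (r'' := r''); first by rewrite gt_eqF.
do 4 eexists; split; first exact: L'.
- by split.
- by rewrite !(derive1_lin3 _ _ _ s0 s1 s2).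
- by move=> a per t; have [g0 g1 g2] := per t; rewrite /lin3 g0 g1 g2.
- by exists (det3 p q r p' q' r' p'' q'' r'') => // t; rewrite (wronski3_lin3 _ _ _ _ _ _ _ _ _ oT s0 s1 s2).
Qed.

(** In the adapted frame the determinant at [t0] is the second derivative of [H2]. So [H2], and with
    it the local graph, vanishes to order three, like the tangent line. *)
Lemma inflection_of_lift M G0 G1 G2 t0 : hlift gamma M G0 G1 G2 -> cross_at G0 G1 G2 t0 ->
  wronski3 G0 G1 G2 t0 = 0 -> inflection_point C (c t0).
Proof.
move=> L cr D0; have [M' [H0 [H1 [H2 [L' [a0 a1 a2] [b0 b1 b2] _ [k k0 W]]]]]] := frame_lift L cr.
have [uM [s0 s1 s2] _] := L'.
have h2 : derive1 (derive1 H2) t0 = 0.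
  by have := W t0; rewrite D0 mulr0 /wronski3 a0 a1 a2 b0 b1 b2 det3_frame.
have [||U [V [f [tau [[oU oV Ut V0 tau0] [H0n tauU stau sf] fE gf]]]]] :=
  graph_of_lift gamma_inj L' _ a1 a2 _ b2; rewrite ?a0 ?b1 //.
have [_ [p0 px py] _ _ _] := gf.
exists (x_axis M'); split; first by exists M', f.
apply: (multiplicity_geI gf (graph_x_axis uM p0 px py)) => // j j3.
have sub F : smooth_on setT F -> smooth_on U F by exact: smooth_sub.
have sY : smooth_on U (fun t => (H0 t)^-1) by apply: smoothV => //; exact: sub.
have fl : flat 3 (fun t => H2 t * (H0 t)^-1) t0.
  by apply: (flatM oU Ut (sub _ s2) sY).
have fl' : flat 3 f 0.
  apply: (@flat_near _ _ (fun x => H2 (tau x) * (H0 (tau x))^-1)).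
    by apply: filterS (open_near oV V0) => x /fE[_ ->].
  have sYY := smoothM oU (sub _ s2) sY.
  by apply: (flat_comp oV V0 oU tauU sYY stau); rewrite tau0.
by have e1 := flat_derive1n fl' j3; rewrite e1 derive1n_zero.
Qed.

(** If the contact with the tangent line has order three, [f] is flat to that order, hence so is the
    coordinate [K2], which equals $K_0 f(K_1/K_0)$ near [t0]. A nonzero linear form then annihilates
    the lift and its first two derivatives, and the determinant vanishes. *)
Lemma not_inflection M G0 G1 G2 t0 : {for t0, continuous c} -> hlift gamma M G0 G1 G2 ->
  wronski3 G0 G1 G2 t0 != 0 -> ~ inflection_point C (c t0).
Proof.
move=> cc L /eqP D0 [L0 [[A0 [f0 [g0 ->]]]]] [m [mult m3]].
have [uA0 _ _ _ _] := g0; case: mult => [[? [? [_ _ _ E]]]|]; first by rewrite E in m3.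
move=> [A [f [g [gC gL E]]]]; apply: D0.
have g2 := graph_line uA0 gL.
have [uA [p0 px py] /smooth_nearP[e e0 sf] [f00 f01] gr] := gC.
have f2 : derive1n 2 f 0 = derive1n 2 g 0.
  case: m m3 E => [[|k] m3 E|m3 E]; first by case: E.
    by case: E => E _; apply: E; exact: m3.
  exact: E.
rewrite g2 !derive1Sn in f2.
have ff : flat 3 f 0 by rewrite /flat f00 f01; split=> //; split=> //; split.
have [uM [s0 s1 s2] hG] := L.
have uN : invmx M *m A \in unitmx by rewrite unitmx_mul unitmx_inv uM.
have := lift_mul L uN; rewrite mulKVmx //.
set N := invmx M *m A; set K0 := lin3 _ _ _ _ _ _; set K1 := lin3 _ _ _ _ _ _; set K2 := lin3 _ _ _ _ _ _ => LK.
have [_ [t0s t1s t2s] hK] := LK.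
have K0n : K0 t0 != 0.
  have [k k0 E'] := hK t0; move: p0; rewrite /in_chart E' vec3Z vec3E.
  by apply: contra_neq => ->; rewrite mulr0.
have [_ x0 y0] := lift_chart LK K0n.
have K10 : K1 t0 / K0 t0 = 0 by rewrite -x0.
have c0 : {for t0, continuous K0} by exact: (smooth_continuous t0s).
have c1 : {for t0, continuous (fun t => K1 t / K0 t)}.
  apply: (@continuousM _ _ K1 (fun t => (K0 t)^-1)); first exact: (smooth_continuous t1s).
  exact: continuousV.
have nB : nbhs ((fun t => K1 t / K0 t) t0) (ball (0 : R) e) by rewrite /= K10; exact: nbhsx_ballx.
have N1 : \forall t \near t0, ball (0 : R) e (K1 t / K0 t) := c1 _ nB.
have N2 : \forall t \near t0, C (c t) <-> chart_y A (c t) = f (chart_x A (c t)) := cc _ gr.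
have n0 : nbhs (K0 t0) [set x | x != 0] by apply: open_nbhs_nbhs; split=> //; exact: open_neq.
have N0 : \forall t \near t0, K0 t != 0 := c0 _ n0.
have [d d0 hd] : exists2 d, 0 < d & forall t, t0 - d < t -> t < t0 + d ->
    [/\ K0 t != 0, ball (0 : R) e (K1 t / K0 t) & K2 t = K0 t * f (K1 t / K0 t)].
  apply: near_gap; apply: filterS3 N0 N1 N2 => t k0 h1 h; split=> //.
  have [_ tx ty] := lift_chart LK k0.
  have := h.1 (ex_intro2 _ _ (angle t) I erefl).
  by rewrite tx ty => <-; rewrite mulrC divfK.
pose U := [set t | t0 - d < t < t0 + d].
have oU : open U by exact: open_itv.
have Ut : U t0 by rewrite /U /=; apply/andP; split; rewrite ?ltrBlDr ltrDl.
have hU t : U t -> [/\ K0 t != 0, ball (0 : R) e (K1 t / K0 t) & K2 t = K0 t * f (K1 t / K0 t)].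
  by move=> /andP[]; exact: hd.
have sub F : smooth_on setT F -> smooth_on U F by exact: smooth_sub.
have sX : smooth_on U (fun t => K1 t / K0 t).
  apply: smoothM => //; first exact: sub.
  by apply: smoothV => //; [move=> t /hU[]|exact: sub].
have oB : open (ball (0 : R) e) by exact: ball_open.
have XB t : U t -> ball (0 : R) e (K1 t / K0 t) by move=> /hU[].
have fl : flat 3 K2 t0.
  apply: (@flat_near _ _ (fun t => f (K1 t / K0 t) * K0 t)).
    by apply: filterS (open_near oU Ut) => t /hU[_ _ ->]; rewrite mulrC.
  apply: (flatM oU Ut _ (sub _ t0s)); first by move=> n; exact: (Cn_comp oU oB XB (sf n)).
  by apply: (flat_comp oU Ut oB XB sf sX); rewrite K10.
have [k2 [k2' [k2'' _]]] := fl.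
have E0 : N 0 2%:R * G0 t0 + N 1 2%:R * G1 t0 + N 2%:R 2%:R * G2 t0 = 0 by [].
apply: (det3_kernel _ E0).
- move=> [m0 m1 m2]; have := unit_last uN m0 m1; rewrite m2 eqxx; by [].
- by rewrite -k2' (derive1_lin3 _ _ _ s0 s1 s2).
- by rewrite -k2'' (derive2_lin3 _ _ _ oT s0 s1 s2).
Qed.

End Special.

(** * Zeros of q as sextactic points *)

Section Sextactic.
Variables (R : realType) (gamma : circle R -> P2 R).
Implicit Types (M N : 'M[R]_3) (s t : R).
Let c t := gamma (angle t).
Hypothesis gamma_inj : injective gamma.
Let C := range gamma.

(** The hypotheses are Leibniz' formula up to order five, with equal terms of the square merged. *)
Lemma flat6_form (U : set R) t0 (a0 a1 a2 a3 a4 a5 b0 b1 b2 b3 b4 b5 d0 d1 d2 d3 d4 d5 : R -> R) :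
  open U -> U t0 ->
  (forall t, U t -> [/\ der a0 t (a1 t), der a1 t (a2 t), der a2 t (a3 t), der a3 t (a4 t) & der a4 t (a5 t)]) ->
  (forall t, U t -> [/\ der b0 t (b1 t), der b1 t (b2 t), der b2 t (b3 t), der b3 t (b4 t) & der b4 t (b5 t)]) ->
  (forall t, U t -> [/\ der d0 t (d1 t), der d1 t (d2 t), der d2 t (d3 t), der d3 t (d4 t) & der d4 t (d5 t)]) ->
  [/\ 2 * (a0 t0 * d0 t0) - b0 t0 * b0 t0 = 0,
      2 * (a1 t0 * d0 t0 + a0 t0 * d1 t0) - 2 * (b0 t0 * b1 t0) = 0 &
      2 * (a2 t0 * d0 t0 + 2 * a1 t0 * d1 t0 + a0 t0 * d2 t0) - 2 * (b1 t0 * b1 t0 + b0 t0 * b2 t0) = 0] ->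
  [/\ 2 * (a3 t0 * d0 t0 + 3 * a2 t0 * d1 t0 + 3 * a1 t0 * d2 t0 + a0 t0 * d3 t0) -
        2 * (3 * b1 t0 * b2 t0 + b0 t0 * b3 t0) = 0,
      2 * (a4 t0 * d0 t0 + 4 * a3 t0 * d1 t0 + 6 * a2 t0 * d2 t0 + 4 * a1 t0 * d3 t0 + a0 t0 * d4 t0) -
        2 * (3 * b2 t0 * b2 t0 + 4 * b1 t0 * b3 t0 + b0 t0 * b4 t0) = 0 &
      2 * (a5 t0 * d0 t0 + 5 * a4 t0 * d1 t0 + 10 * a3 t0 * d2 t0 + 10 * a2 t0 * d3 t0 +
           5 * a1 t0 * d4 t0 + a0 t0 * d5 t0) -
        2 * (10 * b2 t0 * b3 t0 + 5 * b1 t0 * b4 t0 + b0 t0 * b5 t0) = 0] ->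
  flat 6 (fun t => 2 * (a0 t * d0 t) - b0 t * b0 t) t0.
Proof.
move=> oU Ut A B D [e0 e1 e2] [e3 e4 e5].
have near (P : R -> Prop) : (forall t, U t -> P t) -> \forall t \near t0, P t.
  by move=> h; apply: filterS (open_near oU Ut).
pose E1 t := 2 * (a1 t * d0 t + a0 t * d1 t) - 2 * (b0 t * b1 t).
pose E2 t := 2 * (a2 t * d0 t + 2 * a1 t * d1 t + a0 t * d2 t) - 2 * (b1 t * b1 t + b0 t * b2 t).
pose E3 t := 2 * (a3 t * d0 t + 3 * a2 t * d1 t + 3 * a1 t * d2 t + a0 t * d3 t) -
  2 * (3 * b1 t * b2 t + b0 t * b3 t).
pose E4 t := 2 * (a4 t * d0 t + 4 * a3 t * d1 t + 6 * a2 t * d2 t + 4 * a1 t * d3 t + a0 t * d4 t) -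
  2 * (3 * b2 t * b2 t + 4 * b1 t * b3 t + b0 t * b4 t).
pose E5 t := 2 * (a5 t * d0 t + 5 * a4 t * d1 t + 10 * a3 t * d2 t + 10 * a2 t * d3 t +
     5 * a1 t * d4 t + a0 t * d5 t) -
  2 * (10 * b2 t * b3 t + 5 * b1 t * b4 t + b0 t * b5 t).
apply: (flatS (f1 := E1)); [exact: e0| |apply: (flatS (f1 := E2)); [exact: e1| |
  apply: (flatS (f1 := E3)); [exact: e2| |apply: (flatS (f1 := E4)); [exact: e3| |
  apply: (flatS (f1 := E5)); [exact: e4| |split; [exact: e5|exact: I]]]]]];
  apply: near => t Vt; have [x1 x2 x3 x4 x5] := A t Vt; have [y1 y2 y3 y4 y5] := B t Vt;
  have [z1 z2 z3 z4 z5] := D t Vt; rewrite /E1 /E2 /E3 /E4 /E5.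
- by der_ring.
- by der_ring.
- by der_ring.
- by der_ring.
- by der_ring.
Qed.

(* The fifth derivative of [2 a d - b^2] at [t0] is [12 (al - be'/2)]. *)
Lemma flat_conic (U : set R) (al be : R -> R) t0 (a a1 a2 b b1 b2 d d1 d2 : R -> R) :
  open U -> U t0 -> smooth_on U al -> smooth_on U be ->
  solves U al be a a1 a2 -> solves U al be b b1 b2 -> solves U al be d d1 d2 ->
  [/\ a t0 = 1, a1 t0 = 0 & a2 t0 = be t0 / 2] -> [/\ b t0 = 0, b1 t0 = 1 & b2 t0 = 0] ->
  [/\ d t0 = 0, d1 t0 = 0 & d2 t0 = 1] -> al t0 - derive1 be t0 / 2 = 0 ->
  flat 6 (fun t => 2 * (a t * d t) - b t * b t) t0.
Proof.
move=> oU Ut sal sbe Sa Sb Sd [ea0 ea1 ea2] [eb0 eb1 eb2] [ed0 ed1 ed2] q0.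
pose w3 (w w1 : R -> R) t := al t * w t + be t * w1 t.
pose w4 (w w1 w2 : R -> R) t := derive1 al t * w t + al t * w1 t + derive1 be t * w1 t + be t * w2 t.
pose w5 (w w1 w2 : R -> R) t := derive1 (derive1 al) t * w t + 2 * derive1 al t * w1 t + al t * w2 t +
  derive1 (derive1 be) t * w1 t + 2 * derive1 be t * w2 t + be t * (al t * w t + be t * w1 t).
have chain w w1 w2 : solves U al be w w1 w2 -> forall t, U t ->
  [/\ der w t (w1 t), der w1 t (w2 t), der w2 t (w3 w w1 t), der (w3 w w1) t (w4 w w1 w2 t) &
      der (w4 w w1 w2) t (w5 w w1 w2 t)].
  move=> S t Vt; have [x0 x1 x2] := S t Vt.
  have A0 := smooth_der sal Vt; have A1 := smooth_der (smooth_d sal) Vt.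
  have B0 := smooth_der sbe Vt; have B1 := smooth_der (smooth_d sbe) Vt.
  split=> //; rewrite /w3 /w4 /w5.
    by der_ring.
  by der_ring.
have qE : al t0 = derive1 be t0 / 2 by apply/eqP; rewrite -subr_eq0 q0.
apply: (flat6_form oU Ut (chain _ _ _ Sa) (chain _ _ _ Sb) (chain _ _ _ Sd)).
  by rewrite ea0 ea1 ea2 eb0 eb1 eb2 ed0 ed1 ed2; split; ring.
rewrite /w3 /w4 /w5 ea0 ea1 ea2 eb0 eb1 eb2 ed0 ed1 ed2 qE.
move: (derive1 (derive1 al) t0) (derive1 (derive1 be) t0) (derive1 al t0) (derive1 be t0) (be t0) => x y z u v.
by split; field.
Qed.

End Sextactic.

Section SextacticPoints.
Variables (R : realType) (gamma : circle R -> P2 R).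
Implicit Types (M N : 'M[R]_3) (s t : R).
Let c t := gamma (angle t).
Hypothesis gamma_inj : injective gamma.
Let C := range gamma.
Let oT : open [set: R] := @openT R.

(** The rows are dual to $y, y', y'' - \beta y$ with $\beta$ the parameter [be], so the first one
    takes the values $1, 0, \beta$ on $y, y', y''$. In the application the parameter is half the
    coefficient [be] of the equation: the fourth derivative of $2ad - b^2$ is 12 times the parameter
    minus 6 times that coefficient. *)
Lemma adj_frame (a b e a' b' e' a'' b'' e'' be : R) :
  det3 a b e a' b' e' a'' b'' e'' = 1 ->
  exists p q r p' q' r' p'' q'' r'',
  [/\ [/\ p * a + q * b + r * e = 1, p' * a + q' * b + r' * e = 0 & p'' * a + q'' * b + r'' * e = 0],
      [/\ p * a' + q * b' + r * e' = 0, p' * a' + q' * b' + r' * e' = 1 &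
          p'' * a' + q'' * b' + r'' * e' = 0],
      [/\ p * a'' + q * b'' + r * e'' = be, p' * a'' + q' * b'' + r' * e'' = 0 &
          p'' * a'' + q'' * b'' + r'' * e'' = 1] &
      det3 p q r p' q' r' p'' q'' r'' = 1].
Proof.
pose A := a'' - be * a; pose B := b'' - be * b; pose D := e'' - be * e => d1.
exists (b' * D - e' * B), (e' * A - a' * D), (a' * B - b' * A),
  (B * e - D * b), (D * a - A * e), (A * b - B * a),
  (b * e' - e * b'), (e * a' - a * e'), (a * b' - b * a').
have E1 : 1 = det3 a b e a' b' e' a'' b'' e'' by [].
have E2 : be = be * det3 a b e a' b' e' a'' b'' e'' by rewrite d1 mulr1.
have E3 : 1 = det3 a b e a' b' e' a'' b'' e'' ^+ 2 by rewrite d1 expr1n.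
split; last by rewrite E3 /A /B /D /det3; ring.
- by split; rewrite ?E1 /A /B /D /det3; ring.
- by split; rewrite ?E1 /A /B /D /det3; ring.
- split; [rewrite [RHS]E2|..]; rewrite ?E1 /A /B /D /det3; ring.
Qed.

Definition conicmx M : 'M[R]_3 := M *m mx3 0 0 1 0 (- 1) 0 1 0 0 *m M^T.

Lemma conicmxE M q : (rep q *m conicmx M *m (rep q)^T) 0 0 =
  2 * (hcoord M q 0 0 * hcoord M q 0 2%:R) - hcoord M q 0 1 ^+ 2.
Proof.
rewrite /conicmx !mulmxA -[_ *m M^T *m _]mulmxA -trmx_mul -hcoordE.
move: (hcoord M q) => h; rewrite mxE sum3E !mulmx3E !mxE /=; ring.
Qed.

(** In the adapted frame the osculating conic is always this parabola, so contact with it means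
    comparing [f] with $x^2/2$. *)
Lemma conic_parabola M p : M \in unitmx -> in_chart M p -> chart_x M p = 0 -> chart_y M p = 0 ->
  exists Q, conic Q /\ graph_at Q p M (fun x => x ^+ 2 / 2).
Proof.
move=> uM p0 px py.
exists [set q | rep q *m conicmx M *m (rep q)^T = 0]; split.
  exists (conicmx M); split=> //.
    rewrite /conicmx !trmx_mul trmxK mulmxA; congr (_ *m _ *m _).
    by apply/matrixP => i j; rewrite !mxE; case: i => -[|[|[|//]]] i; case: j => -[|[|[|//]]] j.
  rewrite /conicmx !unitmx_mul unitmx_tr uM mx3_unit //.
  by rewrite (_ : det3 _ _ _ _ _ _ _ _ _ = 1) ?oner_neq0 // /det3; ring.
have D1 t : der (fun x : R => x ^+ 2 / 2) t t by der_auto; rewrite /=; field.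
split=> //.
- apply/smooth_nearP; exists 1 => //; apply: smoothM; [exact: ball_open| |by apply: smooth_cst; exact: ball_open].
  by move=> n; apply: CnX; [exact: ball_open|apply: Cn_id; exact: ball_open].
- by split; [rewrite expr2 !mul0r|apply: der_val; exact: D1].
- apply: filterS (chart_near p0 px ltr01) => q [q0 _]; rewrite /in_chart in q0.
  rewrite /chart_x /chart_y /=; have := conicmxE M q.
  move: (hcoord M q 0 0) (hcoord M q 0 1) (hcoord M q 0 2%:R) q0 => x y z x0 E.
  split=> [h|h].
    move: E; rewrite h mxE => /esym/eqP; rewrite subr_eq0 => /eqP E.
    by rewrite expr_div_n -E; field.
  apply/matrixP => i j; rewrite !ord1 E mxE.
  have -> : z = (y / x) ^+ 2 / 2 * x by rewrite -h divfK.
  by field.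
Qed.

(** The flatness of the quadratic form along the normalised lift is carried to the graph: division
    by [psi ^+ 2] gives flatness along the original lift, and division by [2 * H0 ^+ 2] with
    composition by [tau] gives $f - x^2/2$. One frame serves for multiplicity five and six alike. *)
Lemma sextactic_of_lift M G0 G1 G2 psi al be U t0 : {for t0, continuous c} ->
  hlift gamma M G0 G1 G2 -> open U -> hat G0 G1 G2 psi al be U -> U t0 ->
  al t0 - derive1 be t0 / 2 = 0 -> sextactic_point C (c t0).
Proof.
move=> cc L oU H Ut q0; have [_ [s0 s1 s2] _] := L.
have pos := hat_gt0 H Ut; have pD := hat_D H Ut; have det1 := hat_det H Ut.
split.
  apply: (not_inflection cc L); apply/eqP => D0; move: pD; rewrite D0 mulr0 => /esym/eqP.
  by rewrite oner_eq0.
have S0 := hat_solves0 H; have S1 := hat_solves1 H; have S2 := hat_solves2 H.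
have spsi := hat_psi H; have sal := hat_al H; have sbe := hat_be H.
rewrite /wronski3 in det1; move: S0 S1 S2 det1.
set y0 := (fun t => psi t * G0 t); set y1 := (fun t => psi t * G1 t); set y2 := (fun t => psi t * G2 t).
move=> S0 S1 S2 det1.
have [p [q [r [p' [q' [r' [p'' [q'' [r'' [[a0 b0 d0] [a1 b1 d1] [a2 b2 d2] dp]]]]]]]]]] :=
  adj_frame (be t0 / 2) det1.
have [|M' L'] := lift_lin3 L (p := p) (q := q) (r := r) (p' := p') (q' := q') (r' := r')
  (p'' := p'') (q'' := q'') (r'' := r''); first by rewrite dp oner_eq0.
have zE u v w t : lin3 u v w y0 y1 y2 t = psi t * lin3 u v w G0 G1 G2 t.
  by rewrite /lin3 /y0 /y1 /y2; ring.
have Sl u v w := solves_lin3 u v w S0 S1 S2.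
have fl := flat_conic oU Ut sal sbe (Sl p q r) (Sl p' q' r') (Sl p'' q'' r'')
  (And3 a0 a1 a2) (And3 b0 b1 b2) (And3 d0 d1 d2) q0.
have sH u v w : smooth_on setT (lin3 u v w G0 G1 G2) by exact: smooth_lin3.
have sub F : smooth_on setT F -> smooth_on U F by exact: smooth_sub.
have pn : psi t0 != 0 by rewrite gt_eqF.
have dH u v w : lin3 u v w y0 y1 y2 t0 = 0 -> lin3 u v w G0 G1 G2 t0 = 0 /\
    lin3 u v w (derive1 y0) (derive1 y1) (derive1 y2) t0 = psi t0 * derive1 (lin3 u v w G0 G1 G2) t0.
  rewrite zE => /eqP; rewrite mulf_eq0 (negbTE pn) /= => /eqP h; split=> //.
  have [D _ _] := Sl u v w t0 Ut; apply: (der_unique D).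
  apply: (der_near (f := fun t => psi t * lin3 u v w G0 G1 G2 t)).
    by near=> t; rewrite zE.
  apply: (der_eq (derM (smooth_der spsi Ut) (smooth_der (sub _ (sH u v w)) Ut))).
  by rewrite h mulr0 add0r.
move: L' fl; set H0 := lin3 p q r G0 G1 G2; set H1 := lin3 p' q' r' G0 G1 G2.
set H2 := lin3 p'' q'' r'' G0 G1 G2 => L' fl.
have [uM' _ _] := L'.
have [h1 dh1] := dH _ _ _ b0; have [h2 dh2] := dH _ _ _ d0.
have h0 : 0 < H0 t0 by rewrite -(pmulr_rgt0 _ pos) -zE [X in 0 < X]a0.
have e1 : 0 < derive1 H1 t0 by rewrite -(pmulr_rgt0 _ pos) -dh1 [X in 0 < X]b1.
have e2 : derive1 H2 t0 = 0.
  by apply/eqP; move/eqP: dh2; rewrite [lin3 _ _ _ _ _ _ _]d1 eq_sym mulf_eq0 (negbTE pn).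
have [U' [V [f [tau [[oU' oV Ut' V0 tau0] [H0n tauU stau sf] fE gf]]]]] :=
  graph_of_lift gamma_inj L' h0 h1 h2 e1 e2.
have [_ [p0 px py] _ _ _] := gf.
have [Q [cQ gQ]] := conic_parabola uM' p0 px py.
pose F t := 2 * (H0 t * H2 t) - H1 t * H1 t.
have sF W : open W -> smooth_on W F.
  move=> oW; have sW u v w : smooth_on W (lin3 u v w G0 G1 G2) by exact: smooth_sub (sH u v w).
  exact: (smoothB oW (smoothM oW (smooth_cst 2 oW) (smoothM oW (sW p q r) (sW p'' q'' r'')))
    (smoothM oW (sW p' q' r') (sW p' q' r'))).
have sV : smooth_on U (fun t => (psi t ^+ 2)^-1).
  apply: smoothV => //; first by move=> t Vt; rewrite expf_neq0 // gt_eqF // (hat_gt0 H Vt).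
  by move=> n; apply: CnX.
have sE : smooth_on U (fun t => 2 * (lin3 p q r y0 y1 y2 t * lin3 p'' q'' r'' y0 y1 y2 t) -
    lin3 p' q' r' y0 y1 y2 t * lin3 p' q' r' y0 y1 y2 t).
  have sy G : smooth_on setT G -> smooth_on U (fun t => psi t * G t).
    by move=> sG; apply: smoothM => //; exact: sub.
  have sW u v w : smooth_on U (lin3 u v w y0 y1 y2) by apply: smooth_lin3 => //; exact: sy.
  exact: (smoothB oU (smoothM oU (smooth_cst 2 oU) (smoothM oU (sW p q r) (sW p'' q'' r'')))
    (smoothM oU (sW p' q' r') (sW p' q' r'))).
have flF : flat 6 F t0.
  apply: flat_near (flatM oU Ut sE sV fl); apply: filterS (open_near oU Ut) => t Vt.
  rewrite !zE /F -/H0 -/H1 -/H2; have pt : psi t != 0 by rewrite gt_eqF // (hat_gt0 H Vt).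
  by field.
have sI : smooth_on U' (fun t => (2 * (H0 t * H0 t))^-1).
  apply: smoothV => //; first by move=> t /H0n h; rewrite mulf_neq0 ?pnatr_eq0 // mulf_neq0.
  have sW : smooth_on U' H0 by exact: smooth_sub (sH p q r).
  exact: (smoothM oU' (smooth_cst 2 oU') (smoothM oU' sW sW)).
have flG := flatM oU' Ut' (sF _ oU') sI flF.
have flf : flat 6 (fun x => f x - x ^+ 2 / 2) 0.
  apply: (@flat_near _ _ (fun x => F (tau x) * (2 * (H0 (tau x) * H0 (tau x)))^-1)).
    apply: filterS (open_near oV V0) => x Vx; have [xE ->] := fE x Vx.
    have h := H0n _ (tauU x Vx); rewrite /F (_ : x ^+ 2 = (H1 (tau x) / H0 (tau x)) ^+ 2); last by rewrite xE.
    by field.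
  by apply: (flat_comp oV V0 oU' tauU (smoothM oU' (sF _ oU') sI) stau); rewrite tau0.
have sg : smooth_on V (fun x => x ^+ 2 / 2).
  apply: smoothM => //; last exact: smooth_cst.
  by move=> n; apply: CnX => //; exact: Cn_id.
have dE j : (j < 6)%N -> derive1n j f 0 = derive1n j (fun x => x ^+ 2 / 2) 0.
  by move=> j6; apply/eqP; rewrite -subr_eq0 -(derive1nB j oV V0 sf sg); apply/eqP; exact: flat_derive1n flf j j6.
exists Q; split; [split=> //|]; apply: (multiplicity_geI gf gQ) => // j j5; apply: dE => //.
exact: ltn_trans j5 _.
Unshelve. all: by end_near. Qed.

End SextacticPoints.

(** * Existence of a periodic lift *)

Section Directions.
Variable R : realType.
Implicit Types (p q : P2 R) (s t : R).

Definition dot3 (v w : 'rV[R]_3) : R := v 0 0 * w 0 0 + v 0 1 * w 0 1 + v 0 2%:R * w 0 2%:R.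

(** A unit representative, with a sign as arbitrary as the choice made by [repr]. Only even
    expressions, such as [ip p q ^+ 2] or [udir p i * udir p j], depend continuously on the
    points. *)
Definition udir p (j : 'I_3) : R := rep p 0 j / Num.sqrt (dot3 (rep p) (rep p)).

Definition ip p q : R := udir p 0 * udir q 0 + udir p 1 * udir q 1 + udir p 2%:R * udir q 2%:R.

Lemma dot3_gt0 (v : 'rV[R]_3) : v != 0 -> 0 < dot3 v v.
Proof.
move=> v0; have h : 0 <= dot3 v v by rewrite /dot3 -!expr2 !addr_ge0 ?sqr_ge0.
rewrite lt_neqAle h andbT eq_sym; apply: contra_neq v0 => E.
have := sqr_ge0 (v 0 0); have := sqr_ge0 (v 0 1); have := sqr_ge0 (v 0 2%:R).
move: E; rewrite /dot3 -!expr2 => E h2 h1 h0.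
have e0 : v 0 0 ^+ 2 == 0 by apply/eqP; lra.
have e1 : v 0 1 ^+ 2 == 0 by apply/eqP; lra.
have e2 : v 0 2%:R ^+ 2 == 0 by apply/eqP; lra.
move: e0 e1 e2; rewrite !sqrf_eq0 => /eqP e0 /eqP e1 /eqP e2.
by rewrite [v]vec3_eta e0 e1 e2; apply/rowP => j; rewrite !mxE; case: j => -[|[|[|//]]].
Qed.

Lemma sqrt_dot3 p : 0 < Num.sqrt (dot3 (rep p) (rep p)).
Proof. by rewrite sqrtr_gt0; exact/dot3_gt0/rep_neq0. Qed.

Lemma ipE p q : ip p q =
  dot3 (rep p) (rep q) / (Num.sqrt (dot3 (rep p) (rep p)) * Num.sqrt (dot3 (rep q) (rep q))).
Proof.
rewrite /ip /udir; have := sqrt_dot3 p; have := sqrt_dot3 q.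
set a := Num.sqrt (dot3 (rep p) _); set b := Num.sqrt (dot3 (rep q) _) => a0 b0.
by rewrite /dot3; field; rewrite !gt_eqF.
Qed.

Lemma ipp p : ip p p = 1.
Proof.
rewrite ipE -expr2 sqr_sqrtr ?divff //; first by rewrite gt_eqF // dot3_gt0 // rep_neq0.
by apply: ltW; rewrite dot3_gt0 // rep_neq0.
Qed.

Lemma ipC p q : ip p q = ip q p.
Proof. by rewrite /ip; congr (_ + _ + _); exact: mulrC. Qed.

(** The difference of the two sides is the Gram determinant of three unit vectors, which is the
    square of [det3]. *)
Lemma gram (a0 a1 a2 b0 b1 b2 c0 c1 c2 : R) (ab := a0 * b0 + a1 * b1 + a2 * b2)
    (bc := b0 * c0 + b1 * c1 + b2 * c2) (ac := a0 * c0 + a1 * c1 + a2 * c2) :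
  a0 * a0 + a1 * a1 + a2 * a2 = 1 -> b0 * b0 + b1 * b1 + b2 * b2 = 1 ->
  c0 * c0 + c1 * c1 + c2 * c2 = 1 -> (ac - ab * bc) ^+ 2 <= (1 - ab ^+ 2) * (1 - bc ^+ 2).
Proof.
move=> aa bb cc; rewrite -subr_ge0.
suff -> : (1 - ab ^+ 2) * (1 - bc ^+ 2) - (ac - ab * bc) ^+ 2 =
  det3 a0 a1 a2 b0 b1 b2 c0 c1 c2 ^+ 2 by exact: sqr_ge0.
have -> : det3 a0 a1 a2 b0 b1 b2 c0 c1 c2 ^+ 2 =
  (a0 * a0 + a1 * a1 + a2 * a2) * (b0 * b0 + b1 * b1 + b2 * b2) * (c0 * c0 + c1 * c1 + c2 * c2)
  + 2 * ab * bc * ac - (a0 * a0 + a1 * a1 + a2 * a2) * bc ^+ 2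
  - (b0 * b0 + b1 * b1 + b2 * b2) * ac ^+ 2 - (c0 * c0 + c1 * c1 + c2 * c2) * ab ^+ 2.
  by rewrite /det3 /ab /bc /ac; ring.
by rewrite aa bb cc; ring.
Qed.

Lemma ip_gram p q r : (ip p r - ip p q * ip q r) ^+ 2 <= (1 - ip p q ^+ 2) * (1 - ip q r ^+ 2).
Proof. by apply: gram; exact: ipp. Qed.

Lemma ip_le1 p q : ip p q ^+ 2 <= 1.
Proof.
have hp := ipp p; have hq := ipp q; rewrite -[X in _ <= X]mulr1 -{1}hp -hq /ip.
move: (udir p 0) (udir p 1) (udir p 2%:R) (udir q 0) (udir q 1) (udir q 2%:R) => a b c d e f.
rewrite -subr_ge0; have -> : (a * a + b * b + c * c) * (d * d + e * e + f * f) -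
  (a * d + b * e + c * f) ^+ 2 = (a * e - b * d) ^+ 2 + (b * f - c * e) ^+ 2 + (c * d - a * f) ^+ 2.
  by ring.
by rewrite !addr_ge0 ?sqr_ge0.
Qed.

Definition acute p q := 1 / 2 < ip p q ^+ 2.

(* Two angles of less than 45 degrees add up to less than 90 degrees. *)
Lemma acute_cocycle p q r : acute p q -> acute q r -> 0 < ip p q * ip q r * ip p r.
Proof.
rewrite /acute => h1 h2; have := ip_gram p q r.
move: (ip p q) (ip q r) (ip p r) h1 h2 => x y z h1 h2 g.
rewrite ltNge; apply/negP => h.
have := sqr_ge0 z; have : (1 - x ^+ 2) * (1 - y ^+ 2) < x ^+ 2 * y ^+ 2 by lra.
nra.
Qed.

(** The hypotheses give $|xy| > 9/10$, and by [ip_gram] $|z - xy| \le 1/10$; hence $|z| > 4/5$ and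
    $z^2 > 1/2$. *)
Lemma acute_center p q r : 9 / 10 < ip p q ^+ 2 -> 9 / 10 < ip p r ^+ 2 -> acute q r.
Proof.
move=> h1 h2; have := ip_gram q p r; rewrite (ipC q p) /acute.
move: (ip_le1 p q) (ip_le1 p r); move: (ip p q) (ip p r) (ip q r) h1 h2 => x y z h1 h2 x1 y1 g.
have h3 : (1 - x ^+ 2) * (1 - y ^+ 2) <= 1 / 100.
  nra.
have h4 : 81 / 100 < (x * y) ^+ 2 by rewrite exprMn; nra.
have h5 : (z - x * y) ^+ 2 <= 1 / 100 by lra.
(* The weight 9 makes the square vanish in the extremal case $u = 9/10$, $u - z = 1/10$. *)
move: (x * y) h4 h5 => u h4 h5; have := sqr_ge0 (u - 9 * (u - z)); nra.
Qed.

Lemma nbhs_acute p : \forall q \near p, 9 / 10 < ip p q ^+ 2.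
Proof.
pose F (v : 'rV[R]_3) := 10 * (dot3 (rep p) v * dot3 (rep p) v) - 9 * (dot3 (rep p) (rep p) * dot3 v v).
have cc j : continuous (fun v : 'rV[R]_3 => v 0 j).
  have -> : (fun v : 'rV[R]_3 => v 0 j) = (fun v => (v *m 1%:M) 0 j) by apply/funext => v; rewrite mulmx1.
  exact: continuous_coord.
have c1 : continuous (fun v => dot3 (rep p) v).
  by apply: contD; [apply: contD|]; apply: contM; first [exact: contC|exact: cc].
have c2 : continuous (fun v => dot3 v v).
  by apply: contD; [apply: contD|]; apply: contM; exact: cc.
have cF : continuous F.
  by apply: contB; apply: contM; first [exact: contC|apply: contM => //; exact: contC].
have FZ v k : k != 0 -> 0 < F v -> 0 < F (k *: v).
  move=> k0 Fv; have -> : F (k *: v) = k ^+ 2 * F v by rewrite /F /dot3 !mxE; ring.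
  exact: (mulr_gt0 (sqr_pos k0) Fv).
have dp := dot3_gt0 (rep_neq0 p).
have pP : 0 < F (rep p) by rewrite /F; nra.
have : nbhs p [set q : P2 R | 0 < F (rep q)].
  by apply: open_nbhs_nbhs; split => //; exact: open_P2 (open_pos cF) FZ.
apply: filterS => q; rewrite /= /F ipE expr_div_n exprMn.
have dq := dot3_gt0 (rep_neq0 q).
rewrite !sqr_sqrtr ?(ltW dp) ?(ltW dq) // ltr_pdivlMr ?mulr_gt0 // => h; lra.
Qed.

(** A Lebesgue number for the neighbourhoods given by [nbhs_acute]. Only [x] is confined to the
    compact set, so [y] may lie beyond the end of a period. *)
Lemma lebesgue_acute (K : R * R -> P2 R) (A : set (R * R)) : compact A -> continuous K ->
  exists2 d, 0 < d & forall x, A x -> forall y, `|x.1 - y.1| < d -> `|x.2 - y.2| < d ->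
    acute (K x) (K y).
Proof.
move=> cA cK.
pose P (d : R) (x : R * R) := forall y : R * R, `|x.1 - y.1| < d -> `|x.2 - y.2| < d ->
    acute (K x) (K y).
have : \forall d \near (0 : R)^'+, A `<=` P d.
  move/compact_near_coveringP : cA; apply => x _.
  have /nbhs_ballP[e /= e0 he] : nbhs x [set y | 9 / 10 < ip (K x) (K y) ^+ 2].
    exact: cK _ (nbhs_acute (K x)).
  exists (ball x (e / 2), [set d | d < e / 2]).
    split=> /=; first by apply: nbhsx_ballx; rewrite divr_gt0.
    by apply: nbhs_right_lt; rewrite divr_gt0.
  move=> [y d] /= [[yx1 yx2] de] z z1 z2; apply: (@acute_center (K x)); apply: he.
    split; apply: (@le_ball _ _ _ (e / 2)) => //; lra.
  split; rewrite /ball /=.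
    have := ler_distD y.1 x.1 z.1; move: yx1; rewrite /ball /=; lra.
  have := ler_distD y.2 x.2 z.2; move: yx2; rewrite /ball /=; lra.
move=> h; have [d [d0 hd]] : exists d, 0 < d /\ A `<=` P d.
  near (0 : R)^'+ => d; exists d; split; first by near: d; exact: nbhs_right_gt.
  by near: d.
by exists d => // x /hd.
Unshelve. all: by end_near. Qed.

End Directions.

(** * Sign monodromy of a null-homotopic loop *)

Section Signs.
Variable R : realType.
Implicit Types (p q : P2 R) (s t r : R).

Definition sgip p q : R := Num.sg (ip p q).

Lemma sgip_refl p : sgip p p = 1.
Proof. by rewrite /sgip ipp sgr1. Qed.

Lemma sgipC p q : sgip p q = sgip q p.
Proof. by rewrite /sgip ipC. Qed.

Lemma acute_neq0 p q : acute p q -> ip p q != 0.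
Proof. by rewrite /acute => h; apply/eqP => E; move: h; rewrite E expr0n /=; lra. Qed.

Lemma sgip_sqr p q : acute p q -> sgip p q * sgip p q = 1.
Proof. by move=> /acute_neq0 h; rewrite -expr2 sqr_sg h. Qed.

Lemma sgip_cocycle p q (r : P2 R) : acute p q -> acute q r -> sgip p q * sgip q r = sgip p r.
Proof.
move=> h1 h2; have h := acute_cocycle h1 h2.
have z0 : ip p r != 0 by apply: contraTneq h => ->; rewrite mulr0 ltxx.
have /eqP := gtr0_sg h; rewrite !sgrM -!/(sgip _ _) => /eqP E.
by rewrite -[LHS]mulr1 -(_ : sgip p r * sgip p r = 1) ?mulrA ?E ?mul1r // -expr2 sqr_sg z0.
Qed.

Lemma sgip_square p q p' q' : acute p q -> acute q q' -> acute p p' -> acute p' q' ->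
  sgip p q * sgip p' q' = sgip p p' * sgip q q'.
Proof.
move=> h1 h2 h3 h4; have e := sgip_cocycle h1 h2; rewrite -(sgip_cocycle h3 h4) in e.
rewrite -[LHS]mulr1 -(sgip_sqr h2) -[RHS]mulr1 -(sgip_sqr h4).
rewrite !mulrA [_ * sgip q q' * sgip q q']mulrAC.
rewrite (mulrAC (sgip p q)) e; ring.
Qed.

Variables (K : R -> R -> P2 R) (d h : R) (N : nat) (y : P2 R).
Hypotheses (d0 : 0 < d) (h0 : 0 < h) (hd : h < d).
Hypothesis acuteK : forall t t' r r', 0 <= r <= 1 -> 0 <= r' <= 1 -> `|t - t'| < d ->
  `|r - r'| < d -> acute (K t r) (K t' r').
Hypothesis loopK : forall r, K (N%:R * h) r = K 0 r.
Hypothesis endK : forall t, K t 1 = y.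

Let e r i := sgip (K (i%:R * h) r) (K (i.+1%:R * h) r).

Lemma grid_acute i : `|i%:R * h - i.+1%:R * h| < d.
Proof.
rewrite (_ : _ - _ = - h); last by rewrite -addn1 natrD; ring.
by rewrite normrN gtr0_norm.
Qed.

(* The sign cocycle is trivial on each square of the grid. *)
Lemma monodromy_step r r' n : 0 <= r <= 1 -> 0 <= r' <= 1 -> `|r - r'| < d ->
  (\prod_(i < n) e r i) * (\prod_(i < n) e r' i) =
  sgip (K 0 r) (K 0 r') * sgip (K (n%:R * h) r) (K (n%:R * h) r').
Proof.
move=> r1 r2 rr.
have cv t : acute (K t r) (K t r') by apply: acuteK; rewrite // subrr normr0.
elim: n => [|n IH]; first by rewrite !big_ord0 mul0r sgip_sqr // mulr1.
have hh s : 0 <= s <= 1 -> acute (K (n%:R * h) s) (K (n.+1%:R * h) s).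
  by move=> s1; apply: acuteK => //; [exact: grid_acute|rewrite subrr normr0].
have E := sgip_square (hh r r1) (cv _) (cv _) (hh r' r2).
rewrite !big_ord_recr /= -/(e r n) -/(e r' n).
have -> (a b f g : R) : a * b * (f * g) = (a * f) * (b * g) by ring.
rewrite IH {1}/e {1}/e E.
have -> (a b f : R) : a * b * (b * f) = a * f * (b * b) by ring.
by rewrite sgip_sqr // mulr1.
Qed.

(** As the loops close up, the two boundary signs in [monodromy_step] cancel and nearby loops have
    the same product. It is 1 for the constant loop at [r = 1], and steps of [1 / m] lead down to
    [r = 0]. *)
Lemma monodromy : \prod_(i < N) e 0 i = 1.
Proof.
have step r r' : 0 <= r <= 1 -> 0 <= r' <= 1 -> `|r - r'| < d ->
    \prod_(i < N) e r i = 1 -> \prod_(i < N) e r' i = 1.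
  move=> r1 r2 rr E; have := monodromy_step N r1 r2 rr.
  by rewrite E mul1r !loopK sgip_sqr //; apply: acuteK => //; rewrite subrr normr0.
have E1 : \prod_(i < N) e 1 i = 1.
  by apply: big1 => i _; rewrite /e !endK sgip_refl.
have [m m0 md] : exists2 m : nat, (0 < m)%N & m%:R^-1 < d.
  exists (Num.trunc d^-1).+1 => //.
  rewrite invf_plt ?posrE ?ltr0n //; exact: truncnS_gt.
have mp : (0 : R) < m%:R by rewrite ltr0n.
suff H j : (j <= m)%N -> \prod_(i < N) e (1 - j%:R / m%:R) i = 1.
  by have := H m (leqnn m); rewrite divff ?gt_eqF // subrr.
elim: j => [|j IH] jm; first by rewrite mul0r subr0.
have rng k : (k <= m)%N -> 0 <= (1 - k%:R / m%:R : R) <= 1.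
  move=> km; have a : 0 <= k%:R / m%:R :> R by rewrite divr_ge0.
  have b : k%:R / m%:R <= 1 :> R by rewrite ler_pdivrMr // mul1r ler_nat.
  by lra.
apply: (step (1 - j%:R / m%:R)); [exact/rng/ltnW|exact: rng| |exact/IH/ltnW].
rewrite (_ : _ - _ = m%:R^-1); last first.
  by rewrite -addn1 natrD; field; rewrite gt_eqF.
by rewrite gtr0_norm // invr_gt0.
Qed.

End Signs.

(** * Uniform continuity of the homotopy *)

Section UniformLoop.
Variables (R : realType) (gamma : circle R -> P2 R).
Implicit Types (s t r : R).

Lemma cont_pair (T U V : topologicalType) (f : T -> U) (g : T -> V) x :
  {for x, continuous f} -> {for x, continuous g} -> {for x, continuous (fun z => (f z, g z))}.
Proof.
move=> cf cg W [[A B] [/= nA nB] AB].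
have fA : nbhs x (f @^-1` A) := cf _ nA; have gB : nbhs x (g @^-1` B) := cg _ nB.
have h := @filterI _ _ (nbhs_filter x) _ _ fA gB.
suff : nbhs x ((fun z => (f z, g z)) @^-1` W) by [].
by apply: (@filterS _ _ (nbhs_filter x) _ _ _ h) => z [Az Bz]; exact: (AB (f z, g z)).
Qed.

Lemma angle_add s t d : angle s = angle t -> angle (s + d) = angle (t + d) :> circle R.
Proof.
move=> /(congr1 val)[ec es]; apply: val_inj => /=.
by rewrite !cosD !sinD ec es.
Qed.

(** The homotopy is continuous only within [[0, 1]]; composed with [clamp] it becomes continuous on
    the whole plane, as [lebesgue_acute] requires. *)
Definition clamp r : R := Num.max 0 (Num.min r 1).

Lemma clamp_itv r : 0 <= clamp r <= 1.
Proof. by rewrite /clamp le_max lexx ge_max ler01 ge_min lexx orbT. Qed.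

Lemma clamp_id r : 0 <= r <= 1 -> clamp r = r.
Proof. by move=> /andP[a b]; rewrite /clamp min_l // max_r. Qed.

Lemma clamp_continuous : continuous clamp.
Proof.
move=> r; apply: (@continuous_max R R (fun=> 0) (fun r => Num.min r 1)).
  exact: cst_continuous.
by apply: (@continuous_min R R id (fun=> 1)); [exact: cvg_id|exact: cst_continuous].
Qed.

Lemma angle_continuous : continuous (@angle R).
Proof.
move=> t W [_ [[W' oW' <-] W't W'W]].
have cc : {for t, continuous (fun t : R => (cos t, sin t))}.
  by apply: cont_pair; [exact: continuous_cos|exact: continuous_sin].
have nW : nbhs ((fun t : R => (cos t, sin t)) t) W' by apply: open_nbhs_nbhs.
apply: (@filterS _ (nbhs t) _ (fun s => W' (cos s, sin s))); last exact: cc _ nW.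
by move=> s Ws; exact: (W'W (angle s)).
Qed.

Lemma uniform_homotopy : null_homotopic R gamma ->
  exists (K : R -> R -> P2 R) (y : P2 R) (d : R),
    [/\ 0 < d, forall t t' r r', 0 <= r <= 1 -> 0 <= r' <= 1 -> `|t - t'| < d ->
          `|r - r'| < d -> acute (K t r) (K t' r'),
        forall t r, K (t + 2 * pi) r = K t r, forall t, K t 0 = gamma (angle t) &
        forall t, K t 1 = y].
Proof.
move=> [H [y [cH H0 H1]]].
pose phi (x : R * R) : circle R * R := (angle x.1, clamp x.2).
have cphi : continuous phi.
  move=> x; apply: (@cont_pair _ _ _ (fun x : R * R => angle x.1) (fun x : R * R => clamp x.2)).
    apply: (@continuous_comp _ _ _ (@fst R R) (@angle R)); [exact: cvg_fst|exact: angle_continuous].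
  by apply: (@continuous_comp _ _ _ (@snd R R) clamp); [exact: cvg_snd|exact: clamp_continuous].
have Aphi x : ([set: circle R] `*` `[0, 1]) (phi x).
  by split=> //=; rewrite in_itv /=; exact: clamp_itv.
have cK : continuous (H \o phi).
  move=> x W nW; have /subspace_continuousP cH' := cH.
  have h : nbhs x [set z | ([set: circle R] `*` `[0, 1]) (phi z) -> W (H (phi z))] :=
    cphi x _ (cH' _ (Aphi x) W nW).
  suff : nbhs x ((H \o phi) @^-1` W) by [].
  by apply: (@filterS _ _ (nbhs_filter x) _ _ _ h) => z; apply; exact: Aphi.
have cA : compact ((`[0, 2 * pi]%classic : set R) `*` (`[0, 1]%classic : set R)).
  by apply: compact_setX; exact: segment_compact.
have [d d0 hd] := lebesgue_acute cA cK.
exists (fun t r => H (phi (t, r))), y, d; split=> //.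
- move=> t t' r r' r1 r2 tt rr.
  have [s [s0 s1 sE]] := angle_reduce t 0; rewrite add0r in s1.
  have E1 : phi (t, r) = phi (s, r) by rewrite /phi /= sE.
  have E2 : phi (t', r') = phi (s + (t' - t), r').
    by rewrite /phi /= (angle_add (t' - t) sE) addrC subrK.
  have As : ((`[0, 2 * pi]%classic : set R) `*` (`[0, 1]%classic : set R)) (s, r).
    by split; rewrite /= in_itv //= s0 ltW.
  rewrite E1 E2; apply: (hd _ As) => //=.
  by rewrite (_ : s - _ = t - t') //; ring.
- by move=> t r; rewrite /phi /= angle_period.
- by move=> t; rewrite /phi /= clamp_id ?H0 // lexx ler01.
- by move=> t; rewrite /phi /= clamp_id ?H1 // lexx ler01.
Qed.

End UniformLoop.

(** * A consistent choice of signs along the line *)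

Section SignChoice.
Variables (R : realType) (c : R -> P2 R) (d h : R).
Hypotheses (h0 : 0 < h) (hd : h < d).
Hypothesis acute_c : forall t t', `|t - t'| < d -> acute (c t) (c t').
Implicit Types (z : int) (t : R).

Let e z := sgip (c (z%:~R * h)) (c ((z + 1)%:~R * h)).

(** The sign carried from grid point 0 to grid point [z]. On the negative side [e (Negz i)] compares
    the grid points $-i-1$ and $-i$. *)
Definition grid_sign z : R :=
  match z with Posz n => \prod_(i < n) e (Posz i) | Negz n => \prod_(i < n.+1) e (Negz i) end.

Lemma grid_e z : e z * e z = 1.
Proof.
apply: sgip_sqr; apply: acute_c; rewrite intrD.
by rewrite (_ : _ - _ = - h); [rewrite normrN gtr0_norm|ring].
Qed.

Lemma grid_sign_sqr z : grid_sign z * grid_sign z = 1.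
Proof. by case: z => n; rewrite /grid_sign -big_split big1 // => i _; exact: grid_e. Qed.

Lemma grid_sign_step z : grid_sign (z + 1) = grid_sign z * e z.
Proof.
case: z => [n|[|n]].
- by rewrite -PoszD addn1 /grid_sign big_ord_recr.
- by rewrite (_ : Negz 0 + 1 = Posz 0) // /grid_sign big_ord0 big_ord1 grid_e.
- rewrite (_ : Negz n.+1 + 1 = Negz n) //; last by rewrite !NegzE -[in LHS]addn1 PoszD opprD subrK.
  by rewrite /grid_sign [in RHS]big_ord_recr /= -mulrA grid_e mulr1.
Qed.

Definition lift_sign t : R :=
  let z := Num.floor (t / h) in grid_sign z * sgip (c (z%:~R * h)) (c t).

Lemma floor_cell t (z := Num.floor (t / h)) : z%:~R * h <= t < (z + 1)%:~R * h.
Proof. by rewrite -ler_pdivlMr // -ltr_pdivrMr // Num.Theory.floor_itv. Qed.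

Lemma cell_floor t z : z%:~R * h <= t < (z + 1)%:~R * h -> Num.floor (t / h) = z.
Proof. by rewrite -ler_pdivlMr // -ltr_pdivrMr // => /Num.Theory.floor_def. Qed.

(** This writes the cocycle [sgip] as a coboundary along the line. As [t' < t + h], both parameters
    lie in one cell or in adjacent ones, and [sgip_cocycle] applies through the common grid
    point. *)
Lemma lift_sign_loc t t' : t <= t' -> t' < t + h -> lift_sign t * lift_sign t' = sgip (c t) (c t').
Proof.
move=> tt tth; have := floor_cell t; rewrite /lift_sign; set z := Num.floor _.
have [x xE] : exists x : R, x = z%:~R * h by exists (z%:~R * h).
have xE1 : (z + 1)%:~R * h = x + h by rewrite intrD mulr1z mulrDl mul1r xE.
have xE2 : (z + 1 + 1)%:~R * h = x + h + h by rewrite intrD mulr1z mulrDl mul1r xE1.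
rewrite -xE xE1 => /andP[z1 z2]; set p := c x.
have near (a b : R) : b - d < a -> a < b + d -> acute (c a) (c b).
  by move=> h1 h2; apply: acute_c; rewrite ltr_norml; apply/andP; split; lra.
have dd : 0 < d by exact: lt_trans hd.
have [h0' hd'] := (h0, hd).
have pt : acute p (c t) by apply: near; lra.
have [lt|ge] := ltP t' (x + h).
  have -> : Num.floor (t' / h) = z by apply: cell_floor; rewrite -xE xE1 (le_trans z1 tt).
  have pt' : acute (c t) (c t') by apply: near; lra.
  rewrite -xE -/p -(sgip_cocycle pt pt').
  have -> (a b f : R) : a * b * (a * (b * f)) = (a * a) * (b * b) * f by ring.
  by rewrite grid_sign_sqr sgip_sqr // !mul1r.
have -> : Num.floor (t' / h) = z + 1.
  by apply: cell_floor; rewrite xE1 xE2 ge /=; lra.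
rewrite grid_sign_step xE1; set q := c (x + h).
have tq : acute (c t) q by apply: near; lra.
have qt' : acute q (c t') by apply: near; lra.
have eE : e z = sgip p (c t) * sgip (c t) q by rewrite sgip_cocycle // /e -xE xE1.
rewrite eE -(sgip_cocycle tq qt').
have -> (a b f g : R) : a * b * (a * (b * f) * g) = (a * a) * (b * b) * (f * g) by ring.
by rewrite grid_sign_sqr sgip_sqr // !mul1r.
Qed.

Lemma lift_sign_sqr t : lift_sign t * lift_sign t = 1.
Proof.
rewrite lift_sign_loc ?ltrDl // sgip_refl; by [].
Qed.

Lemma lift_sign_near t t' : `|t - t'| < h -> lift_sign t * lift_sign t' = sgip (c t) (c t').
Proof.
rewrite ltr_norml => /andP[h1 h2]; have [le|/ltW le] := leP t t'.
  by apply: lift_sign_loc => //; lra.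
by rewrite mulrC sgipC; apply: lift_sign_loc => //; lra.
Qed.

Lemma lift_sign_grid (n : nat) :
  lift_sign (n%:R * h) = \prod_(i < n) sgip (c (i%:R * h)) (c (i.+1%:R * h)).
Proof.
rewrite /lift_sign mulfK ?gt_eqF //.
rewrite (_ : Num.floor n%:R = Posz n); last by rewrite (Num.Theory.intrKfloor (Posz n)).
rewrite sgip_refl mulr1 /grid_sign; apply: eq_bigr => i _.
by rewrite /e -PoszD addn1.
Qed.

End SignChoice.

(** * Smoothness of the direction up to sign *)

Section SmoothLift.
Variables (R : realType) (c : R -> P2 R).
Hypothesis c_smooth : smooth_curve c.
Implicit Types (t : R) (p : P2 R).

Lemma chart_exists p : exists2 A : 'M[R]_3, A \in unitmx & in_chart A p.
Proof.
have nz := rep_neq0 p; rewrite /in_chart.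
have [e0|e0] := eqVneq (rep p 0 0) 0; last by exists 1%:M; rewrite ?unitmx1 // hcoordE mulmx1.
have [e1|e1] := eqVneq (rep p 0 1) 0; last first.
  exists (mx3 0 1 0 1 0 0 0 0 1); first by apply: mx3_unit; rewrite /det3; apply/eqP; lra.
  by rewrite hcoordE mulmx3E !mxE /= !mulr0 mulr1 add0r addr0.
have [e2|e2] := eqVneq (rep p 0 2%:R) 0; last first.
  exists (mx3 0 0 1 0 1 0 1 0 0); first by apply: mx3_unit; rewrite /det3; apply/eqP; lra.
  by rewrite hcoordE mulmx3E !mxE /= !mulr0 mulr1 !add0r.
move: nz; rewrite [rep p]vec3_eta e0 e1 e2 (_ : vec3 0 0 0 = 0) ?eqxx //.
by apply/rowP => j; rewrite !mxE; case: j => -[|[|[|//]]].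
Qed.

Lemma in_chart_near A p : in_chart A p -> \forall q \near p, in_chart A q.
Proof.
move=> p0; pose F (v : 'rV[R]_3) := (v *m A) 0 0 * (v *m A) 0 0.
have cF : continuous F by apply: contM; exact: continuous_coord.
have FE v : (0 < F v) = ((v *m A) 0 0 != 0).
  by rewrite /F -expr2 lt_neqAle sqr_ge0 andbT eq_sym sqrf_eq0.
have FZ v k : k != 0 -> 0 < F v -> 0 < F (k *: v).
  move=> k0 Fv; have -> : F (k *: v) = k ^+ 2 * F v by rewrite /F -!scalemxAl !mxE; ring.
  exact: (mulr_gt0 (sqr_pos k0) Fv).
have : nbhs p [set q : P2 R | 0 < F (rep q)].
  by apply: open_nbhs_nbhs; split; [exact: open_P2 (open_pos cF) FZ|rewrite /= FE].
by apply: filterS => q /=; rewrite FE.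
Qed.

(** A product of two entries is even in the representative: the unknown factor cancels and a
    rational function of the affine coordinates remains. *)
Lemma udir_chart A p i j (B := invmx A)
    (w := fun i => B 0 i + chart_x A p * B 1 i + chart_y A p * B 2%:R i) : A \in unitmx ->
  in_chart A p -> udir p i * udir p j = w i * w j / (w 0 * w 0 + w 1 * w 1 + w 2%:R * w 2%:R).
Proof.
move=> uA p0; pose k := hcoord A p 0 0.
have rE l : rep p 0 l = k * w l.
  rewrite -[rep p](mulmxK uA) -hcoordE mulmx3E /w -/B /chart_x /chart_y -/k.
  by field; exact: p0.
have dE : dot3 (rep p) (rep p) = k ^+ 2 * (w 0 * w 0 + w 1 * w 1 + w 2%:R * w 2%:R).
  by rewrite /dot3 !rE; ring.
have d0 := dot3_gt0 (rep_neq0 p).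
rewrite /udir !rE mulf_div -expr2 sqr_sqrtr ?(ltW d0) // dE.
move: d0; rewrite dE pmulr_rgt0 ?sqr_pos // => d0.
field; rewrite (gt_eqF d0) /=; exact: p0.
Qed.

Lemma smooth_udir t0 : exists2 e, 0 < e &
  forall i j, smooth_on (ball t0 e) (fun t => udir (c t) i * udir (c t) j).
Proof.
have [cc ch] := c_smooth; have [A uA p0] := chart_exists (c t0).
have [/smooth_nearP[e1 e10 sx] /smooth_nearP[e2 e20 sy]] := ch A t0 uA p0.
have N : \forall t \near t0, in_chart A (c t) := cc _ _ (in_chart_near p0).
have [e3 e30 h3] := near_gap N.
pose e := Num.min (Num.min e1 e2) e3.
have [e0 ee1 ee2 ee3] : [/\ 0 < e, e <= e1, e <= e2 & e <= e3].
  by rewrite /e !lt_min e10 e20 e30 !ge_min !lexx !orbT.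
exists e => // i j; have oB : open (ball t0 e) by exact: ball_open.
have sx' : smooth_on (ball t0 e) (chart_x A \o c) by apply: smooth_sub sx => s; exact: le_ball.
have sy' : smooth_on (ball t0 e) (chart_y A \o c) by apply: smooth_sub sy => s; exact: le_ball.
pose B := invmx A.
pose w i t := B 0 i + (chart_x A \o c) t * B 1 i + (chart_y A \o c) t * B 2%:R i.
have sw l : smooth_on (ball t0 e) (w l).
  by apply: (smoothD oB (smoothD oB _ (smoothM oB sx' _)) (smoothM oB sy' _)); exact: smooth_cst.
have inB t : ball t0 e t -> in_chart A (c t).
  by rewrite ball_itv // => /andP[a b]; have [l r] := gap_le ee3 a b; exact: h3.
apply: (smooth_eq oB (f := fun t => w i t * w j t * (w 0 t * w 0 t + w 1 t * w 1 t + w 2%:R t * w 2%:R t)^-1)).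
  by move=> t /inB tA; rewrite (udir_chart i j uA tA).
apply: (smoothM oB (smoothM oB (sw i) (sw j))); apply: (smoothV oB); last first.
  exact: (smoothD oB (smoothD oB (smoothM oB (sw 0) (sw 0)) (smoothM oB (sw 1) (sw 1))) (smoothM oB (sw 2%:R) (sw 2%:R))).
move=> t /inB tA; apply/eqP => E; have := ipp (c t); rewrite /ip !(udir_chart _ _ uA tA).
rewrite -/B -/(w 0 t) -/(w 1 t) -/(w 2%:R t) E invr0 !mulr0 !addr0 => /esym/eqP.
by rewrite oner_eq0.
Qed.

End SmoothLift.

(** * The smooth periodic lift *)

Section PeriodicLift.
Variables (R : realType) (gamma : circle R -> P2 R).
Implicit Types (t : R).
Let c t := gamma (angle t).
Let oT : open [set: R] := @openT R.

Lemma smooth_local (f : R -> R) : (forall t0, exists2 e, 0 < e & smooth_on (ball t0 e) f) ->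
  smooth_on setT f.
Proof.
move=> h; apply/smooth_onP => n s _; have [e e0 /smooth_onP se] := h s.
by apply: se; exact: ballxx.
Qed.

Lemma smooth_shift (f : R -> R) a : smooth_on setT f -> smooth_on setT (fun t => f (t + a)).
Proof.
move=> sf n; apply: (Cn_comp (g := fun t => t + a) oT oT _ (sf n)) => //.
by apply: CnD => //; [exact: Cn_id|exact: Cn_cst].
Qed.

Lemma lift_exists : smooth_curve c -> null_homotopic R gamma ->
  exists G0 G1 G2, hlift gamma 1%:M G0 G1 G2 /\
    forall t, [/\ G0 (t + 2 * pi) = G0 t, G1 (t + 2 * pi) = G1 t & G2 (t + 2 * pi) = G2 t].
Proof.
move=> sc /uniform_homotopy[K [y [d [d0 aK pK K0 K1]]]].
have p0 : 0 < 2 * pi :> R by rewrite mulr_gt0 // pi_gt0.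
(* The mesh [h] divides the period, so the grid closes up after [N] steps, and it is finer than
   [d]. *)
pose N := (Num.trunc (2 * pi / d)).+1; pose h : R := 2 * pi / N%:R.
have N0 : (0 : R) < N%:R by rewrite ltr0n.
have h0 : 0 < h by rewrite divr_gt0.
have hd : h < d.
  have : 2 * pi / d < N%:R by exact: truncnS_gt.
  by rewrite ltr_pdivrMr // /h ltr_pdivrMr // [d * _]mulrC.
have Nh : N%:R * h = 2 * pi by rewrite /h mulrC divfK // gt_eqF.
have loop r : K (N%:R * h) r = K 0 r by rewrite Nh -[in LHS](add0r (2 * pi)) pK.
have mono := monodromy d0 h0 hd aK loop K1.
have ac t t' : `|t - t'| < d -> acute (c t) (c t').
  by move=> tt; rewrite /c -!K0; apply: aK; rewrite ?lexx ?ler01 // subrr normr0.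
pose s := lift_sign c h; pose G j t := s t * udir (c t) j.
have ss t : s t * s t = 1 by exact: (lift_sign_sqr h0 hd ac).
have s0 : s 0 = 1.
  by have := lift_sign_grid c h0 0; rewrite mul0r big_ord0.
have s2p : s (2 * pi) = 1.
  rewrite -Nh /s lift_sign_grid //; under eq_bigr do rewrite /c -!K0; exact: mono.
have cp t : c (t + 2 * pi) = c t by rewrite /c angle_period.
have GG i j t : G i t * G j t = udir (c t) i * udir (c t) j.
  by rewrite /G mulrACA ss mul1r.
have Gn t : G 0 t * G 0 t + G 1 t * G 1 t + G 2%:R t * G 2%:R t = 1 by rewrite !GG; exact: ipp.
pose P t0 t := G 0 t0 * G 0 t + G 1 t0 * G 1 t + G 2%:R t0 * G 2%:R t.
have PE t0 t : P t0 t = s t0 * s t * ip (c t0) (c t) by rewrite /P /G /ip; ring.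
have Ppos t0 t : `|t0 - t| < h -> 0 < P t0 t.
  move=> tt; rewrite PE /s (lift_sign_near h0 hd ac tt) /sgip -sgr_gt0 !sgrM sgr_id -expr2 sqr_sg.
  by rewrite acute_neq0 //; apply: ac; exact: lt_trans hd.
have sG j : smooth_on setT (G j).
  apply: smooth_local => t0.
  (* [G t] is recovered from the smooth matrix [G t (G t)^T], applied to [G t0]. *)
  have [e e0 S] := smooth_udir sc t0.
  have oU : open (ball t0 (Num.min e h)) by exact: ball_open.
  have r0 : 0 < Num.min e h by rewrite lt_min e0.
  exists (Num.min e h) => //.
  have Sm i k : smooth_on (ball t0 (Num.min e h)) (fun t => udir (c t) i * udir (c t) k).
    by apply: smooth_sub (S i k) => t; apply: le_ball; rewrite ge_min lexx.
  have Pp t : ball t0 (Num.min e h) t -> 0 < P t0 t.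
    by rewrite /ball /= lt_min => /andP[_]; exact: Ppos.
  pose m i k t := udir (c t) i * udir (c t) k.
  pose n t := lin3 (G 0 t0) (G 1 t0) (G 2%:R t0) (m 0 j) (m 1 j) (m 2%:R j) t.
  pose q t := lin3 (G 0 t0) (G 1 t0) (G 2%:R t0)
    (lin3 (G 0 t0) (G 1 t0) (G 2%:R t0) (m 0 0) (m 1 0) (m 2%:R 0))
    (lin3 (G 0 t0) (G 1 t0) (G 2%:R t0) (m 0 1) (m 1 1) (m 2%:R 1))
    (lin3 (G 0 t0) (G 1 t0) (G 2%:R t0) (m 0 2%:R) (m 1 2%:R) (m 2%:R 2%:R)) t.
  have nE t : n t = P t0 t * G j t by rewrite /n /lin3 /m -!GG /P; ring.
  have qE t : q t = P t0 t ^+ 2 by rewrite /q /lin3 /m -!GG /P; ring.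
  apply: (smooth_eq oU (f := fun t => n t * expR (- (1 / 2) * ln (q t)))).
    move=> t /Pp pt; rewrite nE qE lnXn //.
    have -> (x : R) : - (1 / 2) * (x *+ 2) = - x by rewrite -mulr_natr; field.
    by rewrite expRN lnK ?posrE // mulrAC divff ?mul1r // gt_eqF.
  apply: (smoothM oU); first by apply: smooth_lin3 => //; exact: Sm.
  apply: (smooth_pow _ oU) => [t /Pp pt|]; first by rewrite qE exprn_gt0.
  by do 2 apply: smooth_lin3 => //; exact: Sm.
exists (G 0), (G 1), (G 2%:R); split.
  split; [exact: unitmx1|by split; exact: sG|] => t.
  exists (Num.sqrt (dot3 (rep (c t)) (rep (c t))) * s t).
    apply: mulf_neq0; first by rewrite gt_eqF // sqrt_dot3.
    by apply/eqP => st; have := ss t; rewrite st mul0r => /esym/eqP; rewrite oner_eq0.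
  rewrite hcoordE mulmx1 vec3Z [LHS]vec3_eta /G.
  have n0 : Num.sqrt (dot3 (rep (c t)) (rep (c t))) != 0 by rewrite gt_eqF // sqrt_dot3.
  have E i : Num.sqrt (dot3 (rep (c t)) (rep (c t))) * s t * (s t * udir (c t) i) = rep (c t) 0 i.
    by rewrite -mulrA (mulrA (s t)) ss mul1r /udir mulrC divfK.
  by rewrite !E.
have sp t : s (t + 2 * pi) = s t.
  (* [f] is a smooth function of square 1, hence constant; the monodromy gives its value 1 at 0. *)
  pose f u := G 0 u * G 0 (u + 2 * pi) + G 1 u * G 1 (u + 2 * pi) + G 2%:R u * G 2%:R (u + 2 * pi).
  have fE u : f u = s u * s (u + 2 * pi).
    rewrite /f /G cp -[RHS]mulr1 -(ipp (c u)) /ip; ring.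
  have sf : smooth_on setT f.
    have sGG j : smooth_on setT (fun u => G j u * G j (u + 2 * pi)).
      by apply: smoothM => //; exact: smooth_shift.
    exact: (smoothD oT (smoothD oT (sGG 0) (sGG 1)) (sGG 2%:R)).
  have f0 : f 0 = 1 by rewrite fE add0r s0 s2p mulr1.
  have ff u : f u * f u = 1.
    by rewrite fE mulrACA !ss mulr1.
  have fn u : f u != 0.
    by apply/eqP => fu; have := ff u; rewrite fu mul0r => /esym/eqP; rewrite oner_eq0.
  have : 0 < f 0 * f t.
    have n0 := normr_ge0 t; have n1 := ler_norm t; have := ler_norm (- t); rewrite normrN => n2.
    have [i1 i2 i3 i4] : [/\ - (`|t| + 1) < 0, 0 < `|t| + 1, - (`|t| + 1) < t & t < `|t| + 1].
      by split; lra.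
    have cf u : {for u, continuous f} by exact: (smooth_continuous sf).
    exact: (@nonzero_sign R f _ _ (fun u _ _ => cf u) (fun u _ _ => fn u) _ _ i1 i2 i3 i4).
  rewrite f0 mul1r => ft.
  have f1 : f t = 1 by have := ff t; nra.
  apply: (@mulfI _ (s t)); last by rewrite -fE f1 ss.
  by apply/eqP => st; have := ss t; rewrite st mul0r => /esym/eqP; rewrite oner_eq0.
by move=> t; rewrite /G cp sp.
Qed.

End PeriodicLift.

(** * Counting special points *)

Section Shift.
Variable R : realType.
Implicit Types (f w : R -> R) (t a : R).

Lemma der_shift f t a (d : R) : der f (t + a) d -> der (fun t => f (t + a)) t d.
Proof.
move=> df; have D : der (fun t => t + a) t 1 by der_auto; rewrite /=; ring.
by apply: (der_eq (der_comp (g := fun t => t + a) df D)); rewrite mulr1.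
Qed.

Lemma solves_shift (U P : set R) al be w (w1 w2 : R -> R) a : (forall t, P t -> U (t + a)) ->
  solves U al be w w1 w2 -> solves P (fun t => al (t + a)) (fun t => be (t + a))
    (fun t => w (t + a)) (fun t => w1 (t + a)) (fun t => w2 (t + a)).
Proof. by move=> PU S t /PU Ut; have [d0 d1 d2] := S _ Ut; split; exact: der_shift. Qed.

Lemma derive1_periodic f a : smooth_on setT f -> (forall t, f (t + a) = f t) ->
  forall t, derive1 f (t + a) = derive1 f t.
Proof.
move=> sf per t; apply: (der_unique (f := f) (t := t)); last exact: (smooth_der sf).
apply: (der_near (f := fun t => f (t + a))); first by near=> s; rewrite per.
by apply: der_shift; exact: (smooth_der sf).
Unshelve. all: by end_near. Qed.

End Shift.

Section Counting.
Variables (R : realType) (gamma : circle R -> P2 R).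
Implicit Types (t p : R).
Let c t := gamma (angle t).
Let C := range gamma.
Let oT : open [set: R] := @openT R.
Hypothesis gamma_inj : injective gamma.
Hypothesis gamma_smooth : smooth_curve c.
Hypothesis gamma_regular : regular_curve c.

(** If the derivative of the lift were a multiple [k] of the lift, every quotient of coordinates
    would have derivative zero at [t], against regularity in a chart. *)
Lemma cross_of_regular M G0 G1 G2 t : hlift gamma M G0 G1 G2 -> cross_at G0 G1 G2 t.
Proof.
move=> L [h1 h2 h3]; have [uM [s0 s1 s2] _] := L.
have [k [k0 k1 k2]] := cross_parallel (lift_neq0 (t := t) L) h1 h2 h3.
have [A uA p0] := chart_exists (c t).
have uN : invmx M *m A \in unitmx by rewrite unitmx_mul unitmx_inv uM.
have := lift_mul L uN; rewrite mulKVmx //.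
set N := invmx M *m A; set K0 := lin3 _ _ _ _ _ _; set K1 := lin3 _ _ _ _ _ _.
set K2 := lin3 _ _ _ _ _ _ => LK.
have [_ [t0s t1s t2s] hK] := LK.
have K0n : K0 t != 0.
  have [l l0 E'] := hK t; move: p0; rewrite /in_chart E' vec3Z vec3E.
  by apply: contra_neq => ->; rewrite mulr0.
have N0 : \forall s \near t, K0 s != 0.
  have n0 : nbhs (K0 t) [set x | x != 0] by apply: open_nbhs_nbhs; split=> //; exact: open_neq.
  exact: (smooth_continuous t0s I) _ n0.
have dlin a b e : der (lin3 a b e G0 G1 G2) t (k * lin3 a b e G0 G1 G2 t).
  apply: (der_eq (smooth_der (smooth_lin3 a b e oT s0 s1 s2) I)).
  by rewrite (derive1_lin3 a b e s0 s1 s2) // /lin3 k0 k1 k2; ring.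
have dquot a b e : der (fun s => lin3 a b e G0 G1 G2 s / K0 s) t 0.
  apply: (der_eq (derM (dlin a b e) (derV K0n (dlin _ _ _)))); rewrite -/K0.
  by field.
apply: (gamma_regular uA p0); split; apply: der_val.
- apply: (der_near (f := fun s => K1 s / K0 s)); last exact: dquot.
  by apply: filterS N0 => s sn; have [_ <- _] := lift_chart LK sn.
- apply: (der_near (f := fun s => K2 s / K0 s)); last exact: dquot.
  by apply: filterS N0 => s sn; have [_ _ <-] := lift_chart LK sn.
Qed.

Lemma three_sextactic M G0 G1 G2 p : hlift gamma M G0 G1 G2 ->
  (forall t, [/\ G0 (t + 2 * pi) = G0 t, G1 (t + 2 * pi) = G1 t & G2 (t + 2 * pi) = G2 t]) ->
  (forall t, p < t -> t < p + 2 * pi -> 0 < wronski3 G0 G1 G2 t) ->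
  exists t1 t2 t3, [/\ p < t1, t1 < t2, t2 < t3, t3 < p + 2 * pi &
    [/\ sextactic_point C (c t1), sextactic_point C (c t2) & sextactic_point C (c t3)]].
Proof.
move=> L per D; have cr := cross_of_regular (t := p) L.
have [M' [H0 [H1 [H2 [L' [a0 a1 a2] [b0 b1 b2] perH [k k0 W]]]]]] := frame_lift L cr.
have [_ [s0 s1 s2] _] := L'.
have sD : smooth_on setT (wronski3 H0 H1 H2) by exact: smooth_wronski3.
have [psi [al [be]]] := hat_exists s0 s1 s2.
set U := [set t | _ < _] => H.
have oU : open U by apply: open_gt0 => t; apply: (smooth_continuous sD).
have L0 : 0 < 2 * pi :> R by rewrite mulr_gt0 // pi_gt0.
pose P : set R := [set t | 0 < t < 2 * pi].
have PU t : P t -> U (t + p).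
  move=> /andP[t1 t2]; rewrite /U /= W mulr_gt0 //; apply: D; first by rewrite ltrDr.
  by rewrite addrC ltrD2l.
have ds f t : smooth_on setT f -> der (fun t => f (t + p)) t (derive1 f (t + p)).
  by move=> sf; apply: der_shift; exact: (smooth_der sf).
have dsU f t : smooth_on U f -> P t -> der (fun t => f (t + p)) t (derive1 f (t + p)).
  by move=> sf /PU Ut; apply: der_shift; exact: (smooth_der sf).
have sq : smooth_on U (fun t => al t - derive1 be t / 2).
  apply: smoothB => //; first exact: hat_al H.
  by apply: smoothM => //; [exact: smooth_d (hat_be H)|exact: smooth_cst].
have perp : forall t, [/\ H0 (t + 2 * pi + p) = H0 (t + p), H1 (t + 2 * pi + p) = H1 (t + p) &
    H2 (t + 2 * pi + p) = H2 (t + p)].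
  by move=> t; rewrite addrAC; exact: (perH _ per).
(* The parameter is shifted by [p], so that the base point is at 0, where the lift of [frame_lift]
   has the initial values that [three_zeros] expects. *)
have [|t1 [t2 [t3 [i1 i2 i3 i4 [q1 q2 q3]]]]] := @three_zeros R (2 * pi)
  (fun t => H0 (t + p)) (fun t => H1 (t + p)) (fun t => H2 (t + p))
  (fun t => derive1 H0 (t + p)) (fun t => derive1 H1 (t + p)) (fun t => derive1 H2 (t + p))
  (fun t => derive1 (derive1 H0) (t + p)) (fun t => derive1 (derive1 H1) (t + p))
  (fun t => derive1 (derive1 H2) (t + p)) L0
  (fun t => ds _ t s0) (fun t => ds _ t s1) (fun t => ds _ t s2)
  (fun t => ds _ t (smooth_d s0)) (fun t => ds _ t (smooth_d s1)) (fun t => ds _ t (smooth_d s2))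
  (fun t => let: And3 e _ _ := perp t in e) (fun t => let: And3 _ e _ := perp t in e)
  (fun t => let: And3 _ _ e := perp t in e)
  (etrans (congr1 H0 (add0r p)) a0) (etrans (congr1 H1 (add0r p)) a1)
  (etrans (congr1 H2 (add0r p)) a2) (etrans (congr1 (derive1 H1) (add0r p)) b1)
  (etrans (congr1 (derive1 H2) (add0r p)) b2)
  (fun t h1 h2 => PU t (introT andP (conj h1 h2)))
  _ (fun t => psi (t + p)) (fun t => derive1 psi (t + p)) (fun t => al (t + p))
  (fun t => be (t + p)) (fun t => derive1 be (t + p)) _ _ _ _ _ _
  (fun t Pt => hat_gt0 H (PU t Pt)) (fun t Pt => dsU _ t (hat_psi H) Pt)
  (solves_shift PU (hat_solves0 H)) (solves_shift PU (hat_solves1 H))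
  (solves_shift PU (hat_solves2 H)) (fun t Pt => hat_det H (PU t Pt))
  (fun t Pt => dsU _ t (hat_be H) Pt) (fun t Pt => der_continuous (dsU _ t sq Pt)).
  move=> s t l st ts; apply: (lift_simple gamma_inj L' (s := s + p) (t := t + p)); first by rewrite ltrD2r.
  by rewrite addrAC ltrD2r.
have sx t : 0 < t -> t < 2 * pi -> al (t + p) - derive1 be (t + p) / 2 = 0 ->
    sextactic_point C (c (t + p)).
  move=> h1 h2; apply: (sextactic_of_lift gamma_inj _ L' oU H); first exact: gamma_smooth.1.
  by apply: PU; rewrite /P /= h1.
have lt2 : t2 < 2 * pi by exact: lt_trans i4.
have gt2 : 0 < t2 by exact: lt_trans i2.
exists (t1 + p), (t2 + p), (t3 + p); split; first by rewrite ltrDr.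
- by rewrite ltrD2r.
- by rewrite ltrD2r.
- by rewrite [p + _]addrC ltrD2r.
- split; [apply: sx q1 => //; exact: lt_trans lt2|exact: sx q2|apply: sx q3 => //; exact: lt_trans i3].
Qed.

End Counting.

Section FourPoints.
Variables (R : realType) (gamma : circle R -> P2 R).
Implicit Types (t p : R).
Let c t := gamma (angle t).
Let C := range gamma.
Let oT : open [set: R] := @openT R.
Hypothesis gamma_inj : injective gamma.
Hypothesis gamma_smooth : smooth_curve c.
Hypothesis gamma_regular : regular_curve c.

Let special t := sextactic_point C (c t) \/ inflection_point C (c t).

Lemma four_points t1 t2 t3 t4 : t1 < t2 -> t2 < t3 -> t3 < t4 -> t4 < t1 + 2 * pi ->
  special t1 -> special t2 -> special t3 -> special t4 ->
  (`I_4 #<= [set p | C p /\ (sextactic_point C p \/ inflection_point C p)])%card.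
Proof.
move=> h12 h23 h34 h41 s1 s2 s3 s4.
pose T i := nth t4 [:: t1; t2; t3] i.
have inj i j : (i < j < 4)%N -> c (T i) <> c (T j).
  move=> ij /gamma_inj; suff [h1 h2] : T i < T j /\ T j < T i + 2 * pi by exact: angle_inj.
  case: i j ij => [|[|[|[|i]]]] [|[|[|[|j]]]] //= ij; rewrite /T /=; split;
    by [lra|case/andP: ij].
have Tinj : set_inj `I_4 (fun i => c (T i)).
  move=> i j; rewrite !inE /= => i4 j4 E; have [ij|ji|//] := ltngtP i j; exfalso.
    by apply: (inj i j) E; rewrite ij.
  by apply: (inj j i); rewrite ?ji ?E.
have /Pinj[f fE] := Tinj.
rewrite -(card_le_eql (card_image f)); apply: subset_card_le => _ [i i4 <-]; rewrite -fE; split.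
  by exists (angle (T i)).
by case: i i4 => [|[|[|[|i]]]].
Qed.

(** Negating one homogeneous coordinate is a change of frame that reverses the sign of the
    determinant, so arcs with [D < 0] reduce to arcs with [D > 0]. *)
Lemma flip_lift M G0 G1 G2 : hlift gamma M G0 G1 G2 ->
  exists M' H0 H1 H2, [/\ hlift gamma M' H0 H1 H2,
    forall t, wronski3 H0 H1 H2 t = - wronski3 G0 G1 G2 t &
    forall a, (forall t, [/\ G0 (t + a) = G0 t, G1 (t + a) = G1 t & G2 (t + a) = G2 t]) ->
        forall t, [/\ H0 (t + a) = H0 t, H1 (t + a) = H1 t & H2 (t + a) = H2 t]].
Proof.
move=> L; have [_ [s0 s1 s2] _] := L.
have d1 : det3 (-1) 0 0 0 1 0 0 0 1 = -1 :> R by rewrite /det3; ring.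
have [|M' L'] := lift_lin3 (p := -1) (q := 0) (r := 0) (p' := 0) (q' := 1) (r' := 0)
  (p'' := 0) (q'' := 0) (r'' := 1) L; first by rewrite d1 oppr_eq0 oner_eq0.
do 4 eexists; split; first exact: L'.
- by move=> t; rewrite (wronski3_lin3 _ _ _ _ _ _ _ _ _ oT s0 s1 s2) // d1 mulN1r.
- by move=> a per t; have [g0 g1 g2] := per t; rewrite /lin3 g0 g1 g2.
Qed.

Lemma arc_sextactic M G0 G1 G2 t1 t2 : hlift gamma M G0 G1 G2 -> t1 < t2 ->
  wronski3 G0 G1 G2 t1 = 0 -> wronski3 G0 G1 G2 t2 = 0 ->
  (forall t, t1 < t -> t < t2 -> 0 < wronski3 G0 G1 G2 t) ->
  exists t, [/\ t1 < t, t < t2 & sextactic_point C (c t)].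
Proof.
move=> L t12 D1 D2 D; have [_ [s0 s1 s2] _] := L.
have sD : smooth_on setT (wronski3 G0 G1 G2) by exact: smooth_wronski3.
have [psi [al [be]]] := hat_exists s0 s1 s2.
set U := [set t | _ < _] => H.
have oU : open U by apply: open_gt0 => t; apply: (smooth_continuous sD).
have cr t := cross_of_regular gamma_regular (t := t) L.
have [t [h1 h2 q0]] := arc_zero s0 s1 s2 oU H t12 D1 D2 (cr t1) (cr t2) D.
exists t; split=> //; apply: (sextactic_of_lift gamma_inj _ L oU H) => //.
  exact: gamma_smooth.1.
exact: D.
Qed.

Lemma wronski_sign M G0 G1 G2 a b : hlift gamma M G0 G1 G2 -> a < b ->
  (forall t, a < t -> t < b -> wronski3 G0 G1 G2 t != 0) ->
  (forall t, a < t -> t < b -> 0 < wronski3 G0 G1 G2 t) \/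
  (forall t, a < t -> t < b -> 0 < - wronski3 G0 G1 G2 t).
Proof.
move=> [_ [s0 s1 s2] _] ab D0.
have sD : smooth_on setT (wronski3 G0 G1 G2) by exact: smooth_wronski3.
have [||s [[->|->] h]] := @sign_on R (wronski3 G0 G1 G2) a b => //.
- by move=> t _ _; exact: (smooth_continuous sD).
- by left=> t h1 h2; have := h t h1 h2; rewrite mul1r.
- by right=> t h1 h2; have := h t h1 h2; rewrite mulN1r.
Qed.

Lemma arc_special M G0 G1 G2 t1 t2 : hlift gamma M G0 G1 G2 -> t1 < t2 ->
  wronski3 G0 G1 G2 t1 = 0 -> wronski3 G0 G1 G2 t2 = 0 ->
  exists t, [/\ t1 < t, t < t2 & special t].
Proof.
move=> L t12 D1 D2.
have [[t [h1 h2 D0]]|nz] := pselect (exists t, [/\ t1 < t, t < t2 & wronski3 G0 G1 G2 t = 0]).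
  exists t; split=> //; right; apply: (inflection_of_lift gamma_inj L) => //.
  exact: (cross_of_regular gamma_regular L).
have [|D|D] := wronski_sign L t12; first by move=> t h1 h2; apply/eqP => D0; apply: nz; exists t.
  have [t [h1 h2 h3]] := arc_sextactic L t12 D1 D2 D; exists t; split=> //; by left.
have [M' [H0 [H1 [H2 [L' W _]]]]] := flip_lift L.
have [||t|t [h1 h2 h3]] := arc_sextactic L' t12; rewrite ?W ?D1 ?D2 ?oppr0 //; first exact: D.
by exists t; split=> //; left.
Qed.

Lemma three_special M G0 G1 G2 p : hlift gamma M G0 G1 G2 ->
  (forall t, [/\ G0 (t + 2 * pi) = G0 t, G1 (t + 2 * pi) = G1 t & G2 (t + 2 * pi) = G2 t]) ->
  (forall t, p < t -> t < p + 2 * pi -> wronski3 G0 G1 G2 t != 0) ->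
  exists t1 t2 t3, [/\ p < t1, t1 < t2, t2 < t3, t3 < p + 2 * pi &
    [/\ sextactic_point C (c t1), sextactic_point C (c t2) & sextactic_point C (c t3)]].
Proof.
move=> L per nz; have pp : p < p + 2 * pi by rewrite ltrDl mulr_gt0 // pi_gt0.
have [D|D] := wronski_sign L pp nz; first exact: (three_sextactic gamma_inj gamma_smooth gamma_regular L per D).
have [M' [H0 [H1 [H2 [L' W perH]]]]] := flip_lift L.
apply: (three_sextactic gamma_inj gamma_smooth gamma_regular L' (perH _ per)).
by move=> t h1 h2; rewrite W; exact: D.
Qed.

Lemma wronski3_periodic (G0 G1 G2 : R -> R) a : smooth_on setT G0 -> smooth_on setT G1 ->
  smooth_on setT G2 -> (forall t, [/\ G0 (t + a) = G0 t, G1 (t + a) = G1 t & G2 (t + a) = G2 t]) ->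
  forall t, wronski3 G0 G1 G2 (t + a) = wronski3 G0 G1 G2 t.
Proof.
move=> s0 s1 s2 per t.
have p0 : forall t, G0 (t + a) = G0 t by move=> u; have [] := per u.
have p1 : forall t, G1 (t + a) = G1 t by move=> u; have [] := per u.
have p2 : forall t, G2 (t + a) = G2 t by move=> u; have [] := per u.
have [q0 q1 q2] := And3 (derive1_periodic s0 p0) (derive1_periodic s1 p1) (derive1_periodic s2 p2).
rewrite /wronski3 p0 p1 p2 q0 q1 q2.
by rewrite (derive1_periodic (smooth_d s0) q0) (derive1_periodic (smooth_d s1) q1) (derive1_periodic (smooth_d s2) q2).
Qed.

End FourPoints.

Theorem theorem1p3 (R : realType) (gamma : circle R -> P2 R)
    (gamma_smooth : smooth_curve (fun t : R => gamma (angle t)))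
    (gamma_regular : regular_curve (fun t : R => gamma (angle t)))
    (gamma_simple : injective gamma)
    (gamma_null : null_homotopic R gamma) :
  (`I_4 #<= [set p | range gamma p /\
                     (sextactic_point (range gamma) p \/
                      inflection_point (range gamma) p)])%card.
Proof.
have [G0 [G1 [G2 [L per]]]] := lift_exists gamma_smooth gamma_null.
have [_ [s0 s1 s2] _] := L; set D := wronski3 G0 G1 G2.
have perD t : D (t + 2 * pi) = D t by exact: wronski3_periodic.
have sx := three_special gamma_simple gamma_smooth gamma_regular L per.
have infl t : D t = 0 -> inflection_point (range gamma) (gamma (angle t)).
  move=> Dt; apply: (inflection_of_lift gamma_simple L _ Dt).
  exact: (cross_of_regular gamma_regular L).
have [[t1 [t2 [h1 h2 D1 D2]]]|two] :=
  pselect (exists t1 t2, [/\ t1 < t2, t2 < t1 + 2 * pi, D t1 = 0 & D t2 = 0]).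
  have [u [u1 u2 su]] := arc_special gamma_simple gamma_smooth gamma_regular L h1 D1 D2.
  have D3 : D (t1 + 2 * pi) = 0 by rewrite perD.
  have [v [v1 v2 sv]] := arc_special gamma_simple gamma_smooth gamma_regular L h2 D2 D3.
  by apply: (four_points gamma_simple u1 u2 v1 v2) => //; right; exact: infl.
have [[p Dp]|none] := pselect (exists p, D p = 0).
  have [|t1 [t2 [t3 [h1 h2 h3 h4 [x1 x2 x3]]]]] := sx p.
    by move=> t a b; apply/eqP => Dt; apply: two; exists p, t.
  by apply: (four_points gamma_simple h1 h2 h3 h4); [right; exact: infl|left..].
have nz t : D t != 0 by apply/eqP => Dt; apply: none; exists t.
have [|z [_ [_ [_ _ _ _ [xz _ _]]]]] := sx 0; first by move=> t _ _; exact: nz.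
have [|t1 [t2 [t3 [h1 h2 h3 h4 [x1 x2 x3]]]]] := sx z; first by move=> t _ _; exact: nz.
by apply: (four_points gamma_simple h1 h2 h3 h4); left.
Qed.
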